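(* Let $\alpha\in[0,1]$. Let $X_A(t), X_B(t)\in\mathcal{F}$ be the solutions of the Lagrangian system $$y_t=U,\qquad U_t=\tfrac12 V-\tfrac14\lim_{\xi\to\infty}V(\xi,t),\qquad H_t=0,\qquad V(\xi,t)=\int_{-\infty}^{\xi}V_\xi(\eta,0)\big(1-\alpha\mathbf 1_{\{r\in\mathbb{R}\,:\,t\ge\tau(r)>0\}}(\eta)\big)\,d\eta$$ with initial data $X_A(0), X_B(0)\in\mathcal{F}_0$, respectively. Then, for all $t\ge 0$, $$d_{\mathcal F}(X_A(t),X_B(t))\le e^{\frac32 t}\,d_{\mathcal F}(X_A(0),X_B(0)).$$
   Context: Fix a constant $\alpha\in[0,1]$. Subscripts $\xi$, $t$ denote derivatives, $\mathrm{id}$ is the identity map on $\mathbb{R}$, $\|\cdot\|_p$ is the $L^p(\mathbb{R})$ norm, $a\vee b=\max\{a,b\}$. Function spaces. Fix $\chi^-,\chi^+\in C^\infty(\mathbb{R})$ with $\chi^-+\chi^+=1$, $0\le\chi^+\le1$, $\operatorname{supp}\chi^-\subset(-\infty,1)$, $\operatorname{supp}\chi^+\subset(-1,\infty)$. Let $E_1=\{g+a\chi^+: g\in H^1(\mathbb{R}),a\in\mathbb{R}\}$ and $E_2=\{g+a\chi^++b\chi^-: g\in H^1(\mathbb{R}),a,b\in\mathbb{R}\}$, and $B=E_2\times E_2\times E_1\times E_1$. Lagrangian coordinates. $\mathcal{F}$ is the set of all $X=(y,U,H,V)$ with $(y-\mathrm{id},U,H,V)\in B$ such that: (i) $y-\mathrm{id},U,H,V\in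 W^{1,\infty}(\mathbb{R})$; (ii) $y_\xi,H_\xi\ge0$ and there is a constant $c$ with $0<c<y_\xi+H_\xi$ a.e.; (iii) $y_\xi V_\xi=U_\xi^2$ a.e.; (iv) $0\le V_\xi\le H_\xi$ a.e.; (v) if $\alpha=1$: for a.e. $\xi$, $y_\xi(\xi)=0$ implies $V_\xi(\xi)=0$, and $y_\xi(\xi)>0$ implies $V_\xi(\xi)=H_\xi(\xi)$; (vi) if $0\le\alpha<1$: there is $\kappa:\mathbb{R}\to\{1-\alpha,1\}$ with $V_\xi=\kappa H_\xi$ a.e. and $\kappa(\xi)=1$ whenever $U_\xi(\xi)<0$. Set $\mathcal{F}_0=\{X\in\mathcal{F}: y+H=\mathrm{id}\}$. Wave breaking time. For $X\in\mathcal F$ set $\tau_X(\xi)=-2y_\xi(\xi)/U_\xi(\xi)$ if $U_\xi(\xi)<0$, $\tau_X(\xi)=0$ if $U_\xi(\xi)=0=y_\xi(\xi)$, and $\tau_X(\xi)=+\infty$ otherwise. In the Lagrangian system, $\tau=\tau_{X(0)}$ is computed from the initial data $X(0)$; for each $X(0)\in\mathcal F$ the system has a unique solution $X(t)=(y,U,H,V)(\cdot,t)\in\mathcal{F}$, $t\ge0$ (known). Relabelling. $G$ is the group of homeomorphisms $f:\mathbb{R}\to\mathbb{R}$ with $f-\mathrm{id}, f^{-1}-\mathrm{id}\in W^{1,\infty}(\mathbb{R})$ and $f_\xi-1\in L^2(\mathbb{R})$. For $X\in\mathcal F$, $f\in G$ put $X\bullet f=(y\circ f,U\circ f,H\circ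 f,V\circ f)$. Define $\Pi:\mathcal{F}\to\mathcal{F}_0$, $\Pi X=X\bullet(y+H)^{-1}$. The function $d$. For $X_1,X_2\in\mathcal F$ let $A_i=\{\xi: U_{i,\xi}(\xi)\ge0\}$, $\Omega_{12}=(A_1\cap A_2)\cup\{\xi: 0<\tau_{X_1}(\xi)=\tau_{X_2}(\xi)<+\infty\}$, and $$G_{12}=|V_{1,\xi}-V_{2,\xi}|\mathbf 1_{\Omega_{12}}+(V_{1,\xi}\vee V_{2,\xi})\mathbf 1_{\Omega_{12}^c}.$$ (Along solutions $X_1(t),X_2(t)$, the second set in $\Omega_{12}$ at time $t$ is $\{\xi: t<\tau_{X_1(0)}(\xi)=\tau_{X_2(0)}(\xi)<+\infty\}$.) Define $$d(X_1,X_2)=\|y_1-y_2\|_\infty+\|U_1-U_2\|_\infty+\|y_{1,\xi}-y_{2,\xi}\|_2+\|U_{1,\xi}-U_{2,\xi}\|_2+\|H_1-H_2\|_\infty+\|G_{12}\|_1+\|G_{12}\|_2.$$ The metric $d_{\mathcal F}$. Set $J(X_1,X_2)=\inf_{f,g\in G}\big(d(X_1,X_2\bullet f)+d(X_1\bullet g,X_2)\big)$ and $$d_{\mathcal F}(X_A,X_B)=\inf\sum_{n=1}^N J(X_n,X_{n-1}),$$ the infimum being over all finite sequences $\{X_n\}_{n=0}^N$ in $\mathcal F_0$ of arbitrary length with $X_0=\Pi X_A$ and $X_N=\Pi X_B$. *)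

(* Defs.v *)
From HB Require Import structures.
From mathcomp Require Import all_boot all_order all_algebra.
From mathcomp Require Import all_classical all_reals all_analysis.

Set Implicit Arguments.
Unset Strict Implicit.
Unset Printing Implicit Defensive.
Import Order.TTheory GRing.Theory Num.Theory.
Import numFieldNormedType.Exports.
Local Open Scope classical_set_scope.
Local Open Scope ring_scope.

(* In ring_scope this notation otherwise denotes the derivative of a polynomial. *)
Local Notation "f ^` ()" := (derive1 f) : ring_scope.

Section FunctionSpaces.
Context {R : realType}.
Implicit Types f g phi : R -> R.

Local Notation mu := (@lebesgue_measure R).

Definition supp f : set R := closure [set x | f x != 0].

Definition smooth f := forall (n : nat) (x : R), derivable (derive1n n f) x 1.

Definition test_function phi := smooth phi /\ compact (supp phi).

Definition weak_derivative f g := forall phi, test_function phi ->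
  \int[mu]_x (f x * phi^`() x) = - \int[mu]_x (g x * phi x).

(* The Sobolev space W^{1,p}(R) as a set of functions: every class is
   represented by its continuous element, since values, compositions and sup
   norms of these functions are taken pointwise. *)
Definition sobolev1 (p : \bar R) : set (R -> R) :=
  [set f | [/\ continuous f, f \in Lfun mu p &
    exists2 g, g \in Lfun mu p & weak_derivative f g]].

Definition H1 : set (R -> R) := sobolev1 2%:E.
Definition W1oo : set (R -> R) := sobolev1 +oo%E.

Record cutoffs (chim chip : R -> R) : Prop := Cutoffs {
  cutoffs_smoothm : smooth chim;
  cutoffs_smoothp : smooth chip;
  cutoffs_sum : forall x, chim x + chip x = 1;
  cutoffs_bound : forall x, 0 <= chip x <= 1;
  cutoffs_suppm : supp chim `<=` `]-oo, 1[;
  cutoffs_suppp : supp chip `<=` `]-1, +oo[ }.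

Definition E1 (chip : R -> R) : set (R -> R) :=
  [set f | exists g a, H1 g /\ f = (fun x => g x + a * chip x)].

Definition E2 (chim chip : R -> R) : set (R -> R) :=
  [set f | exists g a b,
    H1 g /\ f = (fun x => g x + a * chip x + b * chim x)].

End FunctionSpaces.

Record lag (R : realType) := Lag {
  ly : R -> R;
  lU : R -> R;
  lH : R -> R;
  lV : R -> R }.

Section Lagrangian.
Context {R : realType}.
Variables (alpha : R) (chim chip : R -> R).
Implicit Types X Y : lag R.

Local Notation mu := (@lebesgue_measure R).

Definition inB X :=
  [/\ E2 chim chip (ly X), E2 chim chip (lU X), E1 chip (lH X) &
      E1 chip (lV X)].

(* Spatial derivatives are the pointwise derivatives ^`(); for W^{1,oo}
   functions they exist a.e. and are the weak derivatives. *)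
Record inF X : Prop := InF {
  inF_B : inB (Lag (fun x => ly X x - x) (lU X) (lH X) (lV X));
  inF_y : W1oo (fun x => ly X x - x);
  inF_U : W1oo (lU X);
  inF_H : W1oo (lH X);
  inF_V : W1oo (lV X);
  inF_ge0 : {ae mu, forall x, 0 <= (ly X)^`() x /\ 0 <= (lH X)^`() x};
  inF_gt0 : exists2 c : R, 0 < c &
    {ae mu, forall x, c < (ly X)^`() x + (lH X)^`() x};
  inF_eq : {ae mu, forall x, (ly X)^`() x * (lV X)^`() x = (lU X)^`() x ^+ 2};
  inF_VH : {ae mu, forall x, 0 <= (lV X)^`() x <= (lH X)^`() x};
  inF_alpha1 : alpha = 1 -> {ae mu, forall x,
    ((ly X)^`() x = 0 -> (lV X)^`() x = 0) /\
    (0 < (ly X)^`() x -> (lV X)^`() x = (lH X)^`() x)};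
  inF_alphalt1 : 0 <= alpha < 1 -> exists kappa : R -> R,
    [/\ forall x, kappa x = 1 - alpha \/ kappa x = 1,
        {ae mu, forall x, (lV X)^`() x = kappa x * (lH X)^`() x} &
        forall x, (lU X)^`() x < 0 -> kappa x = 1] }.

Definition F : set (lag R) := [set X | inF X].

Definition F0 : set (lag R) :=
  [set X | F X /\ forall x, ly X x + lH X x = x].

Definition breaking_time X (x : R) : \bar R :=
  if (lU X)^`() x < 0 then (- 2 * (ly X)^`() x / (lU X)^`() x)%:E
  else if ((lU X)^`() x == 0) && ((ly X)^`() x == 0) then 0%E
  else +oo%E.

(* The energy V is discontinuous in time, so that the ODEs y_t = U and
   U_t = V/2 - V(+oo)/4 are understood, for each label, in integrated form. *)
Record lag_system (X : R -> lag R) : Prop := LagSystem {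
  lag_system_y : forall t x : R, 0 <= t ->
    ly (X t) x = ly (X 0) x + \int[mu]_(s in `[0, t]) lU (X s) x;
  lag_system_U : forall t x : R, 0 <= t ->
    lU (X t) x = lU (X 0) x + \int[mu]_(s in `[0, t])
      (2^-1 * lV (X s) x - 4^-1 * lim (lV (X s) z @[z --> +oo]));
  lag_system_H : forall t x : R, 0 <= t -> lH (X t) x = lH (X 0) x;
  lag_system_V : forall t x : R, 0 <= t ->
    lV (X t) x = \int[mu]_(z in `]-oo, x])
      ((lV (X 0))^`() z *
       (1 - alpha * \1_[set r : R | (0 < breaking_time (X 0%R) r)%E /\
                                (breaking_time (X 0%R) r <= t%:E)%E] z)) }.

Definition lag_solution (X : R -> lag R) :=
  lag_system X /\ forall t : R, 0 <= t -> F (X t).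

Definition relabelling : set (R -> R) :=
  [set f | exists g : R -> R,
    [/\ cancel f g, cancel g f, continuous f & continuous g] /\
    [/\ W1oo (fun x => f x - x), W1oo (fun x => g x - x) &
        (fun x => f^`() x - 1) \in Lfun mu 2%:E]].

Definition relabel X (f : R -> R) : lag R :=
  Lag (ly X \o f) (lU X \o f) (lH X \o f) (lV X \o f).

(* 'pinv_ is the library's inverse function: here the inverse of y + H, which
   is a bijection of R whenever X is in F. *)
Definition Pi X : lag R :=
  relabel X ('pinv_(fun=> 0) [set: R] (fun x => ly X x + lH X x)).

Definition Omega X1 X2 : set R :=
  ([set x | 0 <= (lU X1)^`() x] `&` [set x | 0 <= (lU X2)^`() x]) `|`
  [set x | [/\ (0 < breaking_time X1 x)%E,
               breaking_time X1 x = breaking_time X2 x &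
               (breaking_time X2 x < +oo)%E]].

Definition G12 X1 X2 (x : R) : R :=
  `|(lV X1)^`() x - (lV X2)^`() x| * \1_(Omega X1 X2) x +
  Num.max ((lV X1)^`() x) ((lV X2)^`() x) * \1_(~` Omega X1 X2) x.

Definition Lpnorm (p : \bar R) (f : R -> R) : \bar R := 'N[mu]_p[EFin \o f].

(* d, J and d_F take values in [0, +oo]. *)
Definition d X1 X2 : \bar R :=
  (Lpnorm +oo (ly X1 \- ly X2)%R + Lpnorm +oo (lU X1 \- lU X2)%R
   + Lpnorm 2%:E ((ly X1)^`() \- (ly X2)^`())%R
   + Lpnorm 2%:E ((lU X1)^`() \- (lU X2)^`())%R
   + Lpnorm +oo (lH X1 \- lH X2)%R
   + Lpnorm 1%:E (G12 X1 X2) + Lpnorm 2%:E (G12 X1 X2))%E.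

Definition J X1 X2 : \bar R :=
  ereal_inf [set (d X1 (relabel X2 f) + d (relabel X1 g) X2)%E
            | f in relabelling & g in relabelling].

Definition dF XA XB : \bar R :=
  ereal_inf [set e | exists (N : nat) (X : nat -> lag R),
    [/\ forall n, (n <= N)%N -> F0 (X n), X 0%N = Pi XA, X N = Pi XB &
        e = (\sum_(1 <= n < N.+1) J (X n) (X n.-1))%E]].

End Lagrangian.

(* Main.v *)
From HB Require Import structures.
Require Import Defs.
From mathcomp Require Import all_boot all_order all_algebra.
From mathcomp Require Import all_classical all_reals all_analysis.
From mathcomp Require Import measurable_realfun lra.

(** Differentiated with respect to the label, the system is an ordinary
    differential equation at each label for [p = y_xi], [u = U_xi],
    [w = V_xi], with the invariant [p * w = u ^+ 2]. The energy density [w]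
    is an explicit function of the initial data: it drops by the factor
    [1 - alpha] at the breaking time [tau = - 2 * p / u] of a label with
    [u < 0]. Hence solutions are obtained by integrating twice in time, which
    gives a solution operator [evolve] ([lag_system_evolve]), defined on a
    class of data that all relabellings preserve ([admissible]). The estimate
    follows from three properties of [evolve].

    First, it commutes with relabelling ([evolve_relabel]), since breaking
    times do not depend on the parametrization.

    Second, it expands [d] by at most the factor [expR t] ([d_evolve]). At a
    label where the two solutions break at the same time, or never, they lose
    the same fraction of their energies; elsewhere [G12] is the larger of the
    two energies. So [G12] does not increase ([gap_dynamics]), and it controls
    the difference of the forces, also after integration in time ([mass1_gap],
    [mass2_gap]). The seven terms of [d] then grow by polynomials in [t] that
    are at most [expR t] ([expR_coefs]).

    Third, it does not compress labels much: if [y + H = id] at time 0, then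
    the slope of [y + H] at time [t] is at least the inverse of
    [1 + t + t ^+ 2 / 2] ([dynamics_lower], [evolve_slope]). So the relabelling
    that projects the solution back to [F0] has a Lipschitz constant of at most
    [expR t]. It leaves the sup norms and the 1-norm in [d] unchanged and
    multiplies the 2-norms by at most [expR (t / 2)] ([d_relabel_le]).

    Therefore relabellings that compete in [J X Y] yield relabellings that
    compete in [J] between the projected solutions, with a loss of at most
    [expR (3 / 2 * t)] ([J_evolve]); and projecting the solutions that start
    from a chain in [F0] gives a chain between the solutions at time [t].

    The analytic part represents the function spaces by Lipschitz functions
    and their pointwise derivatives. A Lipschitz function is the primitive of
    its derivative, by Radon-Nikodym for the Lebesgue-Stieltjes measure of
    [f + L * id] ([lipschitz_FTC]). A continuous function with a locally
    integrable weak derivative is the primitive of the latter, with rescaled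
    cutoffs as test functions ([weak_derivative_primitive]). This describes
    [W1oo], [H1], [E1] and [E2] ([W1ooP], [H1P], [E1P], [E2P]). *)

Set Implicit Arguments.
Unset Strict Implicit.
Unset Printing Implicit Defensive.
Import Order.TTheory GRing.Theory Num.Theory.
Import numFieldNormedType.Exports.
Local Open Scope classical_set_scope.
Local Open Scope ring_scope.

(* derivatives of functions, not of polynomials *)
Local Notation "f ^` ()" := (derive1 f) : ring_scope.

(** * Borel measurability of pointwise derivatives *)

Section DerivativeMeasurability.
Context {R : realType}.
Implicit Types f g : R -> R.
Local Notation mu := (@lebesgue_measure R).

Let dquot f (h x : R) : R := h^-1 * (f (h + x) - f x).

Let dquot_cauchy f (k m : nat) : set R :=
  [set x | forall h h', h != 0 -> h' != 0 -> `|h| < m.+1%:R^-1 ->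
     `|h'| < m.+1%:R^-1 -> `|dquot f h x - dquot f h' x| <= k.+1%:R^-1].

Lemma derivable_dquot f x : derivable f x 1 <->
  cvg (dquot f h x @[h --> 0^']).
Proof.
rewrite /derivable /dquot /=.
by under eq_fun do rewrite /= [_ *: 1]mulr1.
Qed.

(** Differentiability is the Cauchy criterion for the difference quotient at
    0. With tolerances [1/(k+1)] and radii [1/(m+1)] it is a countable
    combination of sets, which are closed when [f] is continuous. *)
Lemma derivable_cauchyE f : [set x | derivable f x 1] =
  \bigcap_k \bigcup_m dquot_cauchy f k m.
Proof.
apply/seteqP; split => x /=.
  move=> /derivable_dquot /cauchy_cvgP/cauchy_ballP fc k _.
  have k0 : (0 : R) < k.+1%:R^-1 by rewrite invr_gt0.
  have := fc _ k0; rewrite near_map2 => -[[A B]/=[/= [e e0 eA] [e' e'0 eB]] AB].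
  have [m me] : exists m : nat, m.+1%:R^-1 < Num.min e e'.
    have [m _ Hm] := @near_infty_natSinv_lt R (PosNum (ltac:(by rewrite lt_min e0 e'0) : 0 < Num.min e e')).
    by exists m; apply: Hm => /=.
  exists m => // h h' h0 h'0 hm h'm.
  have /= := AB (h,h').
  rewrite /ball /= => /(_ _)/ltW; apply; split.
    apply: eA => //=; rewrite sub0r normrN (lt_trans hm)// (lt_le_trans me)//.
    by rewrite ge_min lexx.
  apply: eB => //=; rewrite sub0r normrN (lt_trans h'm)// (lt_le_trans me)//.
  by rewrite ge_min lexx orbT.
move=> H; apply/derivable_dquot/cauchy_cvgP/cauchy_exP => e e0.
have [k _ Hk] := @near_infty_natSinv_lt R (PosNum e0).
have [m _ Hm] := H k I.
pose h0 : R := m.+2%:R^-1.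
have h00 : 0 < h0 by rewrite invr_gt0.
exists (dquot f h0 x); rewrite /nbhs /=; near=> h; rewrite /ball /=.
apply: (le_lt_trans (Hm _ _ _ _ _ _)).
- by rewrite gt_eqF.
- by near: h; exact: nbhs_dnbhs_neq.
- by rewrite gtr0_norm// ltf_pV2 ?posrE// ltr_nat.
- by near: h; apply: dnbhs0_lt; rewrite invr_gt0.
- exact: (Hk k (leqnn k)).
Unshelve. all: by end_near. Qed.

Lemma continuous_dquot f h : continuous f -> continuous (dquot f h).
Proof.
move=> cf x; apply: cvgM; first exact: cvg_cst.
apply: cvgB; last exact: cf.
apply: (@continuous_comp _ _ _ (fun z => h + z) f); last exact: cf.
by apply: cvgD; [exact: cvg_cst|exact: cvg_id].
Qed.

Lemma closed_dquot_cauchy f k m : continuous f -> closed (dquot_cauchy f k m).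
Proof.
move=> cf.
have -> : dquot_cauchy f k m = \bigcap_(p in [set p : R * R | [/\ p.1 != 0, p.2 != 0, `|p.1| < m.+1%:R^-1 & `|p.2| < m.+1%:R^-1]])
   ((fun x => `|dquot f p.1 x - dquot f p.2 x|) @^-1` [set y | y <= k.+1%:R^-1]).
  apply/seteqP; split => x /= H.
    by move=> [h h'] /= []; exact: H.
  by move=> h h' *; apply: (H (h, h')).
apply: closed_bigI => -[h h'] _ /=.
apply: preimage_closed; last exact: closed_le.
move=> x _; apply: cvg_norm.
by apply: cvgB; exact: continuous_dquot.
Qed.

Lemma measurable_derivable f : continuous f ->
  measurable [set x | derivable f x 1].
Proof.
move=> cf; rewrite derivable_cauchyE; apply: bigcap_measurable => // k _.
by apply: bigcup_measurable => m _; apply: closed_measurable; exact: closed_dquot_cauchy.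
Qed.

(** The limit of a divergent filter is the default point of the real line, 0. *)
Lemma derive1_Nderivable f x : ~ derivable f x 1 -> f^`() x = 0.
Proof.
move=> /derivable_dquot nd; rewrite /derive1 /=.
by rewrite dvgP.
Qed.

(** On the Borel set where [f] is differentiable, the derivative is the limit
    of the difference quotients of step [1/(n+1)]; elsewhere it is 0. *)
Lemma measurable_derive1 f : continuous f -> measurable_fun setT f^`().
Proof.
move=> cf.
pose D := [set x | derivable f x 1].
have mD : measurable D by exact: measurable_derivable.
apply: (@measurable_realfun.measurable_fun_cvg _ _ _ _
   (fun n => (fun x => dquot f n.+1%:R^-1 x * \1_D x)) f^`()).
  move=> n; apply: measurable_funM; last exact: measurable_indic.
  by apply: continuous_measurable_fun; exact: continuous_dquot.
move=> x _; have [Dx|nDx] := pselect (D x).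
  under eq_fun do rewrite indicE mem_set// mulr1.
  have /derivable_dquot dx := Dx.
  apply: (cvg_comp (fun n => n.+1%:R^-1) (dquot f ^~ x) _ dx).
  move=> A [e /= e0 eA]; have [m _ Hm] := @near_infty_natSinv_lt R (PosNum e0).
  exists m => // n /Hm /= ne; apply: eA => //=.
  by rewrite sub0r normrN gtr0_norm.
under eq_fun do rewrite indicE memNset// mulr0.
rewrite derive1_Nderivable//; exact: cvg_cst.
Qed.
End DerivativeMeasurability.

(** * Lipschitz functions: derivative almost everywhere and fundamental theorem *)

Definition lipschitz_with {R : realType} (L : R) (f : R -> R) :=
  forall x y, `|f x - f y| <= L * `|x - y|.

Definition lipschitzian {R : realType} (f : R -> R) :=
  exists L, lipschitz_with L f.

Section LipschitzFTC.
Context {R : realType}.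
Implicit Types (f g : R -> R) (L : R).
Local Notation mu := (@lebesgue_measure R).

Lemma ae_imp (P Q : R -> Prop) : (forall x, P x -> Q x) ->
  {ae mu, forall x, P x} -> {ae mu, forall x, Q x}.
Proof. by move=> PQ; apply: filterS; first exact: (ae_filter_ringOfSetsType mu). Qed.

Lemma ae_and (P Q : R -> Prop) : {ae mu, forall x, P x} ->
  {ae mu, forall x, Q x} -> {ae mu, forall x, P x /\ Q x}.
Proof. by apply: filterS2 => //; exact: (ae_filter_ringOfSetsType mu). Qed.

Lemma lipschitz_with_ge0 L f : lipschitz_with L f -> 0 <= L.
Proof.
move=> fL; have := fL 1 0; rewrite subr0 normr1 mulr1; apply: le_trans.
exact: normr_ge0.
Qed.

Lemma lipschitz_withN L f : lipschitz_with L f -> lipschitz_with L (fun x => - f x).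
Proof. by move=> fL x y; rewrite -opprD normrN; exact: fL. Qed.

Lemma lipschitz_with_cts L f : lipschitz_with L f -> continuous f.
Proof.
move=> fL x; have L0 := lipschitz_with_ge0 fL.
have L1 : 0 < L + 1 by rewrite ltr_wpDl.
apply/cvgrPdist_le => e e0; apply/nbhs_ballP; exists (e / (L + 1)) => /=.
  by rewrite divr_gt0.
move=> y; rewrite /ball/= ltr_pdivlMr// => xy.
apply: (le_trans (fL x y)); apply: le_trans (ltW xy).
by rewrite mulrC ler_wpM2l// lerDl.
Qed.

Lemma lipschitzian_cts f : lipschitzian f -> continuous f.
Proof. by move=> [L /lipschitz_with_cts]. Qed.

Lemma lipschitz_with_derive1 L f x : lipschitz_with L f -> `|f^`() x| <= L.
Proof.
move=> fL; have L0 := lipschitz_with_ge0 fL.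
have [/derivable_dquot dx|nd] := pselect (derivable f x 1); last first.
  by rewrite derive1_Nderivable// normr0.
have : (fun h => `|h^-1 * (f (h + x) - f x)|) @ 0^' --> `|f^`() x|.
  by apply: cvg_norm; exact: dx.
move=> H; rewrite -(cvg_lim (@Rhausdorff R) H).
apply: limr_le; first by apply/cvg_ex; eexists; exact: H.
near=> h => /=; have h0 : h != 0 by near: h; exact: nbhs_dnbhs_neq.
rewrite normrM normfV ler_pdivrMl ?normr_gt0// mulrC.
by have := fL (h + x) x; rewrite addrK.
Unshelve. all: by end_near. Qed.

Lemma lebesgue_stieltjes_measure_oc (F : cumulative R R) a b : a <= b ->
  lebesgue_stieltjes_measure F `]a, b] = (F b - F a)%:E.
Proof.
move=> ab; rewrite /lebesgue_stieltjes_measure/= /measure_extension/=.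
rewrite measurable_mu_extE/=; last exact: is_ocitv.
by rewrite wlength_itv_bnd.
Qed.

Lemma lebesgue_oc (a b : R) : a <= b -> mu `]a, b] = (b - a)%:E.
Proof.
move=> ab; rewrite lebesgue_measure_itv/= lte_fin; case: ltP => // ba.
by have -> : a = b by [apply/eqP; rewrite eq_le ab ba]; rewrite subrr.
Qed.

Lemma lebesgue_cc (a b : R) : a <= b -> mu `[a, b] = (b - a)%:E.
Proof.
move=> ab; rewrite lebesgue_measure_itv/= lte_fin; case: ltP => // ba.
by have -> : a = b by [apply/eqP; rewrite eq_le ab ba]; rewrite subrr.
Qed.

(** Adding [L * x] makes an [L]-Lipschitz function nondecreasing, so that it
    has a Lebesgue-Stieltjes measure. *)
Let tilt L f x := f x + L * x.

Let tilt_nd L f : lipschitz_with L f -> {homo tilt L f : x y / x <= y}.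
Proof.
move=> fL x y xy; rewrite /tilt -subr_ge0.
have := fL x y; rewrite ler_norml distrC ger0_norm ?subr_ge0// => /andP[_].
lra.
Qed.

Let tilt_rc L f : lipschitz_with L f -> forall x, tilt L f @ x^'+ --> tilt L f x.
Proof.
move=> fL x; apply: cvg_within_filter; rewrite /tilt.
apply: cvgD; first exact: (lipschitz_with_cts fL).
by apply: cvgM; [exact: cvg_cst|exact: cvg_id].
Qed.

Let tiltC L f (fL : lipschitz_with L f) : cumulative R R :=
  HB.pack (tilt L f) (isCumulative.Build R _ R (tilt L f) (tilt_nd fL) (tilt_rc fL)).

(** The Stieltjes measures of the tilts of [f] and of [- f] add up to [2 L]
    times the Lebesgue measure, so both of them vanish on null sets. *)
Let null_tilt L f (fL : lipschitz_with L f) A : measurable A -> mu A = 0%E ->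
  lebesgue_stieltjes_measure (tiltC fL) A = 0%E.
Proof.
move=> mA A0.
have idL : lipschitz_with L (fun x => L * x).
  move=> x y; rewrite -mulrBr normrM ger0_norm//; exact: lipschitz_with_ge0 fL.
pose m1 := lebesgue_stieltjes_measure (tiltC fL).
pose m2 := lebesgue_stieltjes_measure (tiltC (lipschitz_withN fL)).
have L20 : 0 <= 2 * L by rewrite mulr_ge0// (lipschitz_with_ge0 fL).
have E1 : lebesgue_stieltjes_measure (tiltC idL) A = measure_add m1 m2 A.
  apply: lebesgue_stieltjes_measure_unique => // X /ocitvP[->|[[a b] ab ->]].
    by rewrite !measure0.
  have H1 := lebesgue_stieltjes_measure_oc (tiltC fL) (ltW ab).
  have H2 := lebesgue_stieltjes_measure_oc (tiltC (lipschitz_withN fL)) (ltW ab).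
  have H3 := lebesgue_stieltjes_measure_oc (tiltC idL) (ltW ab).
  rewrite [RHS]measure_addE H3 [X in (_ = X + _)%E]H1 [X in (_ = _ + X)%E]H2 /=.
  by rewrite /tilt -EFinD; congr EFin; lra.
have E2 : lebesgue_stieltjes_measure (tiltC idL) A = mscale (NngNum L20) mu A.
  apply: lebesgue_stieltjes_measure_unique => // X /ocitvP[->|[[a b]/= ab ->]].
    by rewrite !measure0.
  rewrite lebesgue_stieltjes_measure_oc ?(ltW ab)//=.
  transitivity ((2 * L)%:E * mu `]a, b])%E => //.
  by rewrite lebesgue_oc ?(ltW ab)// /tilt -EFinM; congr EFin; lra.
move: E2; rewrite E1 measure_addE /mscale/= A0 mule0 => /eqP.
by rewrite padde_eq0// => /andP[/eqP].
Qed.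

(** Radon-Nikodym, for the Stieltjes measure restricted to a bounded window,
    where it is finite. *)
Let window_density L f (fL : lipschitz_with L f) (n : nat) :
  exists h : R -> R, [/\ mu.-integrable setT (EFin \o h) &
    forall x, - n%:R <= x <= n%:R ->
     tilt L f x - tilt L f (- n%:R) = \int[mu]_(t in `]-oo, x]) h t].
Proof.
pose W : set (measurableTypeR R) := `]- (n%:R : R), n%:R]%classic.
have mW : measurable W by exact: measurable_itv.
have Woo : (lebesgue_stieltjes_measure (tiltC fL) W < +oo)%E.
  rewrite lebesgue_stieltjes_measure_oc ?ltry//.
  by rewrite (@le_trans _ _ 0)// oppr_le0.
pose nu := mfrestr mW Woo.
have dom : nu `<< mu.
  apply/null_content_dominatesP => A mA A0.
  rewrite /nu/= /mfrestr/= /mrestr/= null_tilt//; first exact: measurableI.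
  by apply/eqP; rewrite eq_le measure_ge0 andbT -A0 le_measure ?inE//; exact: measurableI.
have [h [h0 hf hi hE]] := radon_nikodym_sigma_finite dom.
have hfE : EFin \o (fine \o h) = h by apply/funext => x /=; rewrite fineK.
exists (fine \o h); split; first by rewrite hfE.
move=> x /andP[nx xn].
rewrite /Rintegral.
under eq_integral do rewrite /= fineK//.
rewrite -hE//.
rewrite /nu /= /mfrestr /mrestr /=.
have -> : `]-oo, x] `&` W = `]- n%:R, x]%classic.
  apply/seteqP; split => z; rewrite /W/= !in_itv/=.
    by move=> [-> /andP[->]].
  by move=> /andP[-> zx]; rewrite zx (le_trans zx).
by rewrite lebesgue_stieltjes_measure_oc.
Qed.

(** On a window the tilt of [f] is the primitive of its Radon-Nikodym density
    [h], so that Lebesgue differentiation gives the derivative almost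
    everywhere. *)
Lemma lipschitz_ae_window L f n : lipschitz_with L f ->
  exists h : R -> R, [/\ mu.-integrable setT (EFin \o h),
    {ae mu, forall x, - n%:R < x < n%:R -> derivable f x 1 /\ f^`() x = h x - L} &
    forall x, - n%:R <= x <= n%:R ->
     f x + L * x - (f (- n%:R) + L * (- n%:R)) = \int[mu]_(t in `]-oo, x]) h t].
Proof.
move=> fL; have [h [ih hE]] := window_density fL n.
exists h; split => //.
have /= := @FTC1Ny _ h.
have lh : locally_integrable setT h.
  by apply: open_integrable_locally => //; exact: openT.
have hy y : mu.-integrable `]-oo, y] (EFin \o h).
  by apply: integrableS ih.
move=> /(_ hy lh).
apply: ae_imp => x [dF F'] /andP[nx xn].
have eqn : {near x, (fun y => f y + (L * y - (f (- n%:R) + L * (- n%:R)))) =1 (fun y => \int[mu]_(t in `]-oo, y]) h t)}.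
  near=> y; rewrite addrA hE//.
  by apply/andP; split; apply: ltW; near: y; [exact: lt_nbhsr|exact: lt_nbhsl].
have [dG G'] : derivable (fun y => f y + (L * y - (f (- n%:R) + L * (- n%:R)))) x 1 /\ 'D_1 (fun y => f y + (L * y - (f (- n%:R) + L * (- n%:R)))) x = h x.
  split; first by apply: near_eq_derivable dF; near=> y; apply/esym; near: y.
  by have E := @near_eq_derive _ _ _ _ _ x 1 eqn; rewrite E -derive1E F'.
have dl : is_derive x 1 (fun y => (L * y - (f (- n%:R) + L * (- n%:R)))) L.
  apply: is_derive_eq; rewrite /GRing.scale/=; lra.
have ff : f = (fun y => f y + (L * y - (f (- n%:R) + L * (- n%:R)))) \- (fun y => (L * y - (f (- n%:R) + L * (- n%:R)))).
  by apply/funext => y /=; rewrite addrK.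
split; first by rewrite ff; apply: derivableB; [exact: dG|exact: ex_derive].
by rewrite derive1E {1}ff deriveB// G' derive_val.
Unshelve. all: by end_near. Qed.

Lemma lipschitz_ae_derivable L f : lipschitz_with L f -> {ae mu, forall x, derivable f x 1}.
Proof.
move=> fL.
have H (n : nat) : {ae mu, forall x, - n%:R < x < n%:R -> derivable f x 1}.
  have [h [_ + _]] := lipschitz_ae_window n fL.
  by apply: ae_imp => x /[apply] -[].
have := ae_foralln H; apply: ae_imp => x /(_ (Num.bound `|x|)); apply.
by rewrite -ltr_norml archi_boundP.
Qed.

Lemma bounded_itv_integrable (g : R -> R) C a b : measurable_fun setT g ->
  (forall x, `|g x| <= C) -> mu.-integrable `[a, b] (EFin \o g).
Proof.
move=> mg gC; apply: measurable_bounded_integrable => //.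
- by rewrite /= lebesgue_measure_itv; case: ifP => // _; rewrite ltry.
- exact: measurable_funTS.
- exists C; split; first exact: num_real.
  by move=> M CM x _ /=; rewrite (le_trans (gC x))// ltW.
Qed.

Lemma lipschitz_integrable_derive1 L f a b : lipschitz_with L f ->
  mu.-integrable `[a, b] (EFin \o f^`()).
Proof.
move=> fL; apply: (@bounded_itv_integrable _ L).
  by apply: measurable_derive1; exact: lipschitz_with_cts fL.
by move=> x; exact: lipschitz_with_derive1.
Qed.

(** The increment is the integral of a density, which is the derivative almost
    everywhere, on a window that contains both end points. *)
Lemma lipschitz_FTC L f a b : lipschitz_with L f -> a <= b ->
  \int[mu]_(x in `[a, b]) f^`() x = f b - f a.
Proof.
move=> fL ab.
pose n := Num.bound (Num.max `|a| `|b|).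
have an : - n%:R < a < n%:R.
  rewrite -ltr_norml.
  by apply: le_lt_trans (archi_boundP _); rewrite ?le_max ?lexx// normr_ge0.
have bn : - n%:R < b < n%:R.
  rewrite -ltr_norml.
  by apply: le_lt_trans (archi_boundP _); rewrite ?le_max ?lexx ?orbT// normr_ge0.
have [[na _] [_ nb]] := (andP an, andP bn).
have [h [ih dh Fh]] := lipschitz_ae_window n fL.
have ihb : mu.-integrable `]-oo, b] (EFin \o h) by apply: integrableS ih.
have Eh : \int[mu]_(x in `]a, b]) h x = f b - f a + L * (b - a).
  rewrite -(@Rintegral_itvB _ h -oo%O (BRight b) a)//.
  by rewrite -!Fh//; move: an bn => /andP[? ?] /andP[? ?]; lra.
have ihab : mu.-integrable `]a, b] (EFin \o h) by apply: integrableS ih.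
have ic : mu.-integrable `]a, b] (EFin \o cst L).
  have : mu.-integrable `[a, b] (EFin \o cst L) by exact: (@bounded_itv_integrable _ `|L|).
  by apply: integrableS => // x /=; rewrite !in_itv/= => /andP[/ltW-> ->].
have E2 : \int[mu]_(x in `]a, b]) (h x - L) = f b - f a.
  have cE : \int[mu]_(x in `]a, b]) L = L * (b - a).
    transitivity (L * fine (mu `]a, b])); first exact: Rintegral_cst.
    by rewrite lebesgue_oc.
  by rewrite RintegralB// Eh cE; lra.
rewrite -E2 Rintegral_itv_obnd_cbnd; last exact: (integrableB _ ihab ic).
rewrite /Rintegral; congr fine; apply: ae_eq_integral => //.
- by have /measurable_int := @lipschitz_integrable_derive1 L f a b fL.
- have /measurable_int := ih; move=> /measurable_EFinP mh.
  by apply/measurable_EFinP/measurable_funTS; apply: measurable_funB.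
- apply: ae_imp dh => x H /=.
  rewrite in_itv/= => /andP[ax xb]; have [|_ ->//] := H.
  by rewrite (lt_le_trans na)// (le_lt_trans xb).
Qed.
End LipschitzFTC.

(** * Change of variables under increasing bi-Lipschitz maps *)

Section Density.
Context {R : realType}.
Implicit Types h : R -> R.
Local Notation mu := (@lebesgue_measure R).

(** The hypotheses on [h] are arguments, so that the canonical measure
    structure below can be inferred from the term. *)
Definition density h (h0 : forall x, 0 <= h x) (mh : measurable_fun setT h)
  (A : set (measurableTypeR R)) : \bar R := \int[mu]_(x in A) (h x)%:E.

Section density_measure.
Variables (h : R -> R) (h0 : forall x, 0 <= h x) (mh : measurable_fun setT h).

Let density0 : density h0 mh set0 = 0%E.
Proof. by rewrite /density integral_set0. Qed.

Let density_ge0 A : (0 <= density h0 mh A)%E.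
Proof. by apply: integral_ge0 => x _; rewrite lee_fin. Qed.

Let density_sigma_additive : semi_sigma_additive (density h0 mh).
Proof.
move=> F mF tF mUF; rewrite /density ge0_integral_bigcup//=; last 2 first.
- by apply/measurable_EFinP; exact: measurable_funTS.
- by move=> x _; rewrite lee_fin.
apply: is_cvg_ereal_nneg_natsum_cond => n _ _.
by apply: integral_ge0 => x _; rewrite lee_fin.
Qed.

HB.instance Definition _ := isMeasure.Build _ _ _ (density h0 mh)
  density0 density_ge0 density_sigma_additive.

Import HBNNSimple.

(** Monotone convergence along simple functions reduces the formula to
    indicators. *)
Lemma ge0_integral_density (k : R -> \bar R) : (forall x, 0 <= k x)%E ->
  measurable_fun setT k ->
  (\int[density h0 mh]_x k x = \int[mu]_x (k x * (h x)%:E))%E.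
Proof.
move=> k0 mk.
pose T : measurableType _ := measurableTypeR R.
have mT : measurable (setT : set T) by exact: measurableT.
have mk' : measurable_fun (setT : set T) (k : T -> \bar R) by exact: mk.
pose s := nnsfun_approx mT mk'.
have mh' : measurable_fun (setT : set T) (h : T -> R) by exact: mh.
have mhE : measurable_fun (setT : set T) (EFin \o h : T -> \bar R) by exact/measurable_EFinP.
have msE n : measurable_fun (setT : set T) (EFin \o s n : T -> \bar R) by exact/measurable_EFinP.
have -> : (\int[density h0 mh]_x k x =
    lim (\int[density h0 mh]_x (EFin \o s n) x @[n --> \oo]))%E.
  have kE (x : T) : k x = lim ((EFin \o s n) x @[n --> \oo]).
    by apply/esym/cvg_lim => //; exact: cvg_nnsfun_approx.
  under eq_integral => x _ do rewrite kE.
  apply: monotone_convergence => //.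
  - by move=> n x _; rewrite lee_fin.
  - by move=> x _ a b ab; rewrite lee_fin; exact/lefP/nd_nnsfun_approx.
have -> : (\int[mu]_x (k x * (h x)%:E) =
    lim (\int[mu]_x ((EFin \o s n) x * (h x)%:E) @[n --> \oo]))%E.
  have kE (x : T) : (k x * (h x)%:E = lim ((EFin \o s n) x * (h x)%:E @[n --> \oo]))%E.
    by apply/esym/cvg_lim => //; apply: cvgeZr => //; exact: cvg_nnsfun_approx.
  under eq_integral => x _ do rewrite kE.
  apply: monotone_convergence => //.
  - by move=> n; exact: emeasurable_funM.
  - by move=> n x _; rewrite mule_ge0 ?lee_fin.
  - move=> x _ a b ab; rewrite lee_wpmul2r ?lee_fin//; exact/lefP/nd_nnsfun_approx.
suff suf n : (\int[density h0 mh]_x (EFin \o s n) x =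
    \int[mu]_x ((EFin \o s n) x * (h x)%:E))%E.
  by under eq_fun do rewrite suf.
transitivity (\int[density h0 mh]_x
   (\sum_(y \in range (s n)) (y * \1_(s n @^-1` [set y]) x)%:E))%E.
  by apply: eq_integral => t _; rewrite /= fimfunE -fsumEFin.
have mind r : measurable_fun (setT : set T) (fun x : T => (r * \1_(s n @^-1` [set r]) x)%:E).
  by apply/measurable_EFinP; apply: measurable_funM.
rewrite ge0_integral_fsum//; last by move=> m y _; exact: nnfun_muleindic_ge0.
transitivity (\int[mu]_x (\sum_(y \in range (s n))
    (y * \1_(s n @^-1` [set y]) x)%:E * (h x)%:E))%E; last first.
  apply: eq_integral => x _.
  rewrite -ge0_mule_fsuml => [|y]; last exact: nnfun_muleindic_ge0.
  by rewrite fsumEFin // -(fimfunE _ x).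
rewrite ge0_integral_fsum//; last 2 first.
- by move=> y; apply: emeasurable_funM.
- by move=> m y _; apply: mule_ge0; [exact: nnfun_muleindic_ge0|rewrite lee_fin].
apply: eq_fsbigr => r rs.
have r0 : 0 <= r by move: rs; rewrite inE => -[t _ <-].
under [LHS]eq_integral do rewrite EFinM.
rewrite integralZl_indic_nnsfun//.
under [RHS]eq_integral do rewrite EFinM -muleA.
rewrite ge0_integralZl//; last 2 first.
- have mi : measurable_fun (setT : set T) (fun x : T => (\1_(s n @^-1` [set r]) x : R)%:E).
    by apply/measurable_EFinP.
  exact: (emeasurable_funM mi mhE).
- by move=> t _; rewrite mule_ge0 ?lee_fin.
congr (_ * _)%E.
rewrite integral_indic// setIT.
transitivity (\int[mu]_x ((EFin \o h : T -> \bar R) \_ (s n @^-1` [set r])) x)%E.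
  exact: integral_mkcond.
by apply: eq_integral => x _; rewrite epatch_indic/= muleC.
Qed.
End density_measure.
End Density.

(** The relabellings are the maps of this kind that are close to the identity.
    The inverse is a parameter, which makes the notion symmetric. *)
Record bilipschitz {R : realType} (f g : R -> R) : Prop := Bilipschitz {
  bl_fK : cancel f g;
  bl_gK : cancel g f;
  bl_nd : {homo f : x y / x <= y};
  bl_lip : lipschitzian f;
  bl_lipV : lipschitzian g }.

Section Bilipschitz.
Context {R : realType}.
Implicit Types f g k : R -> R.
Local Notation mu := (@lebesgue_measure R).

Lemma nondecreasing_derive1_ge0 f x : {homo f : x y / x <= y} -> 0 <= f^`() x.
Proof.
move=> nd; have [/derivable_dquot dx|nd'] := pselect (derivable f x 1); last first.
  by rewrite derive1_Nderivable.
apply: limr_ge => //; near=> h => /=.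
have [h0|h0] := leP 0 h.
  by rewrite mulr_ge0 ?invr_ge0// subr_ge0 nd// lerDr.
by rewrite mulr_le0 ?invr_le0 ?(ltW h0)// subr_le0 nd// gerDr ltW.
Unshelve. all: by end_near. Qed.

Lemma bilipschitz_le f g : bilipschitz f g -> {mono f : x y / x <= y}.
Proof.
move=> b; apply: le_mono => x y xy; rewrite lt_neqAle (bl_nd b (ltW xy)) andbT.
by apply/eqP => /(congr1 g); rewrite !(bl_fK b) => xy'; rewrite xy' ltxx in xy.
Qed.

Lemma bilipschitz_sym f g : bilipschitz f g -> bilipschitz g f.
Proof.
move=> b; have [fK gK nd lf lg] := b; split => // x y xy.
by rewrite -(bilipschitz_le b) !gK.
Qed.

(** The Lipschitz constant of the inverse bounds the difference quotients from
    below. *)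
Lemma bilipschitz_derive1_gt0 f g : bilipschitz f g ->
  exists2 c : R, 0 < c & forall x, derivable f x 1 -> c <= f^`() x.
Proof.
move=> b; have [L gL] := bl_lipV b.
have L0 : 0 < L.
  have := gL (f 1) (f 0); rewrite !(bl_fK b) subr0 normr1 => H.
  rewrite lt_neqAle (lipschitz_with_ge0 gL) andbT; apply/eqP => L0.
  by move: H; rewrite -L0 mul0r ler10.
exists L^-1 => [|x /derivable_dquot dx]; first by rewrite invr_gt0.
apply: limr_ge => //; near=> h => /=.
have h0 : h != 0 by near: h; exact: nbhs_dnbhs_neq.
have := gL (f (h + x)) (f x); rewrite !(bl_fK b) addrK => H.
have -> : h^-1 *: (f (h + x) - f x) = `|h|^-1 * `|f (h + x) - f x|.
  have [h1|h1] := leP 0 h.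
    by rewrite ger0_norm// ger0_norm// subr_ge0 (bl_nd b)// lerDr.
  rewrite ltr0_norm// ler0_norm ?subr_le0 ?(bl_nd b)// ?gerDr ?ltW//.
  by rewrite invrN mulrNN.
by rewrite mulrC ler_pdivlMr ?normr_gt0// ler_pdivrMl.
Unshelve. all: by end_near. Qed.

Section bilip.
Variables (f g : R -> R) (b : bilipschitz f g).

Let f'0 x : 0 <= f^`() x. Proof. exact/nondecreasing_derive1_ge0/(bl_nd b). Qed.

Lemma bilipschitz_cts : continuous f.
Proof. exact: lipschitzian_cts (bl_lip b). Qed.

Lemma bilipschitz_measurable : measurable_fun setT f.
Proof. by apply: continuous_measurable_fun; exact: bilipschitz_cts. Qed.

Let mf' : measurable_fun setT f^`().
Proof. by apply: measurable_derive1; exact: bilipschitz_cts. Qed.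

Lemma bilipschitz_preimage_oc x y : f @^-1` `]x, y] = `]g x, g y]%classic.
Proof.
have H z u : (f z <= u) = (z <= g u) by rewrite -{1}(bl_gK b u) (bilipschitz_le b).
by apply/seteqP; split => z /=; rewrite !in_itv/= H !ltNge H.
Qed.

(** Both sides are measures in [A]; on intervals they agree by the fundamental
    theorem. *)
Lemma bilipschitz_measure (A : set R) : measurable A ->
  mu A = (\int[mu]_(x in f @^-1` A) (f^`() x)%:E)%E.
Proof.
move=> mA.
have mf : measurable_fun (setT : set (measurableTypeR R)) (f : measurableTypeR R -> measurableTypeR R).
  exact: bilipschitz_measurable.
pose nu : {measure set (measurableTypeR R) -> \bar R} :=
  pushforward (density f'0 mf') (f : measurableTypeR R -> measurableTypeR R).
rewrite (lebesgue_measure_unique (mu := nu mf))//.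
move=> X /ocitvP[->|[[x y]/= xy ->]].
  by rewrite !measure0.
rewrite [LHS]lebesgue_oc ?(ltW xy)// /nu/= /pushforward bilipschitz_preimage_oc /density.
have gxy : g x <= g y by rewrite -(bilipschitz_le b) !(bl_gK b) ltW.
have [L fL] := bl_lip b.
rewrite integral_itv_obnd_cbnd; last first.
  by apply/measurable_EFinP; exact: measurable_funTS.
rewrite -[LHS]/((y - x)%:E) -{1}(bl_gK b x) -{1}(bl_gK b y) -(lipschitz_FTC fL gxy).
rewrite /Rintegral fineK//; apply: integrable_fin_num => //.
exact: lipschitz_integrable_derive1.
Qed.
End bilip.

(** The preimage of a null set is null by [bilipschitz_measure] for the
    inverse map. *)
Lemma bilipschitz_ae f g (P : R -> Prop) : bilipschitz f g ->
  {ae mu, forall x, P x} -> {ae mu, forall x, P (f x)}.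
Proof.
move=> b [N [mN N0 PN]].
have mfN : measurable (f @^-1` N).
  by rewrite -[_ @^-1` _]setTI; exact: (bilipschitz_measurable b).
exists (f @^-1` N); split => //; last by move=> x /= Px; exact: PN.
rewrite (bilipschitz_measure (bilipschitz_sym b))//.
rewrite (_ : g @^-1` _ = N); last first.
  by apply/seteqP; split => x /=; rewrite (bl_gK b).
apply: null_set_integral => //; apply/measurable_EFinP; apply: measurable_funTS.
by apply: measurable_derive1; exact/bilipschitz_cts/bilipschitz_sym/b.
Qed.

Lemma ge0_bilipschitz_substitution f g (k : R -> \bar R) : bilipschitz f g ->
  (forall x, 0 <= k x)%E -> measurable_fun setT k ->
  (\int[mu]_x k x = \int[mu]_x (k (f x) * (f^`() x)%:E))%E.
Proof.
move=> b k0 mk.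
have f'0 x : 0 <= f^`() x by exact/nondecreasing_derive1_ge0/(bl_nd b).
have mf' : measurable_fun setT f^`() by apply: measurable_derive1; exact: bilipschitz_cts b.
have mf : measurable_fun (setT : set (measurableTypeR R)) (f : measurableTypeR R -> measurableTypeR R).
  exact: bilipschitz_measurable b.
rewrite -(ge0_integral_density f'0 mf')//; last first.
  by apply: measurableT_comp => //; exact: bilipschitz_measurable b.
pose nu : {measure set (measurableTypeR R) -> \bar R} :=
  pushforward (density f'0 mf') (f : measurableTypeR R -> measurableTypeR R).
transitivity (\int[nu mf]_x k x)%E.
  by apply: eq_measure_integral => A mA _; exact: (bilipschitz_measure b).
by rewrite ge0_integral_pushforward// preimage_setT.
Qed.

Lemma bilipschitz_substitution f g k : bilipschitz f g ->
  measurable_fun setT k ->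
  (\int[mu]_x (k x)%:E = \int[mu]_x (k (f x) * f^`() x)%:E)%E.
Proof.
move=> b mk.
have f'0 x : 0 <= f^`() x by exact/nondecreasing_derive1_ge0/(bl_nd b).
rewrite integralE [RHS]integralE; congr (_ - _)%E.
- rewrite (ge0_bilipschitz_substitution b)//; last first.
    by apply: measurable_funepos; exact/measurable_EFinP.
  apply: eq_integral => x _.
  by rewrite !funeposE -!EFin_max -EFinM maxr_pMl// mul0r.
- rewrite (ge0_bilipschitz_substitution b)//; last first.
    by apply: measurable_funeneg; exact/measurable_EFinP.
  apply: eq_integral => x _.
  by rewrite !funenegE -!EFin_max -EFinM maxr_pMl// mul0r mulNr.
Qed.

Lemma bilipschitz_Rsubstitution f g k A : bilipschitz f g ->
  measurable_fun setT k -> measurable A ->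
  \int[mu]_(x in A) k x = \int[mu]_(x in f @^-1` A) (k (f x) * f^`() x).
Proof.
move=> b mk mA; rewrite Rintegral_mkcond [RHS]Rintegral_mkcond /Rintegral.
rewrite (bilipschitz_substitution b)//; last first.
  by apply/(measurable_restrictT _ mA); exact: measurable_funTS.
congr fine; apply: eq_integral => x _; congr EFin.
rewrite !patchE (_ : (x \in f @^-1` A) = (f x \in A)); last by apply/idP/idP; rewrite !inE.
by case: ifPn => // _; rewrite /point/= mul0r.
Qed.
End Bilipschitz.

(** * Square integrable functions *)

Section L2.
Context {R : realType}.
Implicit Types f g : R -> R.
Local Notation mu := (@lebesgue_measure R).
Local Notation L2 f := (f \in Lfun mu 2%:E).

Lemma Lfun2P f : L2 f <->
  measurable_fun setT f /\ (\int[mu]_x (f x ^+ 2)%:E < +oo)%E.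
Proof.
have E : (\int[mu]_x (f x ^+ 2)%:E = 'N[mu]_(2%:E)[EFin \o f] `^ 2)%E.
  rewrite poweR_Lnorm ?pnatr_eq0//; apply: eq_integral => x _.
  by rewrite /= powR_mulrn// real_normK// num_real.
split=> [|[mf foo]].
  rewrite inE => /andP[]; rewrite !inE/= => mf fN; split => //.
  by rewrite E poweR_lty.
apply/andP; split; rewrite inE//= /finite_norm.
rewrite ltey; apply/eqP => Noo; move: foo; rewrite E Noo.
by rewrite poweRyr ?ltxx// pnatr_eq0.
Qed.

Lemma Lfun_measurable p f : f \in Lfun mu p -> measurable_fun setT f.
Proof. by move=> /andP[/[!inE]]. Qed.

Lemma Lfun2D f g : L2 f -> L2 g -> L2 (fun x => f x + g x).
Proof.
have p1 : (1 <= 2%:E :> \bar R)%E by rewrite lee_fin ler1n.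
by move=> Lf Lg; exact: (Lfun_addr_closed mu p1).2.
Qed.

Lemma Lfun2Z f a : L2 f -> L2 (fun x => a * f x).
Proof.
move=> /Lfun2P[mf foo]; apply/Lfun2P; split; first exact: measurable_funM.
under eq_integral do rewrite exprMn EFinM.
rewrite ge0_integralZl//.
- by rewrite lte_mul_pinfty// ?lee_fin ?sqr_ge0.
- by apply/measurable_EFinP; exact: measurable_funX.
- by move=> x _; rewrite lee_fin sqr_ge0.
- by rewrite lee_fin sqr_ge0.
Qed.

Lemma Lfun2B f g : L2 f -> L2 g -> L2 (fun x => f x - g x).
Proof.
move=> Lf Lg; have := Lfun2D Lf (Lfun2Z (-1) Lg).
by under eq_fun do rewrite mulN1r.
Qed.

Lemma Lfun2_le f g : measurable_fun setT f ->
  {ae mu, forall x, `|f x| <= `|g x|} -> L2 g -> L2 f.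
Proof.
move=> mf fg /Lfun2P[mg goo]; apply/Lfun2P; split => //.
apply: le_lt_trans goo; apply: ae_ge0_le_integral => //.
- by move=> x _; rewrite lee_fin sqr_ge0.
- by apply/measurable_EFinP; exact: measurable_funX.
- by move=> x _; rewrite lee_fin sqr_ge0.
- by apply/measurable_EFinP; exact: measurable_funX.
apply: ae_imp fg => x fgx _; rewrite lee_fin -real_normK ?num_real//.
by rewrite -[leRHS]real_normK ?num_real// lerXn2r// nnegrE.
Qed.

Lemma Lfun2_bounded_supp f C a b : measurable_fun setT f ->
  (forall x, `|f x| <= C) -> (forall x, ~ (a <= x <= b) -> f x = 0) -> L2 f.
Proof.
move=> mf fC f0; apply/Lfun2P; split => //.
have mS : measurable_fun setT (EFin \o (fun x => f x ^+ 2)).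
  by apply/measurable_EFinP; exact: measurable_funX.
rewrite (_ : \int[mu]_x _ = \int[mu]_(x in `[a, b]) (f x ^+ 2)%:E)%E; last first.
  rewrite [RHS]integral_mkcond; apply: eq_integral => x _.
  rewrite patchE; case: ifPn => //; rewrite notin_setE/= in_itv/= => /f0 ->.
  by rewrite expr0n.
have : mu.-integrable `[a, b] (EFin \o (fun x => f x ^+ 2)).
  apply: (@bounded_itv_integrable _ _ (C ^+ 2)); first exact: measurable_funX.
  by move=> x; rewrite normrX lerXn2r// nnegrE (le_trans _ (fC x)).
by move=> /integrable_lty; apply.
Qed.

(** The change of variables costs at most the Lipschitz constant of the
    inverse. *)
Lemma Lfun2_comp f h k : bilipschitz h k -> L2 f -> L2 (f \o h).
Proof.
move=> b /Lfun2P[mf foo]; apply/Lfun2P.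
have mh := bilipschitz_measurable b.
have mS : measurable_fun setT (EFin \o (fun x => f x ^+ 2)).
  by apply/measurable_EFinP; exact: measurable_funX.
split; first exact: measurableT_comp.
have [L kL] := bl_lipV b.
rewrite (ge0_bilipschitz_substitution (bilipschitz_sym b))//; last 2 first.
- by move=> x; rewrite lee_fin sqr_ge0.
- by apply: (measurableT_comp mS mh).
apply: (@le_lt_trans _ _ (\int[mu]_x (L%:E * (f x ^+ 2)%:E))%E).
  apply: ge0_le_integral => //.
  - move=> x _; rewrite mule_ge0 ?lee_fin ?sqr_ge0//.
    exact/nondecreasing_derive1_ge0/(bl_nd (bilipschitz_sym b)).
  - apply: emeasurable_funM.
      by apply/measurable_EFinP/measurable_funX; do 2 apply: measurableT_comp => //; exact: bilipschitz_measurable (bilipschitz_sym b).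
    apply/measurable_EFinP; apply: measurable_derive1.
    exact: bilipschitz_cts (bilipschitz_sym b).
  - exact: measurable_funeM.
  - move=> x _; rewrite muleC /= (bl_gK b) lee_wpmul2r ?lee_fin ?sqr_ge0//.
    by rewrite (le_trans (ler_norm _))// lipschitz_with_derive1.
have L0 := lipschitz_with_ge0 kL.
rewrite ge0_integralZl// ?lte_mul_pinfty// ?lee_fin//.
by move=> x _; rewrite lee_fin sqr_ge0.
Qed.

Lemma Lfun2_itv_integrable f a b : L2 f -> mu.-integrable `[a, b] (EFin \o f).
Proof.
move=> Lf.
have L1 : L2 (\1_(`[a, b]) : R -> R).
  apply: (@Lfun2_bounded_supp _ 1 a b).
  - exact: measurable_indic.
  - by move=> x; rewrite indicE; case: (_ \in _); rewrite ?normr1 ?normr0.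
  - by move=> x H; rewrite indicE memNset//= in_itv/=.
have /Lfun1_integrable := Lfun2_mul_Lfun1 Lf L1.
move=> H; rewrite integrable_mkcond//.
apply: eq_integrable H => // x _; rewrite patchE /= indicE.
by case: ifPn; rewrite ?mulr1 ?mulr0.
Qed.

Lemma integrable_itv_locally f : measurable_fun setT f ->
  (forall a b, mu.-integrable `[a, b] (EFin \o f)) ->
  locally_integrable setT f.
Proof.
move=> mf H; split => //; first exact: openT.
move=> K _ cK; have [M [_ HM]] := compact_bounded cK.
have KM : K `<=` `[- (M + 1), M + 1].
  move=> x Kx /=; rewrite in_itv/= -ler_norml; apply: (HM (M + 1)) => //.
  by rewrite ltrDl.
have /integrableP[_ foo] := H (- (M + 1)) (M + 1).
apply: le_lt_trans foo; apply: ge0_subset_integral => //.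
- exact: compact_measurable.
- apply/measurable_EFinP; apply: measurableT_comp => //; exact: measurable_funTS.
Qed.

Lemma is_derive_subcst f (c x a : R) : is_derive x 1 (fun y => f y - c) a ->
  derivable f x 1 /\ f^`() x = a.
Proof.
move=> df; have dc : is_derive x (1 : R) (cst c : R -> R) 0 by exact: is_derive_cst.
have := is_deriveD df dc.
rewrite addr0 (_ : _ + _ = f); last by apply/funext => y /=; rewrite /GRing.add/= subrK.
by move=> dfa; split; [exact: ex_derive|rewrite derive1E derive_val].
Qed.

(** Lebesgue differentiation on the half-lines that start at [- n]. *)
Lemma ae_eq_derive1_primitive f g : measurable_fun setT g ->
  (forall a b, mu.-integrable `[a, b] (EFin \o g)) ->
  (forall a b, a <= b -> f b - f a = \int[mu]_(x in `[a, b]) g x) ->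
  {ae mu, forall x, derivable f x 1 /\ f^`() x = g x}.
Proof.
move=> mg ig fg.
have lg := integrable_itv_locally mg ig.
have H (n : nat) : {ae mu, forall x, - n%:R < x -> derivable f x 1 /\ f^`() x = g x}.
  have := @FTC1 _ g (BLeft (- n%:R)) (fun y => ig _ _) lg.
  apply: ae_imp => x + nx.
  move=> /(_ _)[]; first by rewrite lte_fin.
  set F := (fun y => _) => dF F'.
  have eqn : {near x, F =1 (fun y => f y - f (- n%:R))}.
    by near=> y; rewrite /F -fg// ltW//; near: y; exact: lt_nbhsr.
  have dfc : derivable (fun y => f y - f (- n%:R)) x 1 by apply: near_eq_derivable dF.
  have E := @near_eq_derive _ _ _ _ _ x 1 eqn.
  apply: (@is_derive_subcst _ (f (- n%:R))).
  by apply: DeriveDef => //; rewrite -E -derive1E.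
have := ae_foralln H; apply: ae_imp => x /(_ (Num.bound `|x|)); apply.
by have := archi_boundP (normr_ge0 x); rewrite ltr_norml => /andP[].
Unshelve. all: by end_near. Qed.

End L2.

(** * Smooth functions *)

Section SmoothFunctions.
Context {R : realType}.
Implicit Types f g phi : R -> R.
Local Notation mu := (@lebesgue_measure R).

Lemma derivable_cts f x : derivable f x 1 -> {for x, continuous f}.
Proof. by move=> /derivable1_diffP /differentiable_continuous. Qed.

Lemma smooth_derivable f x : smooth f -> derivable f x 1.
Proof. by move=> /(_ 0%N). Qed.

Lemma smooth_cts f : smooth f -> continuous f.
Proof. by move=> sf x; exact/derivable_cts/smooth_derivable. Qed.

Lemma smooth_derive1 f : smooth f -> smooth f^`().
Proof. by move=> sf n x; have := sf n.+1 x; rewrite /derive1n iterSr. Qed.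

Lemma bounded_derive1_lipschitz f M : (forall x, derivable f x 1) ->
  (forall x, `|f^`() x| <= M) -> lipschitz_with M f.
Proof.
move=> df fM.
have main x y : x <= y -> `|f y - f x| <= M * `|y - x|.
  move=> xy.
  have [||c _ ->] := @MVT_segment R f f^`() x y xy.
  - by move=> z _; rewrite derive1E; apply: DeriveDef.
  - by apply: continuous_subspaceT => z; exact: derivable_cts.
  by rewrite normrM ler_wpM2r.
move=> x y; case: (leP x y) => [xy|/ltW yx]; last exact: main.
by rewrite distrC (distrC x); exact: main.
Qed.

Lemma cts_bounded_supp f a b : continuous f ->
  (forall x, ~ (a <= x <= b) -> f x = 0) -> exists M, forall x, `|f x| <= M.
Proof.
move=> cf f0; have [ab|ba] := leP a b; last first.
  exists 0 => x; rewrite f0 ?normr0// => /andP[ax xb].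
  by move: (le_lt_trans (le_trans ax xb) ba); rewrite ltxx.
have [|c _ cM] := @EVT_max R (fun x => `|f x|) a b ab.
  by apply: continuous_subspaceT => z; apply: cvg_norm; exact: cf.
exists `|f c| => x; have [xab|xab] := boolP (a <= x <= b).
  by apply: cM; rewrite in_itv.
by rewrite f0 ?normr0//; exact/negP.
Qed.

Lemma smooth_supp_lipschitz f a b : smooth f ->
  (forall x, ~ (a <= x <= b) -> f^`() x = 0) -> lipschitzian f.
Proof.
move=> sf f0; have [M fM] := cts_bounded_supp (smooth_cts (smooth_derive1 sf)) f0.
by exists M; apply: bounded_derive1_lipschitz => // x; exact: smooth_derivable.
Qed.

Lemma derive1_locally_cst f (c x e : R) : 0 < e ->
  (forall y, `|x - y| < e -> f y = c) -> f^`() x = 0.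
Proof.
move=> e0 fc; have H : {near x, f =1 cst c}.
  by apply/nbhs_ballP; exists e => //= y; exact: fc.
by rewrite derive1E (@near_eq_derive _ _ _ _ _ x (1 : R) H) derive_cst.
Qed.

Lemma is_derive1n_affine f (c d : R) n (z : R) : smooth f ->
  is_derive z 1 (fun z => derive1n n f (c * z + d)) (derive1n n.+1 f (c * z + d) * c).
Proof.
move=> sf.
have da : is_derive z 1 (fun z => c * z + d) c.
  by apply: is_derive_eq; rewrite /GRing.scale/=; lra.
have df : is_derive (c * z + d) 1 (derive1n n f) (derive1n n.+1 f (c * z + d)).
  by rewrite [derive1n n.+1 f]/derive1n iterS derive1E; apply: DeriveDef => //; exact: sf.
exact: (@is_derive1_comp _ (derive1n n f) (fun z => c * z + d) z _ _ df da).
Qed.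

Lemma derive1n_affine f (c d : R) n : smooth f ->
  derive1n n (fun z => f (c * z + d)) = (fun z => c ^+ n * derive1n n f (c * z + d)).
Proof.
move=> sf; elim: n => [|n IH]; first by apply/funext => z; rewrite expr0 mul1r.
rewrite /derive1n iterS -/(derive1n n _) IH; apply/funext => z.
have dc := is_derive1n_affine c d n z sf.
have dm : is_derive z 1 (fun z => c ^+ n * derive1n n f (c * z + d)) (c ^+ n * (derive1n n.+1 f (c * z + d) * c)).
  by apply: is_derive_eq; rewrite /GRing.scale/=; lra.
by rewrite derive1E derive_val exprS; rewrite -/(derive1n n.+1 f); lra.
Qed.

Lemma smooth_affine f (c d : R) : smooth f -> smooth (fun z => f (c * z + d)).
Proof.
move=> sf n x; rewrite derive1n_affine//.
apply: derivableM; first exact: derivable_cst.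
have dc := is_derive1n_affine c d n x sf; exact: ex_derive.
Qed.

Lemma smoothB f g : smooth f -> smooth g -> smooth (f \- g).
Proof.
move=> sf sg.
have E n : derive1n n (f \- g) = derive1n n f \- derive1n n g.
  elim: n => [//|n IH]; rewrite /derive1n !iterS -/(derive1n n _) IH.
  by apply/funext => x; rewrite [LHS]derive1E /= !derive1E; apply: deriveB; [exact: sf|exact: sg].
by move=> n x; rewrite E; apply: derivableB; [exact: sf|exact: sg].
Qed.
End SmoothFunctions.

(** * Weak derivatives of continuous functions *)

Section WeakDerivative.
Context {R : realType}.
Implicit Types f g phi : R -> R.
Local Notation mu := (@lebesgue_measure R).
Local Notation L2 f := (f \in Lfun mu 2%:E).

Lemma Rintegral_supp f a b : (forall x, ~ (a <= x <= b) -> f x = 0) ->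
  \int[mu]_x f x = \int[mu]_(x in `[a, b]) f x.
Proof.
move=> f0; rewrite [RHS]Rintegral_mkcond; apply: eq_Rintegral => x _.
by rewrite patchE; case: ifPn => //; rewrite notin_setE/= in_itv/= => /f0 ->.
Qed.

Lemma integrable_supp f a b : (forall x, ~ (a <= x <= b) -> f x = 0) ->
  mu.-integrable `[a, b] (EFin \o f) -> mu.-integrable setT (EFin \o f).
Proof.
move=> f0; rewrite integrable_mkcond//; apply: eq_integrable => // x _.
by rewrite patchE; case: ifPn => //; rewrite notin_setE/= in_itv/= => /f0 ->.
Qed.

Lemma supp_notin f x : ~ supp f x -> f x = 0.
Proof. by move=> sx; apply/eqP/negPn/negP => fx; apply/sx/subset_closure. Qed.

Section cutoff.
Variables (chim chip : R -> R) (chi : cutoffs chim chip).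

Lemma chip_eq0 x : x <= -1 -> chip x = 0.
Proof.
move=> x1; apply: supp_notin => /(cutoffs_suppp chi) /=.
by rewrite in_itv/= andbT ltNge x1.
Qed.

Lemma chip_eq1 x : 1 <= x -> chip x = 1.
Proof.
move=> x1; rewrite -(cutoffs_sum chi x) (_ : chim x = 0) ?add0r//.
apply: supp_notin => /(cutoffs_suppm chi) /=.
by rewrite in_itv/= ltNge x1.
Qed.

Lemma chimE : chim = (fun x => 1 - chip x).
Proof. by apply/funext => x; rewrite -(cutoffs_sum chi x) addrK. Qed.

Lemma chip_derive1_eq0 x : ~ (-1 <= x <= 1) -> chip^`() x = 0.
Proof.
move=> /negP; rewrite negb_and -!ltNge => /orP[x1|x1].
  apply: (@derive1_locally_cst _ _ 0 _ (-1 - x)); first by rewrite subr_gt0.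
  move=> y; rewrite distrC => H; apply: chip_eq0.
  by have := le_lt_trans (ler_norm _) H; lra.
apply: (@derive1_locally_cst _ _ 1 _ (x - 1)); first by rewrite subr_gt0.
move=> y H; apply: chip_eq1.
by have := le_lt_trans (ler_norm _) H; lra.
Qed.

Lemma chip_lipschitzian : lipschitzian chip.
Proof. exact: smooth_supp_lipschitz (cutoffs_smoothp chi) chip_derive1_eq0. Qed.

Lemma chip_norm_le1 x : `|chip x| <= 1.
Proof. by have /andP[c0 c1] := cutoffs_bound chi x; rewrite ger0_norm. Qed.

(** For large [n] this test function is close to the indicator of [[x, y]]: it
    goes up near [x] and down near [y]. Testing a weak derivative against it
    gives the fundamental theorem. *)
Let tent (n : nat) (x y z : R) := chip (n.+1%:R * z + (- n.+1%:R * x)) -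
   chip (n.+1%:R * z + (- n.+1%:R * y)).

Let n0 (n : nat) : 0 < n.+1%:R :> R. Proof. by rewrite ltr0n. Qed.
Let n1 (n : nat) : 1 <= n.+1%:R :> R. Proof. by rewrite ler1n. Qed.

Let scaled_le (n : nat) (z w : R) : z <= w - 1 -> n.+1%:R * z + (- n.+1%:R * w) <= -1.
Proof. by move=> zw; have := n1 n; nra. Qed.

Let scaled_ge (n : nat) (z w : R) : w + 1 <= z -> 1 <= n.+1%:R * z + (- n.+1%:R * w).
Proof. by move=> zw; have := n1 n; nra. Qed.

Let tent_supp n x y z : x <= y -> ~ (x - 1 <= z <= y + 1) -> tent n x y z = 0.
Proof.
move=> xy /negP; rewrite negb_and -!ltNge => /orP[zx|yz]; rewrite /tent.
  rewrite !chip_eq0 ?subrr//; apply: scaled_le; lra.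
by rewrite !chip_eq1 ?subrr//; apply: scaled_ge; lra.
Qed.

Let tent_test n x y : x <= y -> test_function (tent n x y).
Proof.
move=> xy; split.
  by apply: smoothB; apply: smooth_affine; exact: cutoffs_smoothp chi.
apply: (@subclosed_compact _ _ `[x - 1, y + 1]%classic).
- exact: closed_closure.
- exact: segment_compact.
- rewrite [X in _ `<=` X](closure_id _).1; last exact: itv_closed.
  apply: closure_subset => z /= /eqP tz; rewrite in_itv/=.
  by apply/negPn/negP => H; apply: tz; apply: tent_supp => //; exact/negP.
Qed.

(** The derivative of the part of [tent] that goes up at [x]: an approximate
    identity, which may change sign, as the cutoff is not assumed monotone. *)
Let bump (n : nat) (x z : R) : R := n.+1%:R * chip^`() (n.+1%:R * z + (- n.+1%:R * x)).

Let derive1_scaled n x (z : R) : is_derive z (1 : R) (fun z => chip (n.+1%:R * z + (- n.+1%:R * x))) (bump n x z).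
Proof.
have s := @smooth_affine _ chip n.+1%:R (- n.+1%:R * x) (cutoffs_smoothp chi).
apply: DeriveDef; first exact: smooth_derivable.
by rewrite -derive1E; have := @derive1n_affine _ chip n.+1%:R (- n.+1%:R * x) 1%N (cutoffs_smoothp chi); rewrite /derive1n/= expr1 => ->.
Qed.

Let tent_derive1 n x y z : (tent n x y)^`() z = bump n x z - bump n y z.
Proof.
have H := is_deriveB (derive1_scaled n x z) (derive1_scaled n y z).
by rewrite derive1E derive_val.
Qed.

Let bump_supp n x (z : R) : ~ (x - n.+1%:R^-1 <= z <= x + n.+1%:R^-1) -> bump n x z = 0.
Proof.
move=> H; rewrite /bump chip_derive1_eq0 ?mulr0//; apply: contra_not H => /andP[z1 z2].
have nn : n.+1%:R * n.+1%:R^-1 = 1 :> R by rewrite divff// gt_eqF.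
by have := n0 n; move: z1 z2 nn; move: (n.+1%:R^-1) => v z1 z2 nn np; apply/andP; split; nra.
Qed.

Let scaled_lipschitzian n x : lipschitzian (fun z => chip (n.+1%:R * z + (- n.+1%:R * x))).
Proof.
have [L cL] := chip_lipschitzian; exists (L * n.+1%:R) => u v.
by rewrite (le_trans (cL _ _))// opprD addrACA subrr addr0 -mulrBr normrM (gtr0_norm (n0 n)) mulrA.
Qed.

Let bump_integrable n x a b : mu.-integrable `[a, b] (EFin \o bump n x).
Proof.
have [L sL] := scaled_lipschitzian n x.
have := lipschitz_integrable_derive1 a b sL.
by congr (mu.-integrable _ (EFin \o _)); apply/funext => z; have H := derive1_scaled n x z; rewrite derive1E derive_val.
Qed.

Let bump_int n x : \int[mu]_(z in `[x - n.+1%:R^-1, x + n.+1%:R^-1]) bump n x z = 1.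
Proof.
have [L sL] := scaled_lipschitzian n x.
have nv0 : 0 < n.+1%:R^-1 :> R by rewrite invr_gt0.
have := @lipschitz_FTC _ L _ (x - n.+1%:R^-1) (x + n.+1%:R^-1) sL.
rewrite (_ : (fun _ => _)^`() = bump n x); last first.
  by apply/funext => z; have H := derive1_scaled n x z; rewrite derive1E derive_val.
move=> ->; last by rewrite lerD2l (le_trans _ (ltW nv0))// oppr_le0 ltW.
have nn : n.+1%:R * n.+1%:R^-1 = 1 :> R by rewrite divff// gt_eqF.
by rewrite chip_eq1 ?chip_eq0 ?subr0// ?mulrBr ?mulrDr nn mulNr addrAC subrr add0r.
Qed.

Let bump_cts n x : continuous (bump n x).
Proof.
have -> : bump n x = (fun z => chip (n.+1%:R * z + (- n.+1%:R * x)))^`().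
  by apply/funext => z; have H := derive1_scaled n x z; rewrite derive1E derive_val.
apply/smooth_cts/smooth_derive1.
exact: (@smooth_affine _ chip n.+1%:R (- n.+1%:R * x) (cutoffs_smoothp chi)).
Qed.

Let bump_cts_integrable f n x a b : continuous f ->
  mu.-integrable `[a, b] (EFin \o (fun z => f z * bump n x z)).
Proof.
move=> cf; apply: continuous_compact_integrable; first exact: segment_compact.
apply: continuous_subspaceT => z; apply: cvgM; first exact: cf.
exact: bump_cts.
Qed.

(** The integral of the absolute value of [bump n x] is at most twice the
    Lipschitz constant of the cutoff, and its integral is 1, so that the
    continuity of [f] at [x] is enough. *)
Lemma cvg_bump f x : continuous f ->
  (\int[mu]_z (f z * bump n x z) @[n --> \oo]) --> f x.
Proof.
move=> cf; have [M cM] := chip_lipschitzian.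
have M0 := lipschitz_with_ge0 cM.
apply/cvgrPdist_le => e e0.
pose d := e / (2 * M + 1).
have d0 : 0 < d by rewrite divr_gt0//; lra.
have /cvgrPdist_le /(_ d d0) /nbhs_ballP[r /= r0 fr] := cf x.
have [m _ Hm] := @near_infty_natSinv_lt R (PosNum r0).
exists m => // n /= /Hm /= nr.
set a := x - n.+1%:R^-1; set b := x + n.+1%:R^-1.
have nv0 : 0 < n.+1%:R^-1 :> R by rewrite invr_gt0.
have ab : a <= b by rewrite /a /b lerD2l (le_trans _ (ltW nv0))// oppr_le0 ltW.
rewrite (@Rintegral_supp _ a b); last first.
  by move=> z /(@bump_supp n x) ->; rewrite mulr0.
have bM z : `|bump n x z| <= n.+1%:R * M.
  by rewrite normrM (gtr0_norm (n0 n)) ler_wpM2l ?(ltW (n0 n))// lipschitz_with_derive1.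
have fd z : a <= z <= b -> `|f x - f z| <= d.
  move=> /andP[az zb]; apply: fr; rewrite /ball/= (le_lt_trans _ nr)//.
  by rewrite ler_distlC; apply/andP; split.
have ifb := bump_cts_integrable n x a b cf.
have ib := bump_integrable n x a b.
have ifx : mu.-integrable `[a, b] (EFin \o (fun z => f x * bump n x z)).
  by apply: (@bump_cts_integrable (cst (f x))) => z; exact: cvg_cst.
have -> : f x = \int[mu]_(z in `[a, b]) (f x * bump n x z).
  by rewrite RintegralZl// bump_int mulr1.
rewrite -RintegralB//.
apply: (le_trans (le_normr_Rintegral _ _)) => //; first exact: (integrableB _ ifx ifb).
apply: (@le_trans _ _ (\int[mu]_(z in `[a, b]) (d * (n.+1%:R * M)))).
  apply: le_Rintegral => //.
  - by apply: integrable_norm; exact: (integrableB _ ifx ifb).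
  - apply: (@bounded_itv_integrable _ _ `|d * (n.+1%:R * M)|) => //.
  - by move=> z /=; rewrite in_itv/= => zab; rewrite -mulrBl normrM ler_pM// fd.
rewrite (_ : Rintegral _ _ _ = d * (n.+1%:R * M) * (b - a)); last first.
  transitivity (d * (n.+1%:R * M) * fine (mu `[a, b])); first exact: Rintegral_cst.
  by rewrite lebesgue_cc.
have -> : b - a = 2 * n.+1%:R^-1 by rewrite /a /b; move: (n.+1%:R^-1) => v; lra.
rewrite -mulrA (_ : n.+1%:R * M * (2 * n.+1%:R^-1) = 2 * M); last first.
  by rewrite mulrACA [n.+1%:R * 2]mulrC -mulrA -[X in 2 * X]mulrCA divff ?mulr1// gt_eqF.
by rewrite /d -mulrA ler_piMr ?(ltW e0)// ler_pdivrMl; lra.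
Qed.

Let tent_le1 n x y z : `|tent n x y z| <= 1.
Proof.
rewrite /tent; have /andP[? ?] := cutoffs_bound chi (n.+1%:R * z + (- n.+1%:R * x)).
have /andP[? ?] := cutoffs_bound chi (n.+1%:R * z + (- n.+1%:R * y)).
by rewrite ler_norml; apply/andP; split; lra.
Qed.

Let cvg_tent x y z : x < y -> z != x -> z != y ->
  tent n x y z @[n --> \oo] --> (\1_(`[x, y]) z : R).
Proof.
move=> xy zx zy.
have [w w0 [wx wy]] : exists2 w, 0 < w & w <= `|z - x| /\ w <= `|z - y|.
  exists (Num.min `|z - x| `|z - y|); rewrite ?lt_min ?normr_gt0 ?subr_eq0 ?zx ?zy//.
  by rewrite !ge_min !lexx orbT.
have H : \forall n \near \oo, tent n x y z = (\1_(`[x, y]) z : R).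
  have [m _ Hm] := @near_infty_natSinv_lt R (PosNum w0).
  exists m => // n /= /Hm /= nw.
  have nw1 : 1 < n.+1%:R * w by rewrite -ltr_pdivrMl// mulr1.
  have np := n0 n.
  have Hl u : w <= `|z - u| -> z < u -> chip (n.+1%:R * z + (- n.+1%:R * u)) = 0.
    move=> wu zu; apply: chip_eq0; rewrite ltr0_norm ?subr_lt0// in wu; nra.
  have Hr u : w <= `|z - u| -> u < z -> chip (n.+1%:R * z + (- n.+1%:R * u)) = 1.
    move=> wu zu; apply: chip_eq1; rewrite gtr0_norm ?subr_gt0// in wu; nra.
  rewrite /tent indicE; move: zx; rewrite neq_lt => /orP[zx|zx].
    rewrite !Hl//; last exact: lt_trans xy.
    by rewrite memNset ?subrr//= in_itv/= leNgt zx.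
  rewrite (Hr x)//; move: zy; rewrite neq_lt => /orP[zy|zy].
    by rewrite Hl// subr0 mem_set//= in_itv/= !ltW.
  by rewrite Hr// subrr memNset//= in_itv/= [z <= _]leNgt zy andbF.
by apply: cvg_near_cst; apply: filterS H => n ->.
Qed.

(** The weak derivative is tested against [tent n x y] and [n] goes to
    infinity. *)
Lemma weak_derivative_primitive f g x y : continuous f -> measurable_fun setT g ->
  (forall a b, mu.-integrable `[a, b] (EFin \o g)) -> weak_derivative f g ->
  x <= y -> f y - f x = \int[mu]_(z in `[x, y]) g z.
Proof.
move=> cf mg ig fg; rewrite le_eqVlt => /predU1P[->|xy].
  rewrite subrr; apply/esym; rewrite set_itv1 //; exact: Rintegral_set1.
have L1 : (\int[mu]_z (f z * (tent n x y)^`() z) @[n --> \oo]) --> f x - f y.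
  under eq_fun => n.
    under eq_Rintegral => z _ do rewrite tent_derive1 mulrBr.
    have I w : mu.-integrable setT (EFin \o (fun z => f z * bump n w z)).
      apply: (@integrable_supp _ (w - n.+1%:R^-1) (w + n.+1%:R^-1)).
        by move=> u /(@bump_supp n w) ->; rewrite mulr0.
      exact: bump_cts_integrable.
    rewrite RintegralB//; over.
  by apply: cvgB; exact: cvg_bump.
have L2 : (\int[mu]_z (g z * tent n x y z) @[n --> \oo]) --> \int[mu]_(z in `[x, y]) g z.
  pose D : set R := `[x - 1, y + 1]%classic.
  have gD n : \int[mu]_z (g z * tent n x y z) = \int[mu]_(z in D) (g z * tent n x y z).
    by apply: Rintegral_supp => z /(@tent_supp n _ _ _ (ltW xy)) ->; rewrite mulr0.
  have mt n : measurable_fun setT (tent n x y).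
    by apply: continuous_measurable_fun; exact/smooth_cts/(tent_test n (ltW xy)).1.
  have mI : measurable_fun setT (fun z => g z * (\1_(`[x, y]) z : R)).
    by apply: measurable_funM => //; exact: measurable_indic.
  have := @dominated_convergence _ _ _ mu D (measurable_itv _)
    (fun n z => (g z * tent n x y z)%:E) (fun z => (g z * \1_(`[x, y]) z)%:E) (fun z => `|g z|%:E).
  case.
  - by move=> n; apply/measurable_EFinP/measurable_funTS; exact: (measurable_funM mg (mt n)).
  - by apply/measurable_EFinP/measurable_funTS.
  - exists [set x; y]; split.
    + exact: measurableU.
    + apply/eqP; rewrite eq_le measure_ge0 andbT.
      have M1 z : (mu [set z] <= 0)%E by rewrite lebesgue_measure_set1.
      apply: (le_trans (measureU2 _ _ _)) => //.
      by rewrite -[leRHS]adde0; apply: leeD; exact: M1.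
    + move=> z /= H; apply: contrapT => nz; apply: H => _.
      have zx : z != x by apply/eqP => zx; apply: nz; left.
      have zy : z != y by apply/eqP => zy; apply: nz; right.
      by apply: cvg_EFin; [apply: nearW|apply: cvgM; [exact: cvg_cst|exact: cvg_tent]].
  - by have := integrable_norm (ig (x - 1) (y + 1)).
  - apply/aeW => z n _; rewrite lee_fin normrM ler_piMr//; exact: tent_le1.
  move=> _ _ H.
  have E : (\int[mu]_(z in D) (g z * \1_(`[x, y]) z)%:E = (\int[mu]_(z in `[x, y]) g z)%:E)%E.
    rewrite /Rintegral fineK; last exact: integrable_fin_num.
    rewrite [LHS]integral_mkcond [RHS]integral_mkcond; apply: eq_integral => z _.
    rewrite !patchE /= indicE; case: ifPn => zD; case: ifPn => zxy.
    - by rewrite mulr1.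
    - by rewrite mulr0.
    - move: zD zxy; rewrite notin_setE inE /D/= !in_itv/= => H1 /andP[H2 H3].
      by exfalso; apply: H1; apply/andP; split; lra.
    - by [].
  rewrite E in H; under eq_fun do rewrite gD.
  exact: (fine_cvg H).
have L3 : (\int[mu]_z (f z * (tent n x y)^`() z) @[n --> \oo]) --> - \int[mu]_(z in `[x, y]) g z.
  under eq_fun do rewrite (fg _ (tent_test _ (ltW xy))).
  exact: cvgN.
have E : f x - f y = - \int[mu]_(z in `[x, y]) g z := cvg_unique (@Rhausdorff R) L1 L3.
by rewrite -(opprB (f x)) E opprK.
Qed.

End cutoff.
End WeakDerivative.

(** * Sobolev functions are Lipschitz functions *)

Section Lipschitz_closure.
Context {R : realType}.
Implicit Types f g phi : R -> R.

Lemma lipschitzianD f g : lipschitzian f -> lipschitzian g ->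
  lipschitzian (fun x => f x + g x).
Proof.
move=> [L fL] [M gM]; exists (L + M) => x y.
by rewrite opprD addrACA mulrDl (le_trans (ler_normD _ _))// lerD.
Qed.

Lemma lipschitzianZ f (c : R) : lipschitzian f -> lipschitzian (fun x => c * f x).
Proof.
move=> [L fL]; exists (`|c| * L) => x y.
by rewrite -mulrBr normrM -mulrA ler_wpM2l.
Qed.

Lemma lipschitzianB f g : lipschitzian f -> lipschitzian g ->
  lipschitzian (fun x => f x - g x).
Proof.
move=> lf lg; have := lipschitzianD lf (lipschitzianZ (-1) lg).
by under eq_fun do rewrite mulN1r.
Qed.

Lemma lipschitzian_id : lipschitzian (fun x : R => x).
Proof. by exists 1 => x y; rewrite mul1r. Qed.

Lemma lipschitzian_cst (c : R) : lipschitzian (fun x : R => c).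
Proof. by exists 0 => x y; rewrite subrr normr0 mul0r. Qed.

Lemma lipschitzian_comp f g : lipschitzian f -> lipschitzian g ->
  lipschitzian (f \o g).
Proof.
move=> [L fL] [M gM]; exists (L * M) => x y /=.
rewrite (le_trans (fL _ _))// -mulrA ler_wpM2l//.
exact: lipschitz_with_ge0 fL.
Qed.

(** A Lipschitz function is bounded on the bounded interval where [phi] lives. *)
Lemma lipschitzian_supp_mul f phi a b M : lipschitzian f -> lipschitzian phi ->
  (forall x, `|phi x| <= M) -> (forall x, ~ (a <= x <= b) -> phi x = 0) ->
  lipschitzian (fun x => f x * phi x).
Proof.
move=> lf [K pK] pM p0; have [L fL] := lf.
have [C fC] : exists C, forall x, a <= x <= b -> `|f x| <= C.
  exists (`|f a| + L * (b - a)) => x /andP[ax xb].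
  rewrite -[f x](subrK (f a)) addrC (le_trans (ler_normD _ _))// lerD2l.
  rewrite (le_trans (fL _ _))// ler_wpM2l ?(lipschitz_with_ge0 fL)//.
  by rewrite ger0_norm ?subr_ge0// lerD2r.
have L0 := lipschitz_with_ge0 fL; have K0 := lipschitz_with_ge0 pK.
have main x y : a <= y <= b -> `|f x * phi x - f y * phi y| <= (L * M + `|C| * K) * `|x - y|.
  move=> yab.
  have -> : f x * phi x - f y * phi y = (f x - f y) * phi x + f y * (phi x - phi y) by lra.
  rewrite (le_trans (ler_normD _ _))//; rewrite [leRHS]mulrDl; apply: lerD; rewrite normrM.
    by rewrite mulrAC ler_pM.
  by rewrite -mulrA ler_pM// (le_trans (fC _ yab))// ler_norm.
exists (L * M + `|C| * K) => x y.
have [yab|/negP yab] := boolP (a <= y <= b); first exact: main.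
have [xab|/negP xab] := boolP (a <= x <= b).
  by rewrite distrC (distrC x); exact: main.
rewrite !p0// !mulr0 subrr normr0 mulr_ge0// addr_ge0// mulr_ge0//.
by rewrite (le_trans _ (pM 0)).
Qed.

End Lipschitz_closure.

Section Sobolev.
Context {R : realType}.
Implicit Types f g phi : R -> R.
Local Notation mu := (@lebesgue_measure R).
Local Notation L2 f := (f \in Lfun mu 2%:E).

Lemma lipschitzian_ae_derivable f : lipschitzian f -> {ae mu, forall x, derivable f x 1}.
Proof. by move=> [L]; exact: lipschitz_ae_derivable. Qed.

Lemma lipschitzian_measurable f : lipschitzian f -> measurable_fun setT f.
Proof. by move=> lf; apply: continuous_measurable_fun; exact: lipschitzian_cts. Qed.

Lemma lipschitzian_measurable_derive1 f : lipschitzian f -> measurable_fun setT f^`().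
Proof. by move=> lf; apply: measurable_derive1; exact: lipschitzian_cts. Qed.

Lemma test_function_supp phi : test_function phi -> exists N : R,
  0 < N /\ forall x, ~ (- N < x < N) -> phi x = 0 /\ phi^`() x = 0.
Proof.
move=> [sp cp]; have [M [_ HM]] := compact_bounded cp.
pose N := `|M| + 1.
have HN x : ~ (- N < x < N) -> ~ supp phi x.
  move=> H sx; apply: H; rewrite -ltr_norml.
  have := HM (`|M| + 2^-1) _ x sx; move=> /(_ _); rewrite /N.
  have h : M < `|M| + 2^-1 by have := ler_norm M; lra.
  by move=> /(_ h) /=; have := normr_ge0 M; lra.
exists N; split; first by rewrite /N; have := normr_ge0 M; lra.
move=> x /HN sx; split; first exact: supp_notin.
have : open (~` supp phi) by apply: closed_openC; exact: closed_closure.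
rewrite openE => /(_ x sx) /nbhs_ballP[e /= e0 He].
by apply: (@derive1_locally_cst _ _ 0 _ e) => // y xy; exact/supp_notin/He.
Qed.

(** Integration by parts: [f * phi] is Lipschitz and vanishes at both ends of
    a large interval. *)
Lemma lipschitzian_weak_derivative f : lipschitzian f -> weak_derivative f f^`().
Proof.
move=> lf phi tp; have [N [N0 HN]] := test_function_supp tp; have [sp _] := tp.
have HN' x : ~ (- N <= x <= N) -> phi x = 0 /\ phi^`() x = 0.
  by move=> H; apply: HN => /andP[H1 H2]; apply: H; rewrite !ltW.
have lp : lipschitzian phi.
  by apply: (@smooth_supp_lipschitz _ _ (-N) N) => // x /HN'[].
have [M pM] := cts_bounded_supp (smooth_cts sp) (fun x H => (HN' x H).1).
have lfp := lipschitzian_supp_mul lf lp pM (fun x H => (HN' x H).1).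
have [K fpK] := lfp.
have NN : - N <= N by lra.
have := lipschitz_FTC fpK NN.
rewrite (HN N _).1; last by rewrite ltxx andbF.
rewrite (HN (- N) _).1; last by rewrite ltxx.
rewrite !mulr0 subrr => E.
have cfp' : continuous (fun x => f x * phi^`() x).
  by move=> x; apply: cvgM; [exact: lipschitzian_cts|exact: (smooth_cts (smooth_derive1 sp))].
have i1 : mu.-integrable `[-N, N] (EFin \o (fun x => f x * phi^`() x)).
  by apply: continuous_compact_integrable; [exact: segment_compact|exact: continuous_subspaceT].
have mf' := lipschitzian_measurable_derive1 lf.
have [L fL] := lf.
have i2 : mu.-integrable `[-N, N] (EFin \o (fun x => f^`() x * phi x)).
  apply: (@bounded_itv_integrable _ _ (L * M)).
    by apply: measurable_funM => //; exact: lipschitzian_measurable.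
  by move=> x; rewrite normrM ler_pM// lipschitz_with_derive1.
rewrite (@Rintegral_supp _ _ (-N) N); last by move=> x /HN'[_ ->]; rewrite mulr0.
rewrite (@Rintegral_supp _ (fun x => _ * phi x) (-N) N); last by move=> x /HN'[-> _]; rewrite mulr0.
apply/eqP; rewrite -addr_eq0 -RintegralD//; apply/eqP; rewrite -[RHS]E.
congr fine; apply: ae_eq_integral => //.
- have /integrableP[/measurable_EFinP m1 _] := i1; have /integrableP[/measurable_EFinP m2 _] := i2.
  by apply/measurable_EFinP; exact: measurable_funD.
- by apply/measurable_EFinP; apply: measurable_funTS; apply: lipschitzian_measurable_derive1.
apply: ae_imp (lipschitzian_ae_derivable lf) => x dfx _.
have dfi : is_derive x 1 f (f^`() x) by rewrite derive1E; exact: DeriveDef.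
have dpi : is_derive x 1 phi (phi^`() x) by rewrite derive1E; apply: DeriveDef => //; exact: smooth_derivable.
have := is_deriveM dfi dpi => di.
congr EFin; rewrite [RHS]derive1E.
rewrite (_ : (fun x => f x * phi x) = f * phi)//.
by rewrite derive_val /GRing.scale/= mulrC [f^`() x * _]mulrC; lra.
Qed.

Lemma lebesgue_setT_gt0 : (0 < mu [set: R])%E.
Proof.
apply: (@lt_le_trans _ _ (mu `[0, 1])); first by rewrite [ltRHS]lebesgue_cc// lte_fin; lra.
by apply: le_measure; rewrite ?inE.
Qed.

(** A value above [C] would persist on a ball, which has positive measure. *)
Lemma ae_le_cts f C : continuous f -> {ae mu, forall x, f x <= C} -> forall x, f x <= C.
Proof.
move=> cf [N [mN N0 HN]] x; rewrite leNgt; apply/negP => Cx.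
have : \forall y \near x, C < f y by exact: (cvgr_gt _ (cf x) _ Cx).
move=> /nbhs_ballP[e /= e0 He].
have : (mu (ball x e) <= mu N)%E.
  apply: le_measure; rewrite ?inE//; first exact: measurable_ball.
  by move=> y /He /= Cy; apply: HN => /=; rewrite leNgt Cy.
rewrite N0 lebesgue_measure_ball ?(ltW e0)// => H.
by have : ((e *+ 2)%:E <= 0%:E)%E := H; rewrite lee_fin mulr2n; lra.
Qed.

Lemma Lfun_inftyP f : f \in Lfun mu +oo%E <->
  measurable_fun setT f /\ exists C, {ae mu, forall x, `|f x| <= C}.
Proof.
have E : ('N[mu]_+oo[EFin \o f] = ess_sup_inf.ess_sup mu (abse \o (EFin \o f)))%E.
  by rewrite unlock /Lnorm lebesgue_setT_gt0.
split=> [/[dup] /Lfun_measurable mf|[mf [C fC]]].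
  rewrite inE => /andP[_]; rewrite !inE/= /finite_norm E => foo; split => //.
  have [M HM] := @ess_sup_inf.ess_supr_bounded _ _ _ mu (fun x => `|f x|) foo.
  by exists M; apply: ae_imp HM.
rewrite inE; apply/andP; split; rewrite !inE//= /finite_norm E.
apply: (@le_lt_trans _ _ C%:E); last exact: ltry.
by apply/ess_sup_inf.ess_supP; apply: ae_imp fC => x; rewrite /= lee_fin.
Qed.

Section with_cutoff.
Variables (chim chip : R -> R) (chi : cutoffs chim chip).

Lemma weak_derivative_ae f g h : measurable_fun setT g -> measurable_fun setT h ->
  {ae mu, forall x, g x = h x} -> weak_derivative f g -> weak_derivative f h.
Proof.
move=> mg mh gh fg phi tphi; rewrite (fg phi tphi); congr (- _).
have mphi : measurable_fun setT phi by apply: continuous_measurable_fun; exact: smooth_cts tphi.1.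
rewrite /Rintegral; congr fine; apply: ae_eq_integral => //.
- by apply/measurable_EFinP; exact: measurable_funM.
- by apply/measurable_EFinP; exact: measurable_funM.
- by apply: ae_imp gh => x ->.
Qed.

(** This is what lets the pointwise derivatives of the coordinates be handled
    as those of Lipschitz functions. *)
Lemma W1ooP f : W1oo f <-> lipschitzian f /\ exists C, forall x, `|f x| <= C.
Proof.
split=> [[cf /Lfun_inftyP[mf [C fC]] [g /Lfun_inftyP[mg [D gD]] fg]]|[lf [C fC]]].
  have cnf : continuous (fun x => `|f x|) by move=> x; apply: cvg_norm; exact: cf.
  split; last by exists C => x; exact: (ae_le_cts cnf fC).
  (* clipping makes the weak derivative bounded everywhere, not only almost
     everywhere *)
  pose g1 x := Num.max (- `|D|) (Num.min `|D| (g x)).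
  have gg1 : {ae mu, forall x, g x = g1 x}.
    apply: ae_imp gD => x gxD; rewrite /g1 (min_idPr _) ?(max_idPr _)//.
      by have := le_trans gxD (ler_norm D); rewrite ler_norml => /andP[].
    by rewrite (le_trans (ler_norm _))// (le_trans gxD)// ler_norm.
  have mg1 : measurable_fun setT g1.
    by apply: measurable_maxr => //; exact: measurable_minr.
  have g1D x : `|g1 x| <= `|D|.
    rewrite /g1 ler_norml le_max lexx/= ge_max ge_min lexx/= andbT.
    by rewrite (le_trans _ (normr_ge0 D))// oppr_le0.
  have ig a b := bounded_itv_integrable a b mg1 g1D.
  have fg1 := weak_derivative_ae mg mg1 gg1 fg.
  have main x y : x <= y -> `|f y - f x| <= `|D| * `|y - x|.
    move=> xy; rewrite (weak_derivative_primitive chi cf mg1 ig fg1 xy).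
    apply: (le_trans (le_normr_Rintegral _ (ig x y))) => //.
    have <- : \int[mu]_(t in `[x, y]) `|D| = `|D| * `|y - x|.
      transitivity (`|D| * fine (mu `[x, y])); first exact: Rintegral_cst.
      by rewrite lebesgue_cc//= [`|y - x|]ger0_norm ?subr_ge0.
    apply: le_Rintegral => //; first exact: integrable_norm (ig x y).
    by apply: (@bounded_itv_integrable _ _ `|D|) => // t; rewrite normr_id.
  exists `|D| => x y; have [yx|/ltW xy] := leP y x; first exact: main.
  by rewrite distrC (distrC x); exact: main.
have [L fL] := lf; split; first exact: lipschitzian_cts.
  by apply/Lfun_inftyP; split; [exact: lipschitzian_measurable|exists C; exact: aeW].
exists f^`(); last exact: lipschitzian_weak_derivative.
apply/Lfun_inftyP; split; first exact: lipschitzian_measurable_derive1.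
by exists L; apply: aeW => x; exact: lipschitz_with_derive1.
Qed.

Lemma H1P f : lipschitzian f -> H1 f <-> L2 f /\ L2 f^`().
Proof.
move=> lf; split=> [[cf f2 [g g2 fg]]|[f2 f'2]].
  split => //.
  have ig a b := Lfun2_itv_integrable a b g2.
  have mg := Lfun_measurable g2.
  have := ae_eq_derive1_primitive mg ig (fun a b => weak_derivative_primitive chi cf mg ig fg).
  move=> H; apply: Lfun2_le g2; first exact: lipschitzian_measurable_derive1.
  by apply: ae_imp H => x [_ ->].
split => //; first exact: lipschitzian_cts.
by exists f^`() => //; exact: lipschitzian_weak_derivative.
Qed.

Lemma derive1_linear2 f g h (a b : R) : lipschitzian f -> lipschitzian g -> lipschitzian h ->
  {ae mu, forall x, (fun x => f x + a * g x + b * h x)^`() x = f^`() x + a * g^`() x + b * h^`() x}.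
Proof.
move=> lf lg lh.
apply: ae_imp (ae_and (lipschitzian_ae_derivable lf) (ae_and (lipschitzian_ae_derivable lg) (lipschitzian_ae_derivable lh))).
move=> x [df [dg dh]].
have dfi : is_derive x 1 f (f^`() x) by rewrite derive1E; exact: DeriveDef.
have dgi : is_derive x 1 g (g^`() x) by rewrite derive1E; exact: DeriveDef.
have dhi : is_derive x 1 h (h^`() x) by rewrite derive1E; exact: DeriveDef.
have H : is_derive x 1 (fun x => f x + a * g x + b * h x) (f^`() x + a * g^`() x + b * h^`() x).
  by apply: is_derive_eq; rewrite /GRing.scale/=; lra.
by rewrite derive1E derive_val.
Qed.

End with_cutoff.
End Sobolev.

(** * The spaces E1 and E2 *)

Section EnergySpaces.
Context {R : realType}.
Implicit Types f g u v : R -> R.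
Local Notation mu := (@lebesgue_measure R).
Local Notation L2 f := (f \in Lfun mu 2%:E).
Variables (chim chip : R -> R) (chi : cutoffs chim chip).

Lemma Lfun2_ext f g : L2 f -> f =1 g -> L2 g.
Proof. by move=> f2 /funext <-. Qed.

Lemma Lfun2_ae_eq f g : measurable_fun setT f -> {ae mu, forall x, f x = g x} -> L2 g -> L2 f.
Proof. by move=> mf fg; apply: Lfun2_le => //; apply: ae_imp fg => x ->. Qed.

Lemma chip_derive1_L2 : L2 chip^`().
Proof.
have lc := chip_lipschitzian chi; have [L cL] := lc.
apply: (@Lfun2_bounded_supp _ _ L (-1) 1).
- exact: lipschitzian_measurable_derive1.
- by move=> x; exact: lipschitz_with_derive1.
- exact: chip_derive1_eq0 chi.
Qed.

(** The cutoffs add up to 1, so that removing multiples of both is an affine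
    combination of [u], one cutoff and a constant. *)
Lemma lipschitzian_splitE u (a b : R) :
  (fun x => u x - a * chip x - b * chim x) = (fun x => u x + (b - a) * chip x + (- b) * cst 1 x).
Proof. by apply/funext => x; rewrite (chimE chi) /=; lra. Qed.

Lemma split_lipschitzian u (a b : R) : lipschitzian u ->
  lipschitzian (fun x => u x - a * chip x - b * chim x).
Proof.
move=> lu; rewrite lipschitzian_splitE.
apply: lipschitzianD; last exact/lipschitzianZ/lipschitzian_cst.
by apply: lipschitzianD => //; apply: lipschitzianZ; exact: chip_lipschitzian chi.
Qed.

Lemma split_derive1_L2 u (a b : R) : lipschitzian u ->
  L2 (fun x => u x - a * chip x - b * chim x)^`() <-> L2 u^`().
Proof.
move=> lu.
have lc := chip_lipschitzian chi.
have ls := split_lipschitzian a b lu.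
have E : {ae mu, forall x, (fun x => u x - a * chip x - b * chim x)^`() x = u^`() x + (b - a) * chip^`() x}.
  rewrite lipschitzian_splitE.
  apply: ae_imp (derive1_linear2 (b - a) (- b) lu lc (lipschitzian_cst 1)) => x ->.
  by rewrite derive1_cst mulr0 addr0.
split=> H.
  apply: (@Lfun2_ae_eq _ (fun x => (fun x => u x - a * chip x - b * chim x)^`() x - (b - a) * chip^`() x)).
  - exact: lipschitzian_measurable_derive1.
  - by apply: ae_imp E => x ->; rewrite addrK.
  - by apply: Lfun2B => //; apply: Lfun2Z; exact: chip_derive1_L2.
apply: (Lfun2_ae_eq _ E); first exact: lipschitzian_measurable_derive1.
by apply: Lfun2D => //; apply: Lfun2Z; exact: chip_derive1_L2.
Qed.

(** The derivatives of the cutoffs are bounded with bounded support, hence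
    square integrable: removing the limits at infinity does not affect the
    condition on the derivative. *)
Lemma E2P u : lipschitzian u -> E2 chim chip u <->
  L2 u^`() /\ exists a b, L2 (fun x => u x - a * chip x - b * chim x).
Proof.
move=> lu; split=> [[g [a [b [Hg uE]]]]|[u2 [a [b uab]]]].
  have gE : g = (fun x => u x - a * chip x - b * chim x) by apply/funext => x; rewrite uE; lra.
  have lg : lipschitzian g by rewrite gE; exact: split_lipschitzian.
  have [g2 g'2] := (H1P chi lg).1 Hg.
  split; last by exists a, b; rewrite -gE.
  by apply/(split_derive1_L2 a b lu); rewrite -gE.
exists (fun x => u x - a * chip x - b * chim x), a, b; split.
  apply/(H1P chi (split_lipschitzian a b lu)); split => //.
  exact/(split_derive1_L2 a b lu).
by apply/funext => x; lra.
Qed.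

Lemma E1P u : lipschitzian u -> E1 chip u <->
  L2 u^`() /\ exists a, L2 (fun x => u x - a * chip x).
Proof.
move=> lu.
have E a : (fun x => u x - a * chip x) = (fun x => u x - a * chip x - 0 * chim x).
  by apply/funext => x; rewrite mul0r subr0.
split=> [[g [a [Hg uE]]]|[u2 [a ua]]].
  have gE : g = (fun x => u x - a * chip x) by apply/funext => x; rewrite uE; lra.
  have lg : lipschitzian g by rewrite gE E; exact: split_lipschitzian.
  have [g2 g'2] := (H1P chi lg).1 Hg.
  split; last by exists a; rewrite -gE.
  by apply/(split_derive1_L2 a 0 lu); rewrite -E -gE.
exists (fun x => u x - a * chip x), a; split; last by apply/funext => x; lra.
rewrite E; apply/(H1P chi (split_lipschitzian a 0 lu)); split; first by rewrite -E.
exact/(split_derive1_L2 a 0 lu).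
Qed.

Lemma E1_E2 u : E1 chip u -> E2 chim chip u.
Proof. by move=> [g [a [Hg ->]]]; exists g, a, 0; split => //; apply/funext => x; lra. Qed.

Lemma derive1_linear f g (c : R) : lipschitzian f -> lipschitzian g ->
  {ae mu, forall x, (fun x => f x + c * g x)^`() x = f^`() x + c * g^`() x}.
Proof.
move=> lf lg.
have E : (fun x => f x + c * g x) = (fun x => f x + c * g x + 0 * cst 0 x).
  by apply/funext => x; rewrite mul0r addr0.
rewrite E; apply: ae_imp (derive1_linear2 c 0 lf lg (lipschitzian_cst 0)) => x ->.
by rewrite mul0r addr0.
Qed.

Lemma E2_linear u v (c : R) : lipschitzian u -> lipschitzian v ->
  E2 chim chip u -> E2 chim chip v -> E2 chim chip (fun x => u x + c * v x).
Proof.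
move=> lu lv /(E2P lu)[u2 [a [b uab]]] /(E2P lv)[v2 [a' [b' vab]]].
have luv : lipschitzian (fun x => u x + c * v x) by apply: lipschitzianD => //; exact: lipschitzianZ.
apply/(E2P luv); split.
  apply: (Lfun2_ae_eq _ (derive1_linear c lu lv)); first exact: lipschitzian_measurable_derive1.
  by apply: Lfun2D => //; exact: Lfun2Z.
exists (a + c * a'), (b + c * b').
by apply: (Lfun2_ext (Lfun2D uab (Lfun2Z c vab))) => x; lra.
Qed.

Lemma L2_cst0 : L2 (fun x : R => 0).
Proof.
have /(congr1 (fun f => L2 f)) : (fun x : R => 0 * chip^`() x) = (fun x : R => 0).
  by apply/funext => x; rewrite mul0r.
by move=> <-; apply: Lfun2Z; exact: chip_derive1_L2.
Qed.

Lemma E2_cst (c : R) : E2 chim chip (fun x => c).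
Proof.
apply/(E2P (lipschitzian_cst c)); split.
  by rewrite (_ : _^`() = (fun x => 0)); [exact: L2_cst0|apply/funext => x; rewrite derive1_cst].
exists c, c; rewrite (_ : (fun _ => _) = (fun x => 0)); first exact: L2_cst0.
by apply/funext => x; rewrite (chimE chi); lra.
Qed.

(** A map at bounded distance from the identity changes the cutoff only on a
    bounded set. *)
Lemma chip_comp_L2 h k (C : R) : bilipschitz h k -> (forall x, `|h x - x| <= C) ->
  L2 (fun x => chip (h x) - chip x).
Proof.
move=> b hC; have C0 : 0 <= C by rewrite (le_trans _ (hC 0)).
have mh := bilipschitz_measurable b.
have mc : measurable_fun setT chip by apply: lipschitzian_measurable; exact: chip_lipschitzian chi.
apply: (@Lfun2_bounded_supp _ _ 2 (- 1 - C) (1 + C)).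
- by apply: measurable_funB => //; exact: measurableT_comp.
- move=> x; rewrite (le_trans (ler_normB _ _))//.
  by have := lerD (chip_norm_le1 chi (h x)) (chip_norm_le1 chi x); lra.
move=> x /negP; rewrite negb_and -!ltNge => /orP[x1|x1]; have := hC x; rewrite ler_norml => /andP[h1 h2].
  by rewrite !(chip_eq0 chi) ?subrr//; lra.
by rewrite !(chip_eq1 chi) ?subrr//; lra.
Qed.

Lemma derive1_bicomp f h k : lipschitzian f -> bilipschitz h k ->
  {ae mu, forall x, [/\ derivable h x 1, derivable f (h x) 1 &
     (f \o h)^`() x = f^`() (h x) * h^`() x]}.
Proof.
move=> lf b.
apply: ae_imp (ae_and (lipschitzian_ae_derivable (bl_lip b)) (bilipschitz_ae b (lipschitzian_ae_derivable lf))).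
by move=> x [dh df]; split => //; exact: derive1_comp.
Qed.

Lemma L2_derive1_bicomp f h k : lipschitzian f -> bilipschitz h k ->
  L2 f^`() -> L2 (f \o h)^`().
Proof.
move=> lf b f2.
have lfh : lipschitzian (f \o h) by apply: lipschitzian_comp => //; exact: bl_lip b.
have [L hL] := bl_lip b.
apply: (@Lfun2_le _ _ (fun x => L * f^`() (h x))).
- exact: lipschitzian_measurable_derive1.
- apply: ae_imp (derive1_bicomp lf b) => x [_ _ ->].
  rewrite !normrM mulrC ler_wpM2r// (le_trans (lipschitz_with_derive1 _ hL))//.
  exact: ler_norm.
- by apply: Lfun2Z; exact: (Lfun2_comp b).
Qed.

Lemma E2_comp u h k (C : R) : lipschitzian u -> bilipschitz h k ->
  (forall x, `|h x - x| <= C) -> E2 chim chip u -> E2 chim chip (u \o h).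
Proof.
move=> lu b hC /(E2P lu)[u2 [a [b' uab]]].
have luh : lipschitzian (u \o h) by apply: lipschitzian_comp => //; exact: bl_lip b.
apply/(E2P luh); split; first exact: (L2_derive1_bicomp lu b).
exists a, b'.
apply: (Lfun2_ext (Lfun2D (Lfun2_comp b uab) (Lfun2Z (a - b') (chip_comp_L2 b hC)))) => x /=.
by rewrite (chimE chi); lra.
Qed.

Lemma E1_comp u h k (C : R) : lipschitzian u -> bilipschitz h k ->
  (forall x, `|h x - x| <= C) -> E1 chip u -> E1 chip (u \o h).
Proof.
move=> lu b hC /(E1P lu)[u2 [a ua]].
have luh : lipschitzian (u \o h) by apply: lipschitzian_comp => //; exact: bl_lip b.
apply/(E1P luh); split; first exact: (L2_derive1_bicomp lu b).
exists a.
by apply: (Lfun2_ext (Lfun2D (Lfun2_comp b ua) (Lfun2Z a (chip_comp_L2 b hC)))) => x /=; lra.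
Qed.

Lemma lipschitz_nondecreasing f : lipschitzian f -> {ae mu, forall x, 0 <= f^`() x} ->
  {homo f : x y / x <= y}.
Proof.
move=> [L fL] [N [mN N0 HN]] x y xy.
rewrite -subr_ge0 -(lipschitz_FTC fL xy) /Rintegral fine_ge0//.
have mf' : measurable_fun setT f^`() by apply: lipschitzian_measurable_derive1; exists L.
rewrite (@ae_eq_integral _ _ _ mu `[x, y]%classic (fun x => (Num.max 0 (f^`() x))%:E)).
- by apply: integral_ge0 => z _; rewrite lee_fin le_max lexx.
- by [].
- by apply/measurable_EFinP; exact: measurable_funTS.
- by apply/measurable_EFinP; apply: measurable_funTS; exact: measurable_maxr.
exists N; split => // z /= H; apply: HN => /= f0; apply: H => _.
by rewrite (max_idPr f0).
Qed.

End EnergySpaces.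

(** * Energies: bounded nondecreasing functions in E1 *)

Section Limits.
Context {R : realType}.
Implicit Types f g u v : R -> R.
Local Notation mu := (@lebesgue_measure R).
Local Notation L2 f := (f \in Lfun mu 2%:E).

Lemma L2_not_bounded_below f c (I : set R) : L2 f -> 0 < c -> measurable I ->
  mu I = +oo%E -> (forall x, I x -> c <= `|f x|) -> False.
Proof.
move=> /Lfun2P[mf foo] c0 mI Ioo cf.
have : ((c ^+ 2)%:E * mu I <= \int[mu]_x (f x ^+ 2)%:E)%E.
  rewrite -integral_cst//.
  apply: (@le_trans _ _ (\int[mu]_(x in I) (f x ^+ 2)%:E)%E).
    apply: ge0_le_integral => //.
    - by move=> x _; rewrite /= lee_fin sqr_ge0.
    - by apply/measurable_EFinP; apply: measurable_funTS; exact: measurable_funX.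
    - move=> x Ix; rewrite /= lee_fin -[leRHS]real_normK ?num_real//.
      by apply: lerXn2r; rewrite ?nnegrE//; [exact: ltW|exact: cf].
  apply: ge0_subset_integral => //.
  - by apply/measurable_EFinP; exact: measurable_funX.
  - by move=> x _; rewrite lee_fin sqr_ge0.
rewrite Ioo gt0_muley ?lte_fin ?exprn_gt0// leye_eq => /eqP E.
by rewrite E ltxx in foo.
Qed.

Lemma lebesgue_Nyc (a : R) : mu `]-oo, a] = +oo%E.
Proof. by rewrite lebesgue_measure_itv/= ltNyr. Qed.

Lemma lebesgue_cy (a : R) : mu `[a, +oo[ = +oo%E.
Proof. by rewrite lebesgue_measure_itv/= ltry. Qed.

(** Dominated convergence; [c] is 1 or 0 when [u] tends to [+oo] or [-oo]. *)
Lemma cvg_Rintegral_seq v (u : R^nat) (c : R) : mu.-integrable setT (EFin \o v) ->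
  (forall z, \forall n \near \oo, (\1_(`]-oo, u n]) z : R) = c) ->
  \int[mu]_(z in `]-oo, u n]) v z @[n --> \oo] --> c * \int[mu]_z v z.
Proof.
move=> iv uc.
have mv : measurable_fun setT v by have /measurable_int/measurable_EFinP := iv.
have := @dominated_convergence _ _ _ mu setT measurableT
  (fun n z => (v z * \1_(`]-oo, u n]) z)%:E) (fun z => (c * v z)%:E) (fun z => `|v z|%:E).
case.
- by move=> n; apply/measurable_EFinP; apply: measurable_funM => //; exact: measurable_indic.
- by apply/measurable_EFinP; exact: measurable_funM.
- apply: aeW => z _; apply: cvg_EFin; first exact: nearW.
  by apply: cvg_near_cst; apply: filterS (uc z) => n /= ->; rewrite mulrC.
- exact: integrable_norm.
- apply/aeW => z n _; rewrite lee_fin normrM ler_piMr// indicE.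
  by case: (_ \in _); rewrite ?normr1 ?normr0.
move=> _ _ H.
have E n : (\int[mu]_z (v z * \1_(`]-oo, u n]) z)%:E = \int[mu]_(z in `]-oo, u n]) (v z)%:E)%E.
  rewrite [RHS]integral_mkcond; apply: eq_integral => z _; rewrite patchE indicE.
  by case: ifPn; rewrite ?mulr1 ?mulr0.
have icv : mu.-integrable setT (EFin \o (fun z => c * v z)).
  exact: (@integrableZl _ _ _ _ _ measurableT c _ iv).
have F : (\int[mu]_z (c * v z)%:E)%E = (c * \int[mu]_z v z)%:E.
  by rewrite -RintegralZl// /Rintegral fineK//; exact: integrable_fin_num icv.
rewrite F in H.
suff -> : (fun n => \int[mu]_(z in `]-oo, u n]) v z) =
  fine \o (fun n => \int[mu]_z (v z * \1_(`]-oo, u n]) z)%:E)%E by exact: (fine_cvg H).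
by apply/funext => n; rewrite /= E.
Qed.

Lemma cvg_Rintegral_y v : mu.-integrable setT (EFin \o v) ->
  \int[mu]_(z in `]-oo, x]) v z @[x --> +oo] --> \int[mu]_z v z.
Proof.
move=> iv; apply/cvg_pinftyP => u uy; rewrite -[X in _ --> X]mul1r.
apply: cvg_Rintegral_seq => // z; move/cvgryPge : uy => /(_ z); apply: filterS => n zn.
by rewrite indicE mem_set//= in_itv.
Qed.

Lemma cvg_Rintegral_Ny v : mu.-integrable setT (EFin \o v) ->
  \int[mu]_(z in `]-oo, x]) v z @[x --> -oo] --> (0 : R).
Proof.
move=> iv; apply/cvg_ninftyP => u uy; rewrite -[X in _ --> X](mul0r (\int[mu]_z v z)).
apply: cvg_Rintegral_seq => // z; move/cvgrNyPlt : uy => /(_ z); apply: filterS => n zn.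
by rewrite indicE memNset//= in_itv/= leNgt zn.
Qed.

Lemma RintegralD_Ny v x y : mu.-integrable setT (EFin \o v) -> x <= y ->
  \int[mu]_(z in `]-oo, y]) v z - \int[mu]_(z in `]-oo, x]) v z = \int[mu]_(z in `[x, y]) v z.
Proof.
move=> iv xy; rewrite Rintegral_itvB//; last by apply: integrableS iv.
by rewrite Rintegral_itv_obnd_cbnd//; apply: integrableS iv.
Qed.

(** The integral over [[-n, n]] is an increment of [f], which is at most
    [2 C]. *)
Lemma nondecreasing_bounded_integrable f C : lipschitzian f -> {homo f : x y / x <= y} ->
  (forall x, `|f x| <= C) -> mu.-integrable setT (EFin \o f^`()).
Proof.
move=> lf nd fC; have [L fL] := lf.
have mf' := lipschitzian_measurable_derive1 lf.
have f'0 x : 0 <= f^`() x by exact: nondecreasing_derive1_ge0.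
apply/integrableP; split; first exact/measurable_EFinP.
rewrite (_ : (fun x => _) = (fun x => (f^`() x)%:E)); last first.
  by apply/funext => x /=; rewrite ger0_norm.
pose S (n : nat) : set (measurableTypeR R) := `[- (n%:R : R), n%:R]%classic.
have ndS : nondecreasing_seq S.
  move=> m n mn; apply/subsetPset => z; rewrite /S/= !in_itv/= => /andP[h1 h2].
  have mnR : m%:R <= n%:R :> R by rewrite ler_nat.
  by rewrite (le_trans h2)// andbT (le_trans _ h1)// lerN2.
have US : \bigcup_n S n = setT.
  apply/seteqP; split => // z _; exists (Num.bound `|z|) => //.
  by rewrite /S /= in_itv/= -ler_norml ltW// archi_boundP.
have := @ge0_nondecreasing_set_cvg_integral _ _ _ S (fun x => (f^`() x)%:E) mu ndS.
rewrite US => H.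
have {}H : (fun n => (\int[mu]_(x in S n) (f^`() x)%:E)%E) @ \oo --> (\int[mu]_x (f^`() x)%:E)%E.
  apply: H => //.
  - by move=> n; exact: measurable_itv.
  - by move=> n; apply/measurable_EFinP; exact: measurable_funTS.
  - by move=> n x _; rewrite lee_fin.
rewrite -(cvg_lim (@ereal_hausdorff R) H).
apply: (@le_lt_trans _ _ (2 * C)%:E); last exact: ltry.
apply: lime_le; first by apply/cvg_ex; eexists; exact: H.
apply: nearW => n.
have nn : - (n%:R : R) <= n%:R by rewrite (le_trans (y := 0))// oppr_le0.
have -> : (\int[mu]_(x in S n) (f^`() x)%:E = (\int[mu]_(x in S n) f^`() x)%:E)%E.
  rewrite /Rintegral fineK//; apply: integrable_fin_num; first exact: measurable_itv.
  exact: lipschitz_integrable_derive1 fL.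
rewrite lee_fin (lipschitz_FTC fL nn).
have := fC n%:R; have := fC (- n%:R); rewrite !ler_norml => /andP[? ?] /andP[? ?]; lra.
Qed.

Lemma L2_cvg_Ny f (l : R) : L2 f -> f x @[x --> -oo] --> l -> l = 0.
Proof.
move=> f2 fl; apply/eqP/negPn/negP => l0.
have l2 : `|l| / 2 < `|l| by have : 0 < `|l| by [rewrite normr_gt0]; lra.
have [M [_ HM]] := cvgr_gt _ (cvg_norm fl) _ l2.
apply: (@L2_not_bounded_below f (`|l| / 2) `]-oo, M - 1]%classic f2).
- by rewrite divr_gt0 ?normr_gt0.
- exact: measurable_itv.
- exact: lebesgue_Nyc.
- by move=> x /=; rewrite in_itv/= => xM; apply/ltW/HM; lra.
Qed.

Lemma L2_cvg_y f (l : R) : L2 f -> f x @[x --> +oo] --> l -> l = 0.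
Proof.
move=> f2 fl; apply/eqP/negPn/negP => l0.
have l2 : `|l| / 2 < `|l| by have : 0 < `|l| by [rewrite normr_gt0]; lra.
have [M [_ HM]] := cvgr_gt _ (cvg_norm fl) _ l2.
apply: (@L2_not_bounded_below f (`|l| / 2) `[M + 1, +oo[%classic f2).
- by rewrite divr_gt0 ?normr_gt0.
- exact: measurable_itv.
- exact: lebesgue_cy.
- by move=> x /=; rewrite in_itv/= andbT => xM; apply/ltW/HM; lra.
Qed.

Section energy.
Variables (chim chip : R -> R) (chi : cutoffs chim chip).

(** The derivative is integrable, so [V - a * chip] has limits at infinity;
    being square integrable it tends to 0. Hence [V] vanishes at [-oo] and [a]
    is the integral of the derivative. *)
Lemma energy_primitive V (C : R) : lipschitzian V -> {homo V : x y / x <= y} ->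
  (forall x, `|V x| <= C) -> E1 chip V ->
  L2 (fun x => V x - (\int[mu]_z V^`() z) * chip x) /\
  forall x, V x = \int[mu]_(z in `]-oo, x]) V^`() z.
Proof.
move=> lV nd VC /(E1P chi lV)[_ [a Va]].
have iV := nondecreasing_bounded_integrable lV nd VC.
have [L VL] := lV.
pose W x := \int[mu]_(z in `]-oo, x]) V^`() z.
have WV x y : x <= y -> W y - W x = V y - V x.
  by move=> xy; rewrite RintegralD_Ny// (lipschitz_FTC VL xy).
pose k := V 0 - W 0.
have Vk x : V x = k + W x.
  rewrite /k; have [x0|/ltW x0] := leP x 0; first by have := WV _ _ x0; lra.
  by have := WV _ _ x0; lra.
have k0 : k = 0.
  apply: (L2_cvg_Ny Va).
  have Wk : k + W x @[x --> -oo] --> k + 0 by apply: cvgD; [exact: cvg_cst|exact: cvg_Rintegral_Ny].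
  rewrite addr0 in Wk; apply: cvg_trans Wk; apply: near_eq_cvg.
  exists (-1); split; first exact: num_real.
  by move=> x x1; rewrite /= (chip_eq0 chi (ltW x1)) mulr0 subr0 Vk.
have aE : \int[mu]_z V^`() z - a = 0.
  apply: (L2_cvg_y Va).
  have Wa : W x - a @[x --> +oo] --> \int[mu]_z V^`() z - a.
    by apply: cvgB; [exact: cvg_Rintegral_y|exact: cvg_cst].
  apply: cvg_trans Wa; apply: near_eq_cvg.
  exists 1; split; first exact: num_real.
  by move=> x x1; rewrite /= (chip_eq1 chi (ltW x1)) mulr1 Vk k0 add0r.
by rewrite (subr0_eq aE); split => // x; rewrite Vk k0 add0r.
Qed.

Lemma Rintegral_le_setT v (D : set R) : measurable D -> (forall x, 0 <= v x) ->
  mu.-integrable setT (EFin \o v) -> \int[mu]_(z in D) v z <= \int[mu]_z v z.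
Proof.
move=> mD v0 iv; apply: fine_le.
- by apply: integrable_fin_num => //; apply: integrableS iv.
- exact: integrable_fin_num.
apply: ge0_subset_integral => //.
- by have /measurable_int := iv.
- by move=> u _; rewrite lee_fin.
Qed.

(** Every time dependent quantity of the system is a primitive of this form.
    Its tails are square integrable because those of [V] are: far to the left
    [W <= c * V], and far to the right the part of the integral of [w] that is
    missing in [W] is at most [c] times the corresponding part for [V]. *)
Lemma energy_dominated V (C : R) (w : R -> R) (c : R) : lipschitzian V -> {homo V : x y / x <= y} ->
  (forall x, `|V x| <= C) -> E1 chip V ->
  measurable_fun setT w -> 0 <= c -> (forall x, 0 <= w x <= c * V^`() x) ->
  let W := fun x => \int[mu]_(z in `]-oo, x]) w z in
  [/\ mu.-integrable setT (EFin \o w), lipschitzian W,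
     {ae mu, forall x, derivable W x 1 /\ W^`() x = w x},
     (forall x, 0 <= W x <= \int[mu]_z w z) & E1 chip W].
Proof.
move=> lV nd VC EV mw c0 wV W.
have [Va VE] := energy_primitive lV nd VC EV.
have iV := nondecreasing_bounded_integrable lV nd VC.
have [L VL] := lV.
have w0 x : 0 <= w x by have /andP[] := wV x.
have wle x : w x <= c * V^`() x by have /andP[] := wV x.
have icV : mu.-integrable setT (EFin \o (fun x => c * V^`() x)).
  exact: (@integrableZl _ _ _ _ _ measurableT c _ iV).
have iw : mu.-integrable setT (EFin \o w).
  apply: (le_integrable measurableT _ _ icV); first exact/measurable_EFinP.
  move=> x _ /=; rewrite lee_fin (ger0_norm (w0 x)) ger0_norm//.
  by rewrite (le_trans (w0 x)).
have WE x y : x <= y -> W y - W x = \int[mu]_(z in `[x, y]) w z.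
  by move=> xy; exact: RintegralD_Ny.
have iw' a b : mu.-integrable `[a, b] (EFin \o w) by apply: integrableS iw.
have WD x : 0 <= W x <= \int[mu]_z w z.
  by rewrite Rintegral_ge0//=; apply: Rintegral_le_setT.
have le_w (D : set R) : measurable D -> \int[mu]_(z in D) w z <= c * \int[mu]_(z in D) V^`() z.
  move=> mD; rewrite -RintegralZl//; last by apply: integrableS iV.
  apply: le_Rintegral => //; first by apply: integrableS iw.
  by apply: integrableS icV.
have lW : lipschitzian W.
  exists (c * L).
  have main x y : x <= y -> `|W y - W x| <= c * L * `|y - x|.
    move=> xy; rewrite WE// ger0_norm; last exact: Rintegral_ge0.
    apply: (le_trans (le_w _ (measurable_itv _))).
    rewrite (lipschitz_FTC VL xy) -mulrA ler_wpM2l// (le_trans (ler_norm _))//.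
  move=> x y; have [yx|/ltW xy] := leP y x; first exact: main.
  by rewrite distrC (distrC x); exact: main.
have dW := ae_eq_derive1_primitive mw iw' WE.
split => //.
have [V'2 _] := (E1P chi lV).1 EV.
apply/(E1P chi lW); split.
  apply: (@Lfun2_le _ _ (fun x => c * V^`() x)).
  - exact: lipschitzian_measurable_derive1.
  - apply: ae_imp dW => x [_ ->]; rewrite ger0_norm// (le_trans (wle x))// ler_norm//.
  - exact: Lfun2Z.
exists (\int[mu]_z w z).
set Winf := \int[mu]_z w z; set Vinf := \int[mu]_z V^`() z in Va.
have Winf0 : 0 <= Winf by exact: Rintegral_ge0.
(* a square integrable bound for the difference of [W] and [Winf * chip]; the
   second term takes care of the interval where the cutoff is neither 0 nor 1 *)
pose h x := c * `|V x - Vinf * chip x| + 2 * Winf * (\1_(`[-1, 1]) x : R).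
have h2 : L2 h.
  apply: Lfun2D; apply: Lfun2Z.
    apply: Lfun2_le Va.
    - apply: measurableT_comp => //; apply: measurable_funB; first exact: lipschitzian_measurable.
      by apply: measurable_funM => //; apply: lipschitzian_measurable; exact: chip_lipschitzian chi.
    - by apply: aeW => x; rewrite normr_id.
  apply: (@Lfun2_bounded_supp _ _ 1 (-1) 1).
  - exact: measurable_indic.
  - by move=> x; rewrite indicE; case: (_ \in _); rewrite ?normr1 ?normr0.
  - by move=> x H; rewrite indicE memNset//= in_itv/=.
apply: Lfun2_le h2.
  apply: measurable_funB; first exact: lipschitzian_measurable.
  by apply: measurable_funM => //; apply: lipschitzian_measurable; exact: chip_lipschitzian chi.
apply: aeW => x; have [W0 W1] := andP (WD x).
have Vx : W x <= c * V x by rewrite VE; exact: le_w.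
have hx0 : 0 <= h x.
  by rewrite /h addr_ge0// mulr_ge0// ?mulr_ge0.
rewrite (ger0_norm hx0).
have [x1|x1] := leP x (-1).
  rewrite (chip_eq0 chi x1) mulr0 subr0 /h (chip_eq0 chi x1) mulr0 subr0 ger0_norm//.
  rewrite (@le_trans _ _ (c * `|V x|))//; last by rewrite lerDl mulr_ge0// mulr_ge0.
  by rewrite (le_trans Vx)// ler_wpM2l// ler_norm.
have [x2|x2] := leP 1 x.
  rewrite (chip_eq1 chi x2) mulr1 /h (chip_eq1 chi x2) mulr1 distrC ger0_norm ?subr_ge0//.
  rewrite (@le_trans _ _ (c * `|V x - Vinf|))//; last by rewrite lerDl mulr_ge0// mulr_ge0.
  have tail v : mu.-integrable setT (EFin \o v) ->
     \int[mu]_z v z - \int[mu]_(z in `]-oo, x]) v z = \int[mu]_(z in `]x, +oo[) v z.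
    by move=> iv; rewrite -[X in X - _]/(Rintegral mu setT v) -set_itvNyy Rintegral_itvB//; apply: integrableS iv.
  rewrite tail// (le_trans (le_w _ (measurable_itv _)))//.
  by rewrite -tail// -VE ler_wpM2l// distrC ler_norm.
rewrite /h indicE mem_set/=; last by rewrite in_itv/= !ltW.
rewrite mulr1 (@le_trans _ _ (2 * Winf))// ?lerDr ?mulr_ge0//.
have := cutoffs_bound chi x => /andP[c1 c2].
rewrite (le_trans (ler_normB _ _))// normrM !ger0_norm//.
have cW : Winf * chip x <= Winf by rewrite ler_piMr.
by rewrite -/Winf in W1; lra.
Qed.
End energy.
End Limits.

(** * The dynamics at one label *)

Section PointwiseDynamics.
Context {R : realFieldType}.
Implicit Types p u w h t : R.

(** At a fixed label [p], [u], [w] are the initial values of the derivatives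
    of [y], [U], [V], subject to [p * w = u ^+ 2]. A label with [u < 0] breaks
    at the time [- 2 * p / u], and [lost] is the time elapsed since then. *)
Definition lost p u t := if u < 0 then Num.max 0 (t + 2 * p / u) else 0.
(** The fraction of the energy at the label that is left at time [t]. *)
Definition survive alpha p u t : R :=
  1 - alpha * ((u < 0) && (2 * p + t * u <= 0))%:R.
(** The first and second integrals in time of [survive]. *)
Definition mass1 alpha p u t := t - alpha * lost p u t.
Definition mass2 alpha p u t := t ^+ 2 / 2 - alpha * (lost p u t ^+ 2 / 2).
(** The derivatives of [y], [U], [V] at time [t]: the system, differentiated
    with respect to the label, is an ordinary differential equation at each
    label. *)
Definition pt alpha p u w t := p + t * u + 2^-1 * (w * mass2 alpha p u t).
Definition ut alpha p u w t := u + 2^-1 * (w * mass1 alpha p u t).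
Definition wt alpha p u w t := w * survive alpha p u t.

(** The constraint leaves two free parameters at a breaking label: its
    breaking time [tau] and a size [q]. In these the dynamics is polynomial. *)
Lemma breaking_param p u w : 0 <= p -> p * w = u ^+ 2 -> u < 0 ->
  exists2 q, 0 < q & exists2 tau, 0 < tau &
    [/\ p = q * tau ^+ 2, u = - 2 * q * tau, w = 4 * q & - 2 * p / u = tau].
Proof.
move=> p0 pw u0.
have u20 : 0 < u ^+ 2 by rewrite expr2; nra.
have pp : 0 < p.
  by rewrite lt_neqAle p0 andbT; apply/eqP => pE; move: u20; rewrite -pw -pE mul0r ltxx.
have wp : 0 < w by rewrite -(pmulr_rgt0 _ pp) pw.
pose tau := - 2 * p / u.
have ut : u * tau = - 2 * p by rewrite /tau mulrC divfK// lt_eqF.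
have taup : 0 < tau by rewrite -(nmulr_rlt0 _ u0) ut; lra.
exists (w / 4); first by lra.
exists tau => //.
have E1 : u * (w * tau) = - 2 * u ^+ 2 by rewrite -pw; nra.
have E2 : w * tau = - 2 * u.
  by apply: (mulfI (lt0r_neq0 (ltac:(by rewrite oppr_gt0) : 0 < - u))); nra.
split => //; last by lra.
- have : w * tau ^+ 2 = 4 * p by rewrite expr2 mulrA E2; nra.
  lra.
- lra.
Qed.

Lemma lost_param q tau t : 0 < q -> 0 < tau ->
  lost (q * tau ^+ 2) (- 2 * q * tau) t = Num.max 0 (t - tau).
Proof.
move=> q0 tau0; rewrite /lost ifT; last by nra.
have nz : - 2 * q * tau != 0 by rewrite lt_eqF//; nra.
have -> : 2 * (q * tau ^+ 2) / (- 2 * q * tau) = - tau.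
  by apply: (mulIf nz); rewrite divfK//; nra.
by [].
Qed.

Lemma survive_param alpha q tau t : 0 < q -> 0 < tau ->
  survive alpha (q * tau ^+ 2) (- 2 * q * tau) t = 1 - alpha * ((tau <= t)%R)%:R.
Proof.
move=> q0 tau0; rewrite /survive; have -> /= : - 2 * q * tau < 0 by nra.
have -> : 2 * (q * tau ^+ 2) + t * (- 2 * q * tau) = (2 * q * tau) * (tau - t) by lra.
by rewrite pmulr_rle0 ?subr_le0//; nra.
Qed.

Lemma lost_ge0u p u t : 0 <= u -> lost p u t = 0.
Proof. by rewrite /lost ltNge => ->. Qed.

Lemma survive_ge0u alpha p u t : 0 <= u -> survive alpha p u t = 1.
Proof. by rewrite /survive ltNge => -> /=; rewrite mulr0 subr0. Qed.

Section alpha.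
Variables (alpha : R) (a01 : 0 <= alpha <= 1).

Lemma survive_bounds p u t : 0 <= survive alpha p u t <= 1.
Proof.
by move: a01 => /andP[? ?]; rewrite /survive; case: ((u < 0) && _); rewrite ?mulr1 ?mulr0; apply/andP; split; lra.
Qed.

Lemma lost_bounds p u t : 0 <= p -> 0 <= t -> 0 <= lost p u t <= t.
Proof.
move=> p0 t0; rewrite /lost; case: ifPn => u0; last by rewrite lexx.
rewrite le_max lexx/= ge_max t0/= gerDl.
by rewrite mulr_ge0_le0 ?mulr_ge0// invr_le0 ltW.
Qed.

Lemma mass1_bounds p u t : 0 <= p -> 0 <= t -> 0 <= mass1 alpha p u t <= t.
Proof.
move=> p0 t0; have /andP[l0 l1] := lost_bounds u p0 t0; move: a01 => /andP[? ?].
by rewrite /mass1; apply/andP; split; nra.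
Qed.

Lemma mass2_bounds p u t : 0 <= p -> 0 <= t -> 0 <= mass2 alpha p u t <= t ^+ 2 / 2.
Proof.
move=> p0 t0; have /andP[l0 l1] := lost_bounds u p0 t0; move: a01 => /andP[a0 a1].
have l2 : 0 <= lost p u t ^+ 2 <= t ^+ 2 by rewrite sqr_ge0 lerXn2r.
move: l2 => /andP[l2 l3]; rewrite /mass2.
by apply/andP; split; nra.
Qed.

(** The label never breaks, has not broken yet, or has broken. In the last two
    cases [p] is a parabola in time with vertex at the breaking time,
    multiplied by [1 - alpha] after it. *)
Lemma dynamics_cases p u w t : 0 <= p -> 0 <= w -> p * w = u ^+ 2 -> 0 <= t ->
  [\/ [/\ 0 <= u, ut alpha p u w t = u + 2^-1 * (w * t),
          pt alpha p u w t = p + t * u + 4^-1 * (w * t ^+ 2) & wt alpha p u w t = w],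
      (exists q tau, [/\ 0 < q, 0 < tau, t < tau & [/\ p = q * tau ^+ 2, u = - 2 * q * tau, w = 4 * q &
         [/\ ut alpha p u w t = - 2 * q * (tau - t),
          pt alpha p u w t = q * (tau - t) ^+ 2 & wt alpha p u w t = w]]]) |
      (exists q tau, [/\ 0 < q, 0 < tau, tau <= t & [/\ p = q * tau ^+ 2, u = - 2 * q * tau, w = 4 * q &
         [/\ ut alpha p u w t = 2 * q * (1 - alpha) * (t - tau),
          pt alpha p u w t = q * (1 - alpha) * (t - tau) ^+ 2 & wt alpha p u w t = w * (1 - alpha)]]])].
Proof.
move=> p0 w0 pw t0; have [u0|u0] := leP 0 u.
  apply: Or31; split => //.
  - by rewrite /ut /mass1 lost_ge0u// mulr0 subr0.
  - by rewrite /pt /mass2 lost_ge0u// expr0n/= mul0r mulr0 subr0; lra.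
  - by rewrite /wt survive_ge0u// mulr1.
have [q q0 [tau tau0 [pE uE wE _]]] := breaking_param p0 pw u0.
have [tt|tt] := ltP t tau.
  apply: Or32; exists q, tau; split => //; split => //; split.
  - by rewrite /ut /mass1 pE uE wE lost_param// (max_idPl _) ?subr_le0 ?ltW// mulr0 subr0; lra.
  - by rewrite /pt /mass2 pE uE wE lost_param// (max_idPl _) ?subr_le0 ?ltW// expr0n/= mul0r mulr0 subr0; lra.
  - by rewrite /wt pE uE survive_param// leNgt tt/= mulr0 subr0 mulr1.
apply: Or33; exists q, tau; split => //; split => //; split.
- by rewrite /ut /mass1 pE uE wE lost_param// (max_idPr _) ?subr_ge0//; lra.
- by rewrite /pt /mass2 pE uE wE lost_param// (max_idPr _) ?subr_ge0//; lra.
- by rewrite /wt pE uE survive_param// tt mulr1.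
Qed.

Lemma dynamics_invariant p u w t : 0 <= p -> 0 <= w -> p * w = u ^+ 2 -> 0 <= t ->
  [/\ 0 <= pt alpha p u w t, 0 <= wt alpha p u w t <= w &
      pt alpha p u w t * wt alpha p u w t = ut alpha p u w t ^+ 2].
Proof.
move=> p0 w0 pw t0; move: a01 => /andP[a0 a1].
case: (dynamics_cases p0 w0 pw t0).
- move=> [u0 -> -> ->]; rewrite w0 lexx; split => //.
    by rewrite !addr_ge0// !mulr_ge0// ?invr_ge0// sqr_ge0.
  have -> : (p + t * u + 4^-1 * (w * t ^+ 2)) * w = p * w + t * u * w + 4^-1 * (w ^+ 2 * t ^+ 2) by lra.
  by rewrite pw; lra.
- move=> [q [tau [q0 tau0 tt [pE uE wE [-> -> ->]]]]]; rewrite w0 lexx; split => //.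
    by rewrite mulr_ge0 ?sqr_ge0 ?ltW.
  by rewrite wE; lra.
- move=> [q [tau [q0 tau0 tt [pE uE wE [-> -> ->]]]]]; split.
  + by rewrite !mulr_ge0 ?sqr_ge0 ?subr_ge0 ?(ltW q0).
  + by rewrite mulr_ge0 ?subr_ge0//= ler_piMr//; lra.
  + by rewrite wE; lra.
Qed.

(** The slope [p + h] cannot collapse: where [p] vanishes, at the breaking
    time, [h] is bounded below by [w = 4 * q]. The factor on the right is at
    most the exponential of [t]. *)
Lemma dynamics_lower p u w h t : 0 <= p -> 0 <= w <= h -> p * w = u ^+ 2 -> 0 <= t ->
  (p + h) <= (1 + t + t ^+ 2 / 2) * (pt alpha p u w t + h).
Proof.
move=> p0 /andP[w0 wh] pw t0; move: a01 => /andP[a0 a1].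
have h0 : 0 <= h by lra.
have t20 : 0 <= t ^+ 2 by rewrite sqr_ge0.
case: (dynamics_cases p0 w0 pw t0).
- move=> [u0 _ -> _].
  have : 0 <= t * u by rewrite mulr_ge0.
  have : 0 <= w * t ^+ 2 by rewrite mulr_ge0.
  set A := t * u; set B := w * t ^+ 2 => B0 A0.
  have X : p + h <= p + A + 4^-1 * B + h by lra.
  apply: (le_trans X); rewrite ler_peMl//; lra.
- move=> [q [tau [q0 tau0 tt [pE uE wE [_ -> _]]]]].
  have s0 : 0 < tau - t by lra.
  set s := tau - t in s0 *.
  have tE : tau = s + t by rewrite /s; lra.
  have hq : 4 * q <= h by rewrite -wE.
  rewrite pE tE.
  have K : (s + t) ^+ 2 <= (1 + t + t ^+ 2 / 2) * s ^+ 2 + 4 * (t + t ^+ 2 / 2).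
    (* [2 * s * t <= t * s ^+ 2 + t] *)
    have : 0 <= t * ((s - 1) ^+ 2) by rewrite mulr_ge0 ?sqr_ge0.
    have : 0 <= (t ^+ 2) by [].
    have : 0 <= t ^+ 2 * s ^+ 2 by rewrite mulr_ge0 ?sqr_ge0.
    have -> : (s + t) ^+ 2 = s ^+ 2 + 2 * s * t + t ^+ 2 by lra.
    nra.
  have : q * (s + t) ^+ 2 <= q * ((1 + t + t ^+ 2 / 2) * s ^+ 2 + 4 * (t + t ^+ 2 / 2)).
    by rewrite ler_wpM2l// ltW.
  have : 4 * q * (t + t ^+ 2 / 2) <= h * (t + t ^+ 2 / 2) by rewrite ler_wpM2r//; lra.
  lra.
- move=> [q [tau [q0 tau0 tt [pE uE wE [_ -> _]]]]].
  have hq : 4 * q <= h by rewrite -wE.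
  have X : 0 <= q * (1 - alpha) * (t - tau) ^+ 2 by rewrite !mulr_ge0 ?sqr_ge0 ?subr_ge0 ?(ltW q0).
  have tau2 : tau ^+ 2 <= t ^+ 2 by rewrite lerXn2r// ?nnegrE ltW.
  rewrite pE.
  have Y : q * tau ^+ 2 <= q * t ^+ 2 by rewrite ler_wpM2l// ltW.
  have Z : 4 * q * t ^+ 2 <= h * t ^+ 2 by rewrite ler_wpM2r.
  apply: (@le_trans _ _ ((1 + t + t ^+ 2 / 2) * h)); last first.
    by rewrite ler_wpM2l ?lerDr//; lra.
  have : 0 <= t * h by rewrite mulr_ge0.
  lra.
Qed.
End alpha.
End PointwiseDynamics.

(** * Comparing two labels *)

Section PointwiseGap.
Context {R : realType}.
Implicit Types p u w t : R.

(** [breaking], [synchronous] and [gap] are the breaking time, the condition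
    that defines [Omega] and the function [G12], in terms of the derivatives
    at one label. *)
Definition breaking p u : \bar R :=
  if u < 0 then (- 2 * p / u)%:E else if (u == 0) && (p == 0) then 0%E else +oo%E.

Definition synchronous p1 u1 p2 u2 : Prop :=
  (0 <= u1 /\ 0 <= u2) \/
  [/\ (0 < breaking p1 u1)%E, breaking p1 u1 = breaking p2 u2 & (breaking p2 u2 < +oo)%E].

Definition gap p1 u1 w1 p2 u2 w2 : R :=
  if `[< synchronous p1 u1 p2 u2 >] then `|w1 - w2| else Num.max w1 w2.

Lemma breaking_paramE (q tau : R) : 0 < q -> 0 < tau ->
  breaking (q * tau ^+ 2) (- 2 * q * tau) = tau%:E.
Proof.
move=> q0 tau0; rewrite /breaking ifT; last by nra.
congr EFin; have nz : - 2 * q * tau != 0 by rewrite lt_eqF//; nra.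
by apply: (mulIf nz); rewrite divfK//; nra.
Qed.

Lemma breaking_finite p u : (0 < breaking p u)%E -> (breaking p u < +oo)%E -> u < 0.
Proof.
by rewrite /breaking; case: ifPn => // _; case: ifPn => // _; rewrite ltxx.
Qed.

Section data.
Variables (alpha : R) (a01 : 0 <= alpha <= 1).

(** The constraint excludes [p = 0] when [u < 0], so that the breaking time of
    such a label is positive. *)
Lemma survive_breaking p u w t : 0 <= p -> p * w = u ^+ 2 ->
  survive alpha p u t =
  1 - alpha * (`[< (0 < breaking p u)%E /\ (breaking p u <= t%:E)%E >])%:R.
Proof.
move=> p0 pw; have [u0|u0] := leP 0 u.
  rewrite survive_ge0u// (_ : `[< _ >] = false) ?mulr0 ?subr0//; apply/asboolPn.
  rewrite /breaking (ltNge u 0) u0/=; case: ifPn => _; first by rewrite ltxx => -[].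
  by rewrite leye_eq => -[].
have [q q0 [tau tau0 [pE uE wE _]]] := breaking_param p0 pw u0.
rewrite pE uE survive_param// breaking_paramE// lte_fin tau0 lee_fin.
congr (1 - alpha * (nat_of_bool _)%:R).
by apply/idP/asboolP => [|[]].
Qed.

Variables (p1 u1 w1 p2 u2 w2 t : R).
Hypotheses (p10 : 0 <= p1) (w10 : 0 <= w1) (e1 : p1 * w1 = u1 ^+ 2).
Hypotheses (p20 : 0 <= p2) (w20 : 0 <= w2) (e2 : p2 * w2 = u2 ^+ 2).
Hypothesis t0 : 0 <= t.

Lemma synchronous_cases : synchronous p1 u1 p2 u2 -> (0 <= u1 /\ 0 <= u2) \/
  exists q1 q2 tau, [/\ 0 < q1, 0 < q2, 0 < tau &
    [/\ p1 = q1 * tau ^+ 2, u1 = - 2 * q1 * tau, w1 = 4 * q1 &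
     [/\ p2 = q2 * tau ^+ 2, u2 = - 2 * q2 * tau & w2 = 4 * q2]]].
Proof.
move=> [|[b0 b12 boo]]; first by left.
have u20 : u2 < 0 by apply: (@breaking_finite p2) => //; rewrite -b12.
have u10 : u1 < 0 by apply: (@breaking_finite p1) => //; rewrite b12.
have [q1 q10 [tau1 tau10 [p1E u1E w1E _]]] := breaking_param p10 e1 u10.
have [q2 q20 [tau2 tau20 [p2E u2E w2E _]]] := breaking_param p20 e2 u20.
right; exists q1, q2, tau1; split => //; split => //.
by move: b12; rewrite p1E u1E p2E u2E !breaking_paramE// => -[->].
Qed.

(** A common breaking time is reduced by [t] until the two labels break
    together; from then on both have [0 <= u]. *)
Lemma synchronous_dynamics : synchronous p1 u1 p2 u2 ->
  synchronous (pt alpha p1 u1 w1 t) (ut alpha p1 u1 w1 t)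
              (pt alpha p2 u2 w2 t) (ut alpha p2 u2 w2 t).
Proof.
move: a01 => /andP[a0 a1].
move=> /synchronous_cases[[u10 u20]|[q1 [q2 [tau [q10 q20 tau0 [p1E u1E w1E [p2E u2E w2E]]]]]]].
  left; rewrite /ut /mass1 !lost_ge0u// !mulr0 !subr0.
  by split; rewrite addr_ge0// !mulr_ge0// invr_ge0.
have [tt|tt] := ltP t tau.
  right.
  have uE q : 0 < q -> ut alpha (q * tau ^+ 2) (- 2 * q * tau) (4 * q) t = - 2 * q * (tau - t).
    by move=> q0; rewrite /ut /mass1 lost_param// (max_idPl _) ?subr_le0 ?ltW// mulr0 subr0; lra.
  have pE q : 0 < q -> pt alpha (q * tau ^+ 2) (- 2 * q * tau) (4 * q) t = q * (tau - t) ^+ 2.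
    by move=> q0; rewrite /pt /mass2 lost_param// (max_idPl _) ?subr_le0 ?ltW// expr0n/= mul0r mulr0 subr0; lra.
  rewrite p1E u1E w1E p2E u2E w2E !uE// !pE//.
  by rewrite !breaking_paramE ?subr_gt0// lte_fin subr_gt0 ltry.
left.
have uE q : 0 < q -> 0 <= ut alpha (q * tau ^+ 2) (- 2 * q * tau) (4 * q) t.
  move=> q0; rewrite /ut /mass1 lost_param// (max_idPr _) ?subr_ge0//.
  have -> : - 2 * q * tau + 2^-1 * (4 * q * (t - alpha * (t - tau))) = 2 * q * ((1 - alpha) * (t - tau)) by lra.
  by rewrite mulr_ge0 ?mulr_ge0 ?subr_ge0// ltW.
by rewrite p1E u1E w1E p2E u2E w2E; split; exact: uE.
Qed.

Lemma normB_le_max (a b : R) : 0 <= a -> 0 <= b -> `|a - b| <= Num.max a b.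
Proof.
move=> a0 b0; rewrite ler_norml le_max; have [ab|/ltW ba] := leP a b.
  by apply/andP; split; [lra|apply/orP; right; lra].
by apply/andP; split; [lra|apply/orP; left; lra].
Qed.

Lemma gap_ge0 : 0 <= gap p1 u1 w1 p2 u2 w2.
Proof. by rewrite /gap; case: ifPn => // _; rewrite le_max w10. Qed.

(** Synchronous labels keep the same fraction of their energies. For the other
    ones [gap] is at most the larger of the two energies, and energies do not
    increase. *)
Lemma gap_dynamics :
  gap (pt alpha p1 u1 w1 t) (ut alpha p1 u1 w1 t) (wt alpha p1 u1 w1 t)
      (pt alpha p2 u2 w2 t) (ut alpha p2 u2 w2 t) (wt alpha p2 u2 w2 t) <= gap p1 u1 w1 p2 u2 w2.
Proof.
have [_ /andP[a1 b1] _] := dynamics_invariant a01 p10 w10 e1 t0.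
have [_ /andP[a2 b2] _] := dynamics_invariant a01 p20 w20 e2 t0.
rewrite [leRHS]/gap; case: ifPn => [/asboolP s|_].
  have s' := synchronous_dynamics s.
  rewrite /gap ifT; last exact/asboolP.
  move: s => /synchronous_cases[[u10 u20]|[q1 [q2 [tau [q10 q20 tau0 [p1E u1E w1E [p2E u2E w2E]]]]]]].
    by rewrite /wt !survive_ge0u// !mulr1.
  rewrite /wt p1E u1E p2E u2E !survive_param// -mulrBl normrM ler_piMr//.
  have := survive_bounds a01 p1 u1 t; rewrite p1E u1E survive_param// => /andP[s0 s1].
  by rewrite ger0_norm.
apply: (@le_trans _ _ (Num.max (wt alpha p1 u1 w1 t) (wt alpha p2 u2 w2 t))).
  by rewrite /gap; case: ifPn => // _; exact: normB_le_max.
by rewrite ge_max !le_max b1 b2 orbT.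
Qed.

(** Accumulated weights agree at synchronous labels; otherwise the larger
    energy controls both terms, and hence their difference. *)
Let mass_gap (m1 m2 c : R) : 0 <= m1 <= c -> 0 <= m2 <= c ->
  (synchronous p1 u1 p2 u2 -> m1 = m2) ->
  `|w1 * m1 - w2 * m2| <= c * gap p1 u1 w1 p2 u2 w2.
Proof.
move=> /andP[m10 m1c] /andP[m20 m2c] sm; have c0 : 0 <= c by lra.
rewrite /gap; case: ifPn => [/asboolP/sm <-|_].
  by rewrite -mulrBl normrM mulrC (ger0_norm m10) ler_wpM2r.
apply: (le_trans (normB_le_max _ _)); rewrite ?mulr_ge0//.
rewrite maxr_pMr// ge_max !le_max.
by rewrite ![c * _]mulrC !ler_wpM2l// orbT.
Qed.

Lemma mass1_gap : `|w1 * mass1 alpha p1 u1 t - w2 * mass1 alpha p2 u2 t| <=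
  t * gap p1 u1 w1 p2 u2 w2.
Proof.
apply: mass_gap; try exact: mass1_bounds.
move=> /synchronous_cases[[u10 u20]|[q1 [q2 [tau [q10 q20 tau0 [p1E u1E w1E [p2E u2E w2E]]]]]]].
  by rewrite /mass1 !lost_ge0u.
by rewrite /mass1 p1E u1E p2E u2E !lost_param.
Qed.

Lemma mass2_gap : `|w1 * mass2 alpha p1 u1 t - w2 * mass2 alpha p2 u2 t| <=
  t ^+ 2 / 2 * gap p1 u1 w1 p2 u2 w2.
Proof.
apply: mass_gap; try exact: mass2_bounds.
move=> /synchronous_cases[[u10 u20]|[q1 [q2 [tau [q10 q20 tau0 [p1E u1E w1E [p2E u2E w2E]]]]]]].
  by rewrite /mass2 !lost_ge0u.
by rewrite /mass2 p1E u1E p2E u2E !lost_param.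
Qed.
End data.
End PointwiseGap.

(** * Integration in time *)

Section TimeIntegrals.
Context {R : realType}.
Implicit Types (alpha p u t : R) (v : R -> R) (k : R -> R -> R).
Local Notation mu := (@lebesgue_measure R).

Lemma EFin_integrableZ (D : set R) (c : R) (f : R -> R) : measurable D ->
  mu.-integrable D (EFin \o f) -> mu.-integrable D (EFin \o (fun x => c * f x)).
Proof. by move=> mD i; exact: (@integrableZl _ _ _ mu D mD c _ i). Qed.

(** Tonelli, for a nonnegative integrable density [v] and a bounded weight
    [k s z] at time [s], whose integral in time at the label [z] is [K z]. *)
Lemma Rintegral_kernel v k (K : R -> R) (C t : R) (D : set R) : measurable D ->
  (forall z, 0 <= v z) -> mu.-integrable setT (EFin \o v) ->
  measurable_fun setT (fun x : R * R => k x.1 x.2) ->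
  (forall s z, 0 <= k s z <= C) ->
  (forall z, \int[mu]_(s in `[0, t]) k s z = K z) ->
  mu.-integrable `[0, t] (EFin \o (fun s => \int[mu]_(z in D) (v z * k s z))) /\
  \int[mu]_(s in `[0, t]) \int[mu]_(z in D) (v z * k s z) = \int[mu]_(z in D) (v z * K z).
Proof.
move=> mD v0 iv mk kC kK.
have integrable_fin (E : set R) (h : R -> R) : measurable E ->
    mu.-integrable E (EFin \o h) -> (\int[mu]_(x in E) (h x)%:E \is a fin_num)%E.
  by move=> mE ih; apply: (@integrable_fin_num _ _ _ mu) ih.
have C0 : 0 <= C by have /andP[h1 h2] := kC 0 0; exact: le_trans h2.
have mv : measurable_fun setT v by have /measurable_int/measurable_EFinP := iv.
have k0 s z : 0 <= k s z by have /andP[] := kC s z.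
have kle s z : k s z <= C by have /andP[] := kC s z.
have mks s : measurable_fun setT (k s).
  by apply: (measurableT_comp mk (measurable_pair1 s)).
have mkz z : measurable_fun setT (k ^~ z).
  by apply: (measurableT_comp mk (measurable_pair2 z)).
have iCv : mu.-integrable setT (EFin \o (fun z => C * v z)).
  exact: EFin_integrableZ.
have ivk s : mu.-integrable setT (EFin \o (fun z => v z * k s z)).
  apply: (le_integrable measurableT _ _ iCv).
    by apply/measurable_EFinP; exact: (measurable_funM mv (mks s)).
  move=> z _ /=; rewrite lee_fin !normrM (ger0_norm (v0 z)) (ger0_norm C0) (ger0_norm (k0 s z)).
  by rewrite mulrC ler_wpM2r.
have vk0 s z : 0 <= v z * k s z by rewrite mulr_ge0.
pose f (x : R * R) : \bar R := ((v x.2 * k x.1 x.2) * (\1_(`[0, t]) x.1 * \1_D x.2))%:E.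
have mf : measurable_fun setT f.
  apply/measurable_EFinP; apply: measurable_funM; first by apply: measurable_funM => //; exact: measurableT_comp.
  have mind (E : set R) : measurable E -> measurable_fun setT (\1_E : R -> R).
    by move=> mE; exact: measurable_indic.
  apply: measurable_funM.
    exact: (measurableT_comp (mind _ (measurable_itv _)) measurable_fst).
  exact: (measurableT_comp (mind _ mD) measurable_snd).
have f0 x : (0 <= f x)%E by rewrite lee_fin mulr_ge0// mulr_ge0.
have Fub := @fubini_tonelli _ _ _ _ R mu mu f mf f0.
have E1 s : (\int[mu]_z f (s, z) = (\int[mu]_(z in D) (v z * k s z) * \1_(`[0, t]) s)%:E)%E.
  rewrite EFinM /Rintegral fineK; last first.
    apply: integrable_fin; first exact: mD.
    by apply: integrableS (ivk s); [exact: measurableT|exact: mD|exact: subsetT].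
  rewrite [X in (_ = _ * X%:E)%E]indicE; case: (boolP (s \in _)) => st.
    rewrite mule1 [RHS]integral_mkcond; apply: eq_integral => z _.
    by rewrite /f/= patchE !indicE st mul1r; case: (z \in D); rewrite ?mulr1 ?mulr0.
  rewrite mule0 -[RHS](integral0 mu setT); apply: eq_integral => z _.
  by rewrite /f/= !indicE (negbTE st) mul0r mulr0.
have E2 z : (\int[mu]_s f (s, z) = ((v z * K z) * \1_D z)%:E)%E.
  have ikz : mu.-integrable `[0, t] (EFin \o k ^~ z).
    apply: (bounded_itv_integrable 0 t (mkz z) (C := C)) => s.
    by rewrite (ger0_norm (k0 s z)); exact: kle.
  rewrite -kK -RintegralZl; [|exact: measurable_itv|exact: ikz]; rewrite EFinM /Rintegral fineK; last first.
    apply: integrable_fin; first exact: measurable_itv.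
    by apply: EFin_integrableZ; [exact: measurable_itv|exact: ikz].
  rewrite [X in (_ = _ * X%:E)%E]indicE; case: (boolP (z \in _)) => st.
    rewrite mule1 [RHS]integral_mkcond; apply: eq_integral => s _.
    by rewrite /f/= patchE !indicE st mulr1; case: (s \in _); rewrite ?mulr1 ?mulr0.
  rewrite mule0 -[RHS](integral0 mu setT); apply: eq_integral => s _.
  by rewrite /f/= !indicE (negbTE st) !mulr0.
have mF : measurable_fun setT (fun s => \int[mu]_(z in D) (v z * k s z) * \1_(`[0, t]) s).
  apply/measurable_EFinP.
  have := @measurable_fun_fubini_tonelli_F _ _ _ _ R mu f mf f0.
  by congr measurable_fun; apply/funext => s; rewrite -[RHS]/((_ * _)%:E) -E1.
have bF s : `|\int[mu]_(z in D) (v z * k s z) * \1_(`[0, t]) s| <= C * \int[mu]_z v z.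
  have I0 : 0 <= \int[mu]_(z in D) (v z * k s z).
    by apply: Rintegral_ge0 => z _; exact: vk0.
  rewrite ger0_norm; last by apply: mulr_ge0 I0 _; rewrite indicE ler0n.
  apply: (@le_trans _ _ (\int[mu]_(z in D) (v z * k s z))).
    by apply: ler_piMr I0 _; rewrite indicE; case: (_ \in _).
  apply: (le_trans (Rintegral_le_setT mD (vk0 s) (ivk s))).
  rewrite -RintegralZl; [|exact: measurableT|exact: iv].
  apply: le_Rintegral; [exact: measurableT|exact: ivk|exact: iCv|move=> z _].
  by rewrite mulrC; exact: (ler_wpM2r (v0 z) (kle s z)).
have iF := bounded_itv_integrable 0 t mF bF.
have eqF : {in `[0, t]%classic, (EFin \o (fun s => \int[mu]_(z in D) (v z * k s z) * \1_(`[0, t]) s)) =1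
   (EFin \o (fun s => \int[mu]_(z in D) (v z * k s z)))}.
  by move=> s st /=; rewrite indicE st mulr1.
split; first by apply: eq_integrable iF.
rewrite /Rintegral; congr fine.
transitivity (\int[mu]_s \int[mu]_z f (s, z))%E.
  rewrite [LHS]integral_mkcond; apply: eq_integral => s _.
  by rewrite E1 patchE indicE; case: (s \in _); rewrite ?mulr1 ?mulr0.
rewrite Fub [RHS]integral_mkcond; apply: eq_integral => z _.
by rewrite E2 patchE indicE; case: (z \in _); rewrite ?mulr1 ?mulr0.
Qed.

Lemma Rintegral_affine (a b c : R) : a <= b ->
  \int[mu]_(s in `[a, b]) (s - c) = ((b - c) ^+ 2 - (a - c) ^+ 2) / 2.
Proof.
rewrite le_eqVlt => /predU1P[->|ab].
  by rewrite subrr mul0r set_itv1; exact: Rintegral_set1.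
have cf : continuous (fun s : R => s - c).
  by move=> x; apply: cvgB; [exact: cvg_id|exact: cvg_cst].
have dF (x : R) : is_derive x (1 : R) (fun s => (s - c) ^+ 2 / 2) (x - c).
  by apply: is_derive_eq; rewrite /GRing.scale/=; lra.
have cF : continuous (fun s : R => (s - c) ^+ 2 / 2).
  by move=> x; apply: derivable_cts; have H := dF x; exact: ex_derive.
have := @continuous_FTC2 R (fun s => s - c) (fun s => (s - c) ^+ 2 / 2) a b ab.
rewrite /Rintegral => ->.
- by rewrite /=; lra.
- exact: continuous_subspaceT.
- split.
  + by move=> x _; have H := dF x; exact: ex_derive.
  + by apply: cvg_at_right_filter; exact: cF.
  + by apply: cvg_at_left_filter; exact: cF.
- by move=> x _; have H := dF x; rewrite derive1E derive_val.
Qed.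

Let Rintegral_sub (f : R -> R) (a b c d : R) : c <= a -> b <= d ->
  (forall s, ~ (a <= s <= b) -> c <= s <= d -> f s = 0) ->
  \int[mu]_(s in `[c, d]) f s = \int[mu]_(s in `[a, b]) f s.
Proof.
move=> ca bd f0; rewrite [LHS]Rintegral_mkcond [RHS]Rintegral_mkcond.
apply: eq_Rintegral => s _; rewrite !patchE.
case: ifPn; rewrite ?notin_setE ?inE /= in_itv/= => cd; case: ifPn; rewrite ?notin_setE ?inE /= in_itv/= => ab //.
  by rewrite f0.
by exfalso; apply: cd; move: ab => /andP[h1 h2]; apply/andP; split; lra.
Qed.

Lemma integral_survive alpha p u t : 0 <= p -> 0 <= t ->
  \int[mu]_(s in `[0, t]) survive alpha p u s = mass1 alpha p u t.
Proof.
move=> p0 t0.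
have i1 : mu.-integrable `[0, t] (EFin \o cst (1 : R)).
  by apply: (@bounded_itv_integrable _ _ `|1|).
have c1 : \int[mu]_(s in `[0, t]) 1 = t.
  transitivity (1 * fine (mu `[0, t])); first exact: Rintegral_cst.
  by rewrite lebesgue_cc// mul1r/= subr0.
have [u0|u0] := leP 0 u.
  rewrite /mass1 lost_ge0u// mulr0 subr0 -[RHS]c1.
  by apply: eq_Rintegral => s _; rewrite survive_ge0u.
pose tau := - (2 * p / u).
have tau0 : 0 <= tau.
  by rewrite /tau oppr_ge0 mulr_ge0_le0 ?mulr_ge0// invr_le0 ltW.
have utau : u * tau = - (2 * p) by rewrite /tau mulrN mulrC divfK// lt_eqF.
have sE s : survive alpha p u s = 1 - alpha * (\1_(`[tau, +oo[) s : R).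
  rewrite /survive u0/= indicE; congr (1 - alpha * (nat_of_bool _)%:R).
  have -> : 2 * p + s * u = u * (s - tau) by rewrite mulrBr utau; lra.
  by rewrite nmulr_rle0// subr_ge0; apply/idP/idP; rewrite inE/= in_itv/= andbT.
have mI : measurable_fun setT (\1_(`[tau, +oo[) : R -> R) by exact: measurable_indic.
have iI : mu.-integrable `[0, t] (EFin \o (\1_(`[tau, +oo[) : R -> R)).
  apply: (@bounded_itv_integrable _ _ 1) => // s.
  by rewrite indicE; case: (_ \in _); rewrite ?normr1 ?normr0.
have -> : \int[mu]_(s in `[0, t]) survive alpha p u s = t - alpha * \int[mu]_(s in `[0, t]) (\1_(`[tau, +oo[) s : R).
  rewrite -RintegralZl// -[X in _ = X - _]c1 -RintegralB//; last first.
    exact: EFin_integrableZ.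
  by apply: eq_Rintegral => s _; rewrite sE.
rewrite /mass1 /lost u0 (_ : t + 2 * p / u = t - tau); last by rewrite /tau opprK.
congr (_ - _ * _); have [tt|tt] := leP (t - tau) 0.
  rewrite (_ : Rintegral _ _ _ = \int[mu]_(s in `[tau, t]) (\1_(`[tau, +oo[) s : R)); last first.
    apply: Rintegral_sub => // s H /andP[s0 st]; rewrite indicE memNset//= in_itv/= andbT => ts.
    by apply: H; rewrite ts st.
  move: tt; rewrite subr_le0 le_eqVlt => /predU1P[->|tt].
    by rewrite set_itv1; exact: Rintegral_set1.
  by rewrite set_itv_ge ?Rintegral_set0// bnd_simp -ltNge.
rewrite (_ : Rintegral _ _ _ = \int[mu]_(s in `[tau, t]) (\1_(`[tau, +oo[) s : R)); last first.
  apply: Rintegral_sub => // s H /andP[s0 st]; rewrite indicE memNset//= in_itv/= andbT => ts.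
  by apply: H; rewrite ts st.
transitivity (\int[mu]_(s in `[tau, t]) (1 : R)).
  by apply: eq_Rintegral => s; rewrite inE/= in_itv/= => /andP[h1 h2]; rewrite indicE mem_set//= in_itv/= h1.
transitivity (1 * fine (mu `[tau, t])); first exact: Rintegral_cst.
by rewrite lebesgue_cc ?mul1r//; lra.
Qed.

Lemma integral_mass1 alpha p u t : 0 <= p -> 0 <= t ->
  \int[mu]_(s in `[0, t]) mass1 alpha p u s = mass2 alpha p u t.
Proof.
move=> p0 t0.
have cid : continuous (fun s : R => s - 0).
  by move=> x; apply: cvgB; [exact: cvg_id|exact: cvg_cst].
have cint (f : R -> R) : continuous f -> mu.-integrable `[0, t] (EFin \o f).
  by move=> cf; apply: continuous_compact_integrable; [exact: segment_compact|exact: continuous_subspaceT].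
have I0 : \int[mu]_(s in `[0, t]) (s - 0) = t ^+ 2 / 2 by rewrite Rintegral_affine//; lra.
have [u0|u0] := leP 0 u.
  rewrite /mass2 lost_ge0u// expr0n/= mul0r mulr0 subr0 -I0.
  by apply: eq_Rintegral => s _; rewrite /mass1 lost_ge0u// mulr0.
pose tau := - (2 * p / u).
have tau0 : 0 <= tau.
  by rewrite /tau oppr_ge0 mulr_ge0_le0 ?mulr_ge0// invr_le0 ltW.
have lE s : lost p u s = Num.max 0 (s - tau) by rewrite /lost u0 /tau opprK.
have cl : continuous (fun s : R => Num.max 0 (s - tau)).
  move=> x; apply: (@continuous_max _ _ (fun _ : R => 0) (fun s : R => s - tau)).
    exact: cvg_cst.
  by apply: cvgB; [exact: cvg_id|exact: cvg_cst].
have ial : mu.-integrable `[0, t] (EFin \o (fun s => alpha * Num.max 0 (s - tau))).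
  by apply: EFin_integrableZ => //; exact: cint.
have -> : \int[mu]_(s in `[0, t]) mass1 alpha p u s =
   t ^+ 2 / 2 - alpha * \int[mu]_(s in `[0, t]) (Num.max 0 (s - tau)).
  rewrite -RintegralZl//; last exact: cint.
  rewrite -I0 -RintegralB//; last exact: cint.
  by apply: eq_Rintegral => s _; rewrite /mass1 lE subr0.
rewrite /mass2 lE; congr (_ - _ * _).
rewrite (_ : Rintegral _ _ _ = \int[mu]_(s in `[tau, t]) (Num.max 0 (s - tau))); last first.
  apply: Rintegral_sub => // s H /andP[s0 st]; rewrite (max_idPl _)// subr_le0 leNgt; apply/negP => ts.
  by apply: H; rewrite st ltW.
have [tt|tt] := ltP t tau.
  rewrite set_itv_ge ?Rintegral_set0; last by rewrite bnd_simp -ltNge.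
  by rewrite (max_idPl _) ?expr0n ?mul0r// subr_le0 ltW.
rewrite (max_idPr _) ?subr_ge0//.
rewrite (_ : Rintegral _ _ _ = \int[mu]_(s in `[tau, t]) (s - tau)).
  by rewrite Rintegral_affine//; lra.
by apply: eq_Rintegral => s; rewrite inE/= in_itv/= => /andP[h1 h2]; rewrite (max_idPr _) ?subr_ge0.
Qed.
End TimeIntegrals.

(** * Measurability of the weights *)

Section Measurability.
Context {R : realType}.
Local Notation mu := (@lebesgue_measure R).

Lemma measurable_invr : measurable_fun [set: R] (@GRing.inv R).
Proof.
rewrite -(setvU [set 0]); apply/measurable_funU => //; first exact: measurableC.
split; last exact: measurable_fun_set1.
apply: open_continuous_measurable_fun; first by apply: closed_openC; exact: closed_eq.
by move=> x; rewrite inE/= => /eqP x0; exact: inv_continuous.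
Qed.

Section fields.
Context d (T : measurableType d).
Variables (p u t : T -> R).
Hypotheses (mp : measurable_fun setT p) (mu' : measurable_fun setT u)
  (mt : measurable_fun setT t).

Lemma measurable_lost : measurable_fun setT (fun x => lost (p x) (u x) (t x)).
Proof.
apply: measurable_fun_ifT; [exact: measurable_fun_ltr| |exact: measurable_cst].
apply: measurable_maxr; first exact: measurable_cst.
apply: measurable_funD => //; apply: measurable_funM; first exact: measurable_funM.
exact: (measurableT_comp measurable_invr).
Qed.

Lemma measurable_mass1 alpha : measurable_fun setT (fun x => mass1 alpha (p x) (u x) (t x)).
Proof. by apply: measurable_funB => //; apply: measurable_funM => //; exact: measurable_lost. Qed.

Lemma measurable_mass2 alpha : measurable_fun setT (fun x => mass2 alpha (p x) (u x) (t x)).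
Proof.
have sq (f : T -> R) : measurable_fun setT f -> measurable_fun setT (fun x => f x ^+ 2 / 2).
  by move=> mf; apply: measurable_funM => //; exact: measurable_funX.
apply: measurable_funB; first exact: sq.
by apply: measurable_funM => //; apply: sq; exact: measurable_lost.
Qed.

Lemma measurable_survive alpha : measurable_fun setT (fun x => survive alpha (p x) (u x) (t x)).
Proof.
rewrite (_ : (fun _ => _) = (fun x => if (u x < 0) && (2 * p x + t x * u x <= 0) then 1 - alpha else 1)).
  apply: measurable_fun_ifT => //; apply: measurable_and; first exact: measurable_fun_ltr.
  by apply: measurable_fun_ler => //; apply: measurable_funD; exact: measurable_funM.
by apply/funext => x; rewrite /survive; case: (_ && _); rewrite ?mulr1 ?mulr0 ?subr0.
Qed.
End fields.
End Measurability.

(** * Solution of the system by quadratures *)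

Section Evolution.
Context {R : realType}.
Variables (alpha : R) (a01 : 0 <= alpha <= 1).
Variables (chim chip : R -> R) (chi : cutoffs chim chip).
Implicit Types (X : lag R) (s t x z : R).
Local Notation mu := (@lebesgue_measure R).

(** The conditions under which the system is integrated and the distance is
    estimated. They are stable under all relabellings, whereas [relabel X f]
    with [X] in [F] can fail to be in [F], because [f - id] need not have
    limits at infinity. *)
Record admissible X : Prop := Admissible {
  adm_y : lipschitzian (ly X);
  adm_U : lipschitzian (lU X);
  adm_H : lipschitzian (lH X);
  adm_V : lipschitzian (lV X);
  adm_y_nd : {homo ly X : x y / x <= y};
  adm_V_nd : {homo lV X : x y / x <= y};
  adm_V_bd : exists C, forall x, `|lV X x| <= C;
  adm_V_E1 : E1 chip (lV X);
  adm_eq : {ae mu, forall x, (ly X)^`() x * (lV X)^`() x = (lU X)^`() x ^+ 2} }.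

Definition surviveX X t z := survive alpha ((ly X)^`() z) ((lU X)^`() z) t.
Definition mass1X X t z := mass1 alpha ((ly X)^`() z) ((lU X)^`() z) t.
Definition mass2X X t z := mass2 alpha ((ly X)^`() z) ((lU X)^`() z) t.

(** With [w] the density of the energy, this is the force on the label [x],
    one quarter of the difference between the energies on its left and on its
    right. *)
Definition pull (w : R -> R) x : R :=
  2^-1 * \int[mu]_(z in `]-oo, x]) w z - 4^-1 * \int[mu]_z w z.

(** The weights [surviveX], [mass1X], [mass2X] are successive integrals in
    time. They turn the initial energy density into the energy at time [t] and
    the contributions of the force to velocity and position. *)
Definition evolve X t : lag R := Lag
  (fun x => ly X x + t * lU X x + pull (fun z => (lV X)^`() z * mass2X X t z) x)
  (fun x => lU X x + pull (fun z => (lV X)^`() z * mass1X X t z) x)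
  (lH X)
  (fun x => \int[mu]_(z in `]-oo, x]) ((lV X)^`() z * surviveX X t z)).

Lemma F_admissible X : F alpha chim chip X -> admissible X.
Proof.
case=> [[_ _ _ VE]] /(W1ooP chi)[ly' _] /(W1ooP chi)[lU' _] /(W1ooP chi)[lH' _] /(W1ooP chi)[lV' VC].
move=> yH _ e VH _ _.
have lyX : lipschitzian (ly X).
  by have := lipschitzianD ly' lipschitzian_id; under eq_fun do rewrite subrK.
split => //; apply: lipschitz_nondecreasing => //.
- by apply: ae_imp yH => x [].
- by apply: ae_imp VH => x /andP[].
Qed.

Section Admissible.
Variables (X : lag R) (aX : admissible X).

Let p0 z : 0 <= (ly X)^`() z.
Proof. exact: nondecreasing_derive1_ge0 (adm_y_nd aX). Qed.

Let v0 z : 0 <= (lV X)^`() z.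
Proof. exact: nondecreasing_derive1_ge0 (adm_V_nd aX). Qed.

Let mp : measurable_fun setT (ly X)^`().
Proof. exact: lipschitzian_measurable_derive1 (adm_y aX). Qed.

Let mU : measurable_fun setT (lU X)^`().
Proof. exact: lipschitzian_measurable_derive1 (adm_U aX). Qed.

Let mv : measurable_fun setT (lV X)^`().
Proof. exact: lipschitzian_measurable_derive1 (adm_V aX). Qed.

Lemma admissible_integrable : mu.-integrable setT (EFin \o (lV X)^`()).
Proof. by have [C VC] := adm_V_bd aX; exact: nondecreasing_bounded_integrable (adm_V aX) (adm_V_nd aX) VC. Qed.

Lemma measurable_surviveX t : measurable_fun setT (surviveX X t).
Proof. exact: measurable_survive. Qed.
Lemma measurable_mass1X t : measurable_fun setT (mass1X X t).
Proof. exact: measurable_mass1. Qed.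
Lemma measurable_mass2X t : measurable_fun setT (mass2X X t).
Proof. exact: measurable_mass2. Qed.

Lemma admissible_dominated (k : R -> R) (c : R) : measurable_fun setT k ->
  (forall z, 0 <= k z <= c) ->
  let w := fun z => (lV X)^`() z * k z in
  let W := fun x => \int[mu]_(z in `]-oo, x]) w z in
  [/\ mu.-integrable setT (EFin \o w), lipschitzian W,
     {ae mu, forall x, derivable W x 1 /\ W^`() x = w x},
     (forall x, 0 <= W x <= \int[mu]_z w z) & E1 chip W].
Proof.
move=> mk kc w; have [C VC] := adm_V_bd aX.
apply: (energy_dominated chi (adm_V aX) (adm_V_nd aX) VC (adm_V_E1 aX) (c := c)).
- exact: measurable_funM.
- by have /andP[h1 h2] := kc 0; exact: le_trans h2.
- move=> z; have /andP[h1 h2] := kc z; rewrite /w mulr_ge0//= mulrC.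
  by rewrite ler_wpM2r.
Qed.

Lemma surviveX_bounds t z : 0 <= surviveX X t z <= 1.
Proof. exact: survive_bounds. Qed.
Lemma mass1X_bounds t z : 0 <= t -> 0 <= mass1X X t z <= t.
Proof. by move=> ?; exact: mass1_bounds. Qed.
Lemma mass2X_bounds t z : 0 <= t -> 0 <= mass2X X t z <= t ^+ 2 / 2.
Proof. by move=> ?; exact: mass2_bounds. Qed.

Lemma survive_integral (D : set R) t : measurable D -> 0 <= t ->
  mu.-integrable `[0, t] (EFin \o (fun s => \int[mu]_(z in D) ((lV X)^`() z * surviveX X s z))) /\
  \int[mu]_(s in `[0, t]) \int[mu]_(z in D) ((lV X)^`() z * surviveX X s z) =
  \int[mu]_(z in D) ((lV X)^`() z * mass1X X t z).
Proof.
move=> mD t0; apply: (Rintegral_kernel mD v0 admissible_integrable (C := 1) (k := surviveX X)).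
- apply: measurable_survive => //; exact: measurableT_comp.
- by move=> s z; exact: surviveX_bounds.
- by move=> z; exact: integral_survive.
Qed.

(** The bound on [mass1X] holds for times in [[0, t]] only, hence the clipped
    time [c]. *)
Lemma mass1_integral (D : set R) t : measurable D -> 0 <= t ->
  mu.-integrable `[0, t] (EFin \o (fun s => \int[mu]_(z in D) ((lV X)^`() z * mass1X X s z))) /\
  \int[mu]_(s in `[0, t]) \int[mu]_(z in D) ((lV X)^`() z * mass1X X s z) =
  \int[mu]_(z in D) ((lV X)^`() z * mass2X X t z).
Proof.
move=> mD t0; pose c s := Num.max 0 (Num.min t s).
have cE s : s \in `[0, t]%classic -> c s = s.
  by rewrite inE/= in_itv/= => /andP[h1 h2]; rewrite /c (min_idPr h2) (max_idPr h1).
have c0 s : 0 <= c s by rewrite le_max lexx.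
have ct s : c s <= t by rewrite ge_max t0 ge_min lexx.
have [] := @Rintegral_kernel R _ (fun s z => mass1X X (c s) z) (mass2X X t) t t D mD v0 admissible_integrable.
- apply: measurable_mass1 => //; try exact: measurableT_comp.
  apply: measurable_maxr => //; apply: measurable_minr => //.
- move=> s z; have /andP[h1 h2] := mass1X_bounds z (c0 s).
  by rewrite h1 (le_trans h2).
- move=> z; rewrite -[RHS]integral_mass1//; apply: eq_Rintegral => s st.
  by rewrite cE.
move=> i1 i2; split.
  by apply: eq_integrable i1 => // s st /=; rewrite cE.
by rewrite -i2; apply: eq_Rintegral => s st; rewrite cE.
Qed.

(** A form from which the measurability of the set of broken labels can be
    read off. *)
Lemma broken_fieldsE p u t : 0 <= p ->
  ((0 < breaking p u)%E /\ (breaking p u <= t%:E)%E) <->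
  (((u < 0) && (0 < p)) && (2 * p + t * u <= 0)).
Proof.
move=> p0'; rewrite /breaking; case: (ltP u 0) => u0 /=; last first.
  split => //; case: ifPn => _; first by rewrite ltxx => -[].
  by rewrite leye_eq => -[].
have -> : - 2 * p / u = 2 * p / (- u) by rewrite invrN mulrN !mulNr.
rewrite lte_fin lee_fin ler_pdivrMr ?oppr_gt0//.
rewrite -[in X in (X /\ _)](mul0r (- u)^-1) ltr_pM2r ?invr_gt0 ?oppr_gt0//.
by rewrite pmulr_rgt0// (_ : (2 * p + t * u <= 0) = (2 * p <= t * - u)); [split=> [[-> ->]|/andP[]]|apply/idP/idP; lra].
Qed.

(** The two densities agree where [y_xi * V_xi = U_xi ^+ 2], hence almost
    everywhere. *)
Lemma energy_breaking_timeE t x :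
  \int[mu]_(z in `]-oo, x])
      ((lV X)^`() z * (1 - alpha * \1_[set r : R | (0 < breaking_time X r)%E /\
                                (breaking_time X r <= t%:E)%E] z)) =
  \int[mu]_(z in `]-oo, x]) ((lV X)^`() z * surviveX X t z).
Proof.
set E := [set r | (0 < breaking_time X r)%E /\ _].
have mE : measurable (E : set (measurableTypeR R)).
  pose b z := ((((lU X)^`() z < 0) && (0 < (ly X)^`() z)) && (2 * (ly X)^`() z + t * (lU X)^`() z <= 0))%R.
  have -> : E = [set z | b z] by apply/seteqP; split => z H; exact/(broken_fieldsE ((lU X)^`() z) t (p0 z)).
  have mb : measurable_fun setT b.
    apply: measurable_and; first by apply: measurable_and; apply: measurable_fun_ltr.
    by apply: measurable_fun_ler => //; apply: measurable_funD; exact: measurable_funM.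
  have := mb measurableT [set true] I.
  by rewrite setTI; congr measurable; apply/seteqP; split.
rewrite /Rintegral; congr fine; apply: ae_eq_integral => //.
- apply/measurable_EFinP; apply: (measurable_funS measurableT) => //; apply: measurable_funM => //.
  by apply: measurable_funB => //; apply: measurable_funM => //; exact: measurable_indic.
- apply/measurable_EFinP; apply: (measurable_funS measurableT) => //; apply: measurable_funM => //.
  exact: measurable_surviveX.
apply: ae_imp (adm_eq aX) => z e _; congr EFin; congr (_ * _).
rewrite /surviveX (survive_breaking _ _ (p0 z) e) indicE; congr (1 - alpha * (nat_of_bool _)%:R).
Qed.
Lemma evolve_V_lim t : lim (lV (evolve X t) z @[z --> +oo]) =
  \int[mu]_z ((lV X)^`() z * surviveX X t z).
Proof.
have [i _ _ _ _] := admissible_dominated (measurable_surviveX t) (surviveX_bounds t).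
by apply/cvg_lim => //; exact: cvg_Rintegral_y.
Qed.

Lemma pull_integral (w : R -> R -> R) (W : R -> R) t x :
  (forall D, measurable D ->
    mu.-integrable `[0, t] (EFin \o (fun s => \int[mu]_(z in D) w s z)) /\
    \int[mu]_(s in `[0, t]) \int[mu]_(z in D) w s z = \int[mu]_(z in D) W z) ->
  mu.-integrable `[0, t] (EFin \o (fun s => pull (w s) x)) /\
  \int[mu]_(s in `[0, t]) pull (w s) x = pull W x.
Proof.
move=> H; have [i1 e1] := H _ (measurable_itv `]-oo, x]).
have [i2 e2] := H _ measurableT.
have j1 := EFin_integrableZ (2^-1) (measurable_itv _) i1.
have j2 := EFin_integrableZ (4^-1) (measurable_itv _) i2.
split; first by apply: (integrableB _ j1 j2); exact: measurable_itv.
by rewrite /pull RintegralB// !RintegralZl// e1 e2.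
Qed.

End Admissible.

Lemma lag_eq X Y : ly X =1 ly Y -> lU X =1 lU Y -> lH X =1 lH Y -> lV X =1 lV Y -> X = Y.
Proof.
by case: X Y => [a b c e] [a' b' c' e']/= /funext-> /funext-> /funext-> /funext->.
Qed.

(** The energy is prescribed by the initial data. It determines the force,
    whose integrals in time are the velocity and the position. *)
Lemma lag_system_evolve (XA : R -> lag R) t : lag_system alpha XA -> admissible (XA 0) ->
  0 <= t -> XA t = evolve (XA 0) t.
Proof.
move=> [sy sU sH sV] aX t0.
have V_ s : 0 <= s -> lV (XA s) = lV (evolve (XA 0) s).
  by move=> s0; apply/funext => x; rewrite sV// energy_breaking_timeE.
have U_ s : 0 <= s -> lU (XA s) = lU (evolve (XA 0) s).
  move=> s0; apply/funext => x; rewrite sU//=; congr (_ + _).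
  have [_ <-] := pull_integral x (fun D mD => survive_integral aX mD s0).
  apply: eq_Rintegral => r; rewrite inE/= in_itv/= => /andP[r0 _].
  by rewrite V_// evolve_V_lim.
apply: lag_eq => x; [|by rewrite U_|exact: sH|by rewrite V_].
rewrite sy//=; have [i1 e1] := pull_integral x (fun D mD => mass1_integral aX mD t0).
have iU : mu.-integrable `[0, t] (EFin \o cst (lU (XA 0) x)).
  by apply: (@bounded_itv_integrable _ _ `|lU (XA 0) x|).
transitivity (ly (XA 0) x + (\int[mu]_(s in `[0, t]) lU (XA 0) x + \int[mu]_(s in `[0, t]) pull (fun z => (lV (XA 0))^`() z * mass1X (XA 0) s z) x)).
  congr (_ + _); rewrite -RintegralD//.
  by apply: eq_Rintegral => r; rewrite inE/= in_itv/= => /andP[r0 _]; rewrite U_.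
rewrite e1 addrA; congr (_ + _ + _).
transitivity (lU (XA 0) x * fine (mu `[0, t])); first exact: Rintegral_cst.
by rewrite lebesgue_cc//= subr0 mulrC.
Qed.

End Evolution.

(** * The solution operator preserves the phase space *)

Section PointwiseDissipation.
Context {R : realFieldType}.
Variables (alpha : R) (a01 : 0 <= alpha <= 1).
Implicit Types p u w h k t : R.

(** A label that has broken has [p = 0] and no energy left. *)
Lemma dynamics_fully_dissipative p u w h t : 0 <= p -> 0 <= w -> p * w = u ^+ 2 -> 0 <= t ->
  alpha = 1 -> (p = 0 -> w = 0) -> (0 < p -> w = h) ->
  (pt alpha p u w t = 0 -> wt alpha p u w t = 0) /\
  (0 < pt alpha p u w t -> wt alpha p u w t = h).
Proof.
move=> p0 w0 e t0 a1 pz pp; case: (dynamics_cases alpha p0 w0 e t0).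
- move=> [u0 _ -> ->]; split => [E|P].
    apply: pz; apply/eqP; rewrite eq_le p0 andbT -E -addrA lerDl.
    by rewrite addr_ge0// !mulr_ge0// ?invr_ge0 ?sqr_ge0.
  case: (ltgtP 0 p) => [|pn|pn]; [exact: pp|by rewrite ltNge p0 in pn|].
  move: e (pz (esym pn)) P; rewrite -pn => e w00.
  move/esym/eqP: e; rewrite mul0r sqrf_eq0 => /eqP ->.
  by rewrite w00 !(mul0r, mulr0, addr0) ltxx.
- move=> [q [tau [q0 tau0 tt [pE uE wE [_ -> ->]]]]].
  have tt0 : 0 < tau - t by rewrite subr_gt0.
  split => [E|_]; last by apply: pp; rewrite pE mulr_gt0// exprn_gt0.
  exfalso; have : 0 < q * (tau - t) ^+ 2 by rewrite mulr_gt0// exprn_gt0.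
  by rewrite E ltxx.
- move=> [q [tau [q0 tau0 tt [pE uE wE [_ -> ->]]]]].
  by rewrite a1 subrr !(mul0r, mulr0) ltxx.
Qed.

(** As long as [ut < 0] the label has not broken and carries its full energy.
    Afterwards the fraction that is left is absorbed in the factor in front of
    [h]. *)
Lemma dynamics_partially_dissipative p u w h k t : 0 <= p -> 0 <= w -> p * w = u ^+ 2 -> 0 <= t ->
  w = k * h -> (u < 0 -> k = 1) ->
  wt alpha p u w t =
  (if ut alpha p u w t < 0 then 1 else if u < 0 then survive alpha p u t else k) * h.
Proof.
move=> p0 w0 e t0 wk kx.
have [u0|u0] := ltP u 0; last first.
  rewrite ifF; first by rewrite /wt survive_ge0u// mulr1.
  by rewrite ltNge /ut /mass1 lost_ge0u// mulr0 subr0 addr_ge0// !mulr_ge0 ?invr_ge0.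
have wh : w = h by rewrite wk kx// mul1r.
case: ifPn => ut0; last by rewrite /wt wh mulrC.
rewrite mul1r -wh; case: (dynamics_cases alpha p0 w0 e t0).
- by move=> [u0' _ _ ->].
- by move=> [q [tau [q0 tau0 tt [pE uE wE [_ _ ->]]]]].
- move=> [q [tau [q0 tau0 tt [pE uE wE [utE _ _]]]]].
  exfalso; move: ut0; rewrite utE ltNge => /negP; apply.
  by move: a01 => /andP[a0 a1]; rewrite !mulr_ge0//; lra.
Qed.
End PointwiseDissipation.

Section EvolutionInF.
Context {R : realType}.
Variables (alpha : R) (a01 : 0 <= alpha <= 1).
Variables (chim chip : R -> R) (chi : cutoffs chim chip).
Implicit Types (X : lag R) (s t x z : R).
Local Notation mu := (@lebesgue_measure R).
Local Notation evolve := (evolve alpha).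
Local Notation admissible := (admissible chip).

(** [pull w] is half of the primitive of [w], up to a constant. *)
Lemma pull_derive1 (f w : R -> R) : lipschitzian f ->
  lipschitzian (fun x => \int[mu]_(z in `]-oo, x]) w z) ->
  {ae mu, forall x, derivable (fun x => \int[mu]_(z in `]-oo, x]) w z) x 1 /\
    (fun x => \int[mu]_(z in `]-oo, x]) w z)^`() x = w x} ->
  lipschitzian (fun x => f x + pull w x) /\
  {ae mu, forall x, (fun x => f x + pull w x)^`() x = f^`() x + 2^-1 * w x}.
Proof.
move=> lf; set W := fun x => Rintegral mu _ w => lW dW.
have -> : (fun x => f x + pull w x) =
    (fun x => f x + 2^-1 * W x + (- (4^-1 * \int[mu]_z w z)) * cst 1 x).
  by apply/funext => x; rewrite /pull /= mulr1 addrA.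
split.
  by apply: lipschitzianD; [apply: lipschitzianD => //; exact: lipschitzianZ|
    apply: lipschitzianZ; exact: lipschitzian_cst].
have l1 := derive1_linear2 (2^-1) (- (4^-1 * \int[mu]_z w z)) lf lW (lipschitzian_cst 1).
apply: ae_imp (ae_and dW l1) => x [[_ e] ->].
by rewrite e derive1_cst mulr0 addr0.
Qed.

Lemma pull_E2_bounded X (k : R -> R) (c : R) : admissible X -> measurable_fun setT k ->
  (forall z, 0 <= k z <= c) ->
  E2 chim chip (pull (fun z => (lV X)^`() z * k z)) /\
  exists C, forall x, `|pull (fun z => (lV X)^`() z * k z) x| <= C.
Proof.
move=> aX mk kc; have [_ lW _ bW EW] := admissible_dominated chi aX mk kc.
set I := \int[mu]_z ((lV X)^`() z * k z).
split; last first.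
  exists I => x; rewrite /pull -/I; have /andP[h1 h2] := bW x.
  move: h1 h2; rewrite -/I; move: I (Rintegral _ _ _) => I j h1 h2.
  by rewrite ler_norml; apply/andP; split; lra.
have E2W := E1_E2 chim EW.
have := E2_linear chi (2^-1) (lipschitzian_cst (- (4^-1 * I))) lW (E2_cst chi _) E2W.
by congr (E2 _ _ _); apply/funext => x; rewrite /pull addrC.
Qed.

Definition pX X t x := pt alpha ((ly X)^`() x) ((lU X)^`() x) ((lV X)^`() x) t.
Definition uX X t x := ut alpha ((ly X)^`() x) ((lU X)^`() x) ((lV X)^`() x) t.
Definition wX X t x := wt alpha ((ly X)^`() x) ((lU X)^`() x) ((lV X)^`() x) t.

Section Admissible.
Variables (X : lag R) (aX : admissible X) (t : R) (t0 : 0 <= t).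

Let DV := admissible_dominated chi aX (measurable_surviveX alpha aX t) (surviveX_bounds a01 X t).
Let DU := admissible_dominated chi aX (measurable_mass1X alpha aX t) (fun z => mass1X_bounds a01 aX z t0).
Let Dy := admissible_dominated chi aX (measurable_mass2X alpha aX t) (fun z => mass2X_bounds a01 aX z t0).

Lemma evolve_V_derive1 : lipschitzian (lV (evolve X t)) /\
  {ae mu, forall x, (lV (evolve X t))^`() x = wX X t x}.
Proof. by have [_ lW dW _ _] := DV; split => //; apply: ae_imp dW => x []. Qed.

Lemma evolve_U_derive1 : lipschitzian (lU (evolve X t)) /\
  {ae mu, forall x, (lU (evolve X t))^`() x = uX X t x}.
Proof. have [_ lW dW _ _] := DU; exact: (pull_derive1 (adm_U aX) lW dW). Qed.

Lemma evolve_y_derive1 : lipschitzian (ly (evolve X t)) /\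
  {ae mu, forall x, (ly (evolve X t))^`() x = pX X t x}.
Proof.
have [_ lW dW _ _] := Dy.
have lf : lipschitzian (fun x => ly X x + t * lU X x).
  by apply: lipschitzianD (adm_y aX) _; apply: lipschitzianZ; exact: adm_U aX.
have [l d] := pull_derive1 lf lW dW; split => //.
apply: ae_imp (ae_and d (derive1_linear t (adm_y aX) (adm_U aX))) => x [-> ->].
by [].
Qed.

Lemma evolve_derive1 : {ae mu, forall x, [/\ (ly (evolve X t))^`() x = pX X t x,
  (lU (evolve X t))^`() x = uX X t x & (lV (evolve X t))^`() x = wX X t x]}.
Proof.
have [_ dy] := evolve_y_derive1; have [_ dU] := evolve_U_derive1; have [_ dV] := evolve_V_derive1.
by apply: ae_imp (ae_and dy (ae_and dU dV)) => x [? []].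
Qed.

End Admissible.

Lemma ae_and3 (P Q S : R -> Prop) : {ae mu, forall x, P x} -> {ae mu, forall x, Q x} ->
  {ae mu, forall x, S x} -> {ae mu, forall x, [/\ P x, Q x & S x]}.
Proof. by move=> p q s; apply: ae_imp (ae_and p (ae_and q s)) => x [? []]. Qed.

Lemma evolve_slope X t : F alpha chim chip X -> 0 <= t ->
  {ae mu, forall x, (ly X)^`() x + (lH X)^`() x <=
     (1 + t + t ^+ 2 / 2) * ((ly (evolve X t))^`() x + (lH (evolve X t))^`() x)}.
Proof.
move=> FX t0; have aX := F_admissible chi FX.
apply: ae_imp (ae_and (inF_ge0 FX) (ae_and3 (inF_eq FX) (inF_VH FX) (evolve_derive1 aX t0))).
move=> x [[p0 h0] [e VH [-> _ _]]].
exact: dynamics_lower.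
Qed.

(** The behaviour at infinity is that of [admissible_dominated]; the
    conditions on the derivatives hold at almost every label by the dynamics
    at one label. *)
Lemma evolve_F X t : F alpha chim chip X -> 0 <= t -> F alpha chim chip (evolve X t).
Proof.
move=> FX t0; have aX := F_admissible chi FX.
have [Ey EU EH EV] := inF_B FX; rewrite /= in Ey EU EH EV.
have /(W1ooP chi)[lyi [Cy yC]] := inF_y FX.
have /(W1ooP chi)[liU [CU UC]] := inF_U FX.
have [Epy [Cpy pyC]] := pull_E2_bounded aX (measurable_mass2X alpha aX t) (fun z => mass2X_bounds a01 aX z t0).
have [EpU [CpU pUC]] := pull_E2_bounded aX (measurable_mass1X alpha aX t) (fun z => mass1X_bounds a01 aX z t0).
have [_ lW _ bW EW] := admissible_dominated chi aX (measurable_surviveX alpha aX t) (surviveX_bounds a01 X t).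
have [lyt _] := evolve_y_derive1 aX t0.
have [lUt _] := evolve_U_derive1 aX t0.
have lpull (f g : R -> R) : lipschitzian f -> lipschitzian (fun x => f x + g x) -> lipschitzian g.
  by move=> lf lg; have := lipschitzianB lg lf; congr lipschitzian; apply/funext => x; lra.
have lpU := lpull _ _ liU lUt.
have lpy : lipschitzian (pull (fun z => (lV X)^`() z * mass2X alpha X t z)).
  apply: lpull lyt; apply: lipschitzianD (adm_y aX) _; exact: lipschitzianZ.
have yE x : ly (evolve X t) x - x = (ly X x - x) + t * lU X x + 1 * pull (fun z => (lV X)^`() z * mass2X alpha X t z) x.
  by rewrite /=; lra.
have D := ae_and (inF_ge0 FX) (ae_and3 (inF_eq FX) (inF_VH FX) (evolve_derive1 aX t0)).
split => //.
- split => //=.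
  + rewrite (_ : (fun x => _) = (fun x => (ly X x - x) + t * lU X x + 1 * pull (fun z => (lV X)^`() z * mass2X alpha X t z) x)); last exact/funext/yE.
    apply: (E2_linear chi) => //; last exact: (E2_linear chi).
    by apply: lipschitzianD => //; exact: lipschitzianZ.
  + have := E2_linear chi 1 liU lpU EU EpU.
    by congr (E2 _ _ _); apply/funext => x; rewrite mul1r.
- apply/(W1ooP chi); split; first by apply: lipschitzianB => //; exact: lipschitzian_id.
  exists (Cy + t * CU + Cpy) => x; rewrite yE mul1r.
  apply: (le_trans (ler_normD _ _)); rewrite lerD//.
  apply: (le_trans (ler_normD _ _)); rewrite lerD//.
  by rewrite normrM ger0_norm// ler_wpM2l.
- apply/(W1ooP chi); split => //; exists (CU + CpU) => x.
  by apply: (le_trans (ler_normD _ _)); rewrite lerD.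
- exact: inF_H FX.
- apply/(W1ooP chi); split => //; exists (\int[mu]_z ((lV X)^`() z * surviveX alpha X t z)) => x.
  by have /andP[h1 h2] := bW x; rewrite ger0_norm.
- apply: ae_imp D => x [[p0 h0] [e /andP[w0 wh] [-> _ _]]]; split => //.
  by have [] := dynamics_invariant a01 p0 w0 e t0.
- have [c c0 cX] := inF_gt0 FX.
  have K0 : 0 < 1 + t + t ^+ 2 / 2 by rewrite !ltr_wpDr// ?mulr_ge0 ?invr_ge0 ?sqr_ge0.
  exists (c / (1 + t + t ^+ 2 / 2)); first by rewrite divr_gt0.
  apply: ae_imp (ae_and cX (evolve_slope FX t0)) => x [h1 h2].
  by rewrite ltr_pdivrMr// mulrC; exact: lt_le_trans h2.
- apply: ae_imp D => x [[p0 h0] [e /andP[w0 wh] [-> -> ->]]].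
  by have [] := dynamics_invariant a01 p0 w0 e t0.
- apply: ae_imp D => x [[p0 h0] [e /andP[w0 wh] [_ _ ->]]].
  have [_ /andP[h1 h2] _] := dynamics_invariant a01 p0 w0 e t0.
  by rewrite h1 (le_trans h2).
- move=> a1; apply: ae_imp (ae_and D (inF_alpha1 FX a1)) => x [[[p0 h0] [e /andP[w0 wh] [-> _ ->]]] [pz pp]].
  exact: (dynamics_fully_dissipative (alpha := alpha) p0 w0 e t0 a1 pz pp).
- move=> a1; have [kappa [k1 k2 k3]] := inF_alphalt1 FX a1.
  exists (fun x => if (lU (evolve X t))^`() x < 0 then 1 else
      if (lU X)^`() x < 0 then surviveX alpha X t x else kappa x); split.
  + move=> x; case: ifP => _; first by right.
    case: ifP => _ //; rewrite /surviveX /survive.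
    by case: (_ && _); rewrite ?mulr1 ?mulr0 ?subr0; [left|right].
  + apply: ae_imp (ae_and D k2) => x [[[p0 h0] [e /andP[w0 wh] [_ -> ->]]] wk].
    exact: (dynamics_partially_dissipative a01 p0 w0 e t0 wk (k3 x)).
  + by move=> x ->.
Qed.

End EvolutionInF.

(** * Relabelling *)

Section Relabelling.
Context {R : realType}.
Variables (chim chip : R -> R) (chi : cutoffs chim chip).
Implicit Types (f g h k : R -> R).
Local Notation mu := (@lebesgue_measure R).
Local Notation L2 f := (f \in Lfun mu 2%:E).

Lemma derive1_subid f : lipschitzian f ->
  {ae mu, forall x, (fun x => f x - x)^`() x = f^`() x - 1}.
Proof.
move=> lf; have := derive1_linear (-1) lf lipschitzian_id.
apply: ae_imp => x; rewrite derive1_id mulN1r => <-.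
by congr (_^`() x); apply/funext => y; rewrite mulN1r.
Qed.

Lemma L2_derive1_subid f : lipschitzian f ->
  L2 (fun x => f^`() x - 1) <-> L2 (fun x => f x - x)^`().
Proof.
move=> lf; have lfi := lipschitzianB lf lipschitzian_id.
have m1 := lipschitzian_measurable_derive1 lf.
have m2 := lipschitzian_measurable_derive1 lfi.
split; apply: Lfun2_ae_eq => //.
- exact: derive1_subid.
- exact: measurable_funB.
- by apply: ae_imp (derive1_subid lf) => x ->.
Qed.

(** A homeomorphism at bounded distance from the identity is increasing, and
    its difference with the identity being Lipschitz gives both Lipschitz
    bounds. *)
Lemma relabellingP f : relabelling f <-> exists g,
  [/\ bilipschitz f g, exists C, forall x, `|f x - x| <= C & L2 (fun x => f x - x)^`()].
Proof.
split => [[g [[fK gK cf cg] [/(W1ooP chi)[lf' [C fC]] /(W1ooP chi)[lg' _] f2]]]|].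
  have lf : lipschitzian f.
    by have := lipschitzianD lf' lipschitzian_id; under eq_fun do rewrite subrK.
  have lg : lipschitzian g.
    by have := lipschitzianD lg' lipschitzian_id; under eq_fun do rewrite subrK.
  exists g; split; [|by exists C|exact/L2_derive1_subid].
  split => //.
  have C0 : 0 <= C by apply: le_trans (fC 0).
  have inj : {in `]-oo, +oo[ &, injective f} by move=> x y _ _; exact: (can_inj fK).
  have wcf : {within [set` `]-oo, +oo[], continuous f} by apply: continuous_subspaceT.
  have ex : exists x y : R, [/\ x \in `]-oo, +oo[, y \in `]-oo, +oo[, x < y & f x <= f y].
    exists 0, (C + C + 1); split => //; first by rewrite ltr_wpDl// addr_ge0.
    have := fC 0; have := fC (C + C + 1); rewrite !ler_norml => /andP[h1 _] /andP[_ h2].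
    by lra.
  move=> x y xy; rewrite (itv_continuous_inj_le ex wcf inj) ?in_itv//.
move=> [g [b [C fC] f2]]; have [fK gK nd lf lg] := b.
exists g; split; split => //; [exact: lipschitzian_cts|exact: lipschitzian_cts|..].
- apply/(W1ooP chi); split; first exact: lipschitzianB lipschitzian_id.
  by exists C.
- apply/(W1ooP chi); split; first exact: lipschitzianB lipschitzian_id.
  by exists C => x; rewrite -normrN opprB; have := fC (g x); rewrite gK.
- exact/L2_derive1_subid.
Qed.

Lemma bilipschitz_comp f g h k : bilipschitz f g -> bilipschitz h k ->
  bilipschitz (f \o h) (k \o g).
Proof.
move=> [fK gK nd lf lg] [hK kK nd' lh lk]; split => //=.
- by move=> x /=; rewrite fK.
- by move=> x /=; rewrite kK.
- by move=> x y xy /=; apply: nd; exact: nd'.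
- exact: lipschitzian_comp.
- exact: lipschitzian_comp.
Qed.

Lemma subid_comp f h : lipschitzian f -> lipschitzian h ->
  {ae mu, forall x, ((fun x => f x - x) \o h)^`() x + 1 * (fun x => h x - x)^`() x = ((fun x => (f \o h) x - x))^`() x}.
Proof.
move=> lf lh.
have l1 : lipschitzian ((fun x => f x - x) \o h).
  by apply: lipschitzian_comp lh; exact: lipschitzianB lipschitzian_id.
have l2 : lipschitzian (fun x => h x - x) by exact: lipschitzianB lipschitzian_id.
apply: ae_imp (derive1_linear 1 l1 l2) => x <-.
by congr (_^`() x); apply/funext => z; rewrite /= mul1r addrA subrK.
Qed.

Lemma relabelling_comp f h : relabelling f -> relabelling h -> relabelling (f \o h).
Proof.
move=> /relabellingP[g [bf [C fC] f2]] /relabellingP[k [bh [C' hC'] h2]].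
have lf := bl_lip bf; have lh := bl_lip bh.
have lfi : lipschitzian (fun x => f x - x) by exact: lipschitzianB lipschitzian_id.
apply/relabellingP; exists (k \o g); split; first exact: bilipschitz_comp.
  exists (C + C') => x /=; have -> : f (h x) - x = (f (h x) - h x) + (h x - x) by lra.
  by apply: (le_trans (ler_normD _ _)); rewrite lerD.
apply: (@Lfun2_ae_eq _ _ (fun x => ((fun x => f x - x) \o h)^`() x + (fun x => h x - x)^`() x)).
- apply: lipschitzian_measurable_derive1; apply: lipschitzianB lipschitzian_id.
  exact: lipschitzian_comp.
- by apply: ae_imp (subid_comp lf lh) => x <-; rewrite mul1r.
- by apply: Lfun2D => //; exact: L2_derive1_bicomp bh f2.
Qed.

Lemma relabelling_inv f g : bilipschitz f g -> relabelling f -> relabelling g.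
Proof.
move=> b /relabellingP[g' [b' [C fC] f2]].
have [fK gK _ lf lg] := b.
have lfi : lipschitzian (fun x => f x - x) by exact: lipschitzianB lipschitzian_id.
have gE : (fun x => g x - x) = (fun x => (-1) * ((fun x => f x - x) \o g) x).
  by apply/funext => x /=; rewrite gK; lra.
apply/relabellingP; exists f; split; first exact: bilipschitz_sym.
  by exists C => x; rewrite -normrN opprB; have := fC (g x); rewrite gK.
have lc : lipschitzian ((fun x => f x - x) \o g) by exact: lipschitzian_comp.
rewrite gE; apply: (@Lfun2_ae_eq _ _ (fun x => (-1) * ((fun x => f x - x) \o g)^`() x)).
- by apply: lipschitzian_measurable_derive1; exact: lipschitzianZ.
- have := derive1_linear (-1) (lipschitzian_cst 0) lc.
  apply: ae_imp => x; rewrite derive1_cst add0r => <-.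
  by congr (_^`() x); apply/funext => y; rewrite add0r.
- by apply: Lfun2Z; exact: L2_derive1_bicomp (bilipschitz_sym b) f2.
Qed.

(** Growth at least linear makes [h] onto, so that the partial inverse is an
    inverse. *)
Lemma expanding_bilipschitz h (c : R) : lipschitzian h -> 0 < c ->
  (forall x y, x <= y -> c * (y - x) <= h y - h x) ->
  bilipschitz h ('pinv_(fun=> 0) [set: R] h) /\
  lipschitz_with c^-1 ('pinv_(fun=> 0) [set: R] h).
Proof.
move=> lh c0 hc; set g := 'pinv_ _ _ h.
have nd : {homo h : x y / x <= y}.
  by move=> x y xy; rewrite -subr_ge0; apply: le_trans (hc _ _ xy); rewrite mulr_ge0 ?subr_ge0// ltW.
have inj : injective h.
  move=> x y hxy; apply/eqP; rewrite eq_le; apply/andP; split.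
    rewrite leNgt; apply/negP => yx; have := hc _ _ (ltW yx).
    by rewrite hxy subrr leNgt mulr_gt0 ?subr_gt0.
  rewrite leNgt; apply/negP => yx; have := hc _ _ (ltW yx).
  by rewrite hxy subrr leNgt mulr_gt0 ?subr_gt0.
have surj v : exists x, h x = v.
  pose b := `|v - h 0| / c.
  have b0 : 0 <= b by rewrite divr_ge0// ltW.
  have cb : c * b = `|v - h 0| by rewrite mulrC divfK// gt_eqF.
  have bb : - b <= b by rewrite (le_trans _ b0)// oppr_le0.
  have [||x _ <-] := @IVT R h (- b) b v bb.
  - by apply: continuous_subspaceT; exact: lipschitzian_cts.
  - rewrite (min_idPl (nd _ _ bb)) (max_idPr (nd _ _ bb)).
    have h1 := hc _ _ b0; have nb0 : - b <= 0 by rewrite oppr_le0.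
    have h2 := hc _ _ nb0; rewrite subr0 cb in h1; rewrite sub0r opprK cb in h2.
    have := ler_norm (v - h 0); have := ler_norm (- (v - h 0)); rewrite normrN.
    by move=> ? ?; apply/andP; split; lra.
  - by exists x.
have hgK : cancel h g by move=> x; apply: pinvKV; rewrite ?inE// => y z _ _; exact: inj.
have ghK : cancel g h by move=> v; have [x <-] := surj v; rewrite hgK.
have lg : lipschitz_with c^-1 g.
  have key u v : u <= v -> `|g u - g v| <= c^-1 * `|u - v|.
    move=> uv; have guv : g u <= g v.
      rewrite leNgt; apply/negP => vu; have := hc _ _ (ltW vu); rewrite !ghK.
      have : 0 < c * (g u - g v) by rewrite mulr_gt0// subr_gt0.
      by lra.
    rewrite distrC (distrC u) !ger0_norm ?subr_ge0// mulrC ler_pdivlMr// mulrC.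
    by have := hc _ _ guv; rewrite !ghK.
  move=> u v; have [uv|/ltW vu] := leP u v; first exact: key.
  by rewrite distrC (distrC u); exact: key.
split=> //; split => //; by exists c^-1.
Qed.

Lemma ae_expanding h (K : R) : lipschitzian h -> 0 < K -> {ae mu, forall x, 1 <= K * h^`() x} ->
  forall x y, x <= y -> K^-1 * (y - x) <= h y - h x.
Proof.
move=> lh K0 H x y xy.
have ln : lipschitzian (fun x : R => - x).
  by exists 1 => u v; rewrite mul1r -opprD normrN.
have l1 : lipschitzian (fun x => (- x) + K * h x).
  by apply: lipschitzianD => //; exact: lipschitzianZ.
have nd : {homo (fun x => (- x) + K * h x) : x y / x <= y}.
  apply: lipschitz_nondecreasing => //.
  apply: ae_imp (ae_and H (derive1_linear K ln lh)) => z [h1 ->].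
  have -> : (fun x : R => - x)^`() z = -1.
    by rewrite derive1E; apply: derive_val.
  by rewrite addrC subr_ge0.
by have /= := nd _ _ xy; rewrite ler_pdivrMl// mulrBr; lra.
Qed.

Variable alpha : R.
Implicit Types X Y : lag R.
Local Notation admissible := (admissible chip).

Lemma relabel_comp X f h : relabel (relabel X f) h = relabel X (f \o h).
Proof. by []. Qed.

Lemma relabel_derive1 X f g : lipschitzian (ly X) -> lipschitzian (lU X) -> lipschitzian (lH X) ->
  lipschitzian (lV X) -> bilipschitz f g ->
  {ae mu, forall x, 0 < f^`() x /\
    [/\ (ly (relabel X f))^`() x = (ly X)^`() (f x) * f^`() x,
        (lU (relabel X f))^`() x = (lU X)^`() (f x) * f^`() x,
        (lH (relabel X f))^`() x = (lH X)^`() (f x) * f^`() x &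
        (lV (relabel X f))^`() x = (lV X)^`() (f x) * f^`() x]}.
Proof.
move=> ly' lU' lH' lV' b; have [c c0 fc] := bilipschitz_derive1_gt0 b.
have H := ae_and (ae_and (derive1_bicomp ly' b) (derive1_bicomp lU' b))
  (ae_and (derive1_bicomp lH' b) (derive1_bicomp lV' b)).
apply: ae_imp H => x [[[df _ e1] [_ _ e2]] [[_ _ e3] [_ _ e4]]].
by split => //; exact: lt_le_trans (fc x df).
Qed.

Lemma admissible_relabel X f : admissible X -> relabelling f -> admissible (relabel X f).
Proof.
move=> aX /relabellingP[g [b [C fC] _]]; have [_ _ nd lf _] := b.
have [C' VC'] := adm_V_bd aX.
split => /=.
- exact: lipschitzian_comp (adm_y aX) lf.
- exact: lipschitzian_comp (adm_U aX) lf.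
- exact: lipschitzian_comp (adm_H aX) lf.
- exact: lipschitzian_comp (adm_V aX) lf.
- by move=> x y xy /=; apply: (adm_y_nd aX); exact: nd.
- by move=> x y xy /=; apply: (adm_V_nd aX); exact: nd.
- by exists C' => x; exact: VC'.
- exact (E1_comp chi (adm_V aX) b fC (adm_V_E1 aX)).
- have R1 := relabel_derive1 (adm_y aX) (adm_U aX) (adm_H aX) (adm_V aX) b.
  apply: ae_imp (ae_and R1 (bilipschitz_ae b (adm_eq aX))) => x [[_ [/= -> -> _ ->]]].
  by move=> e; rewrite exprMn -e expr2; lra.
Qed.

Section homogeneous.
Variables (X : lag R) (f g : R -> R).
Hypotheses (aX : admissible X) (b : bilipschitz f g).
Let Y := relabel X f.

(** A relabelling multiplies the three derivatives by [f^`()]. Weights that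
    are homogeneous of degree 0 are transported, and the factor on the energy
    density is the Jacobian. *)
Lemma relabel_energy_integral (k : R -> R -> R) (A : set R) :
  (forall (c p u : R), 0 < c -> k (p * c) (u * c) = k p u) ->
  measurable_fun setT (fun x => k ((ly X)^`() x) ((lU X)^`() x)) ->
  measurable_fun setT (fun x => k ((ly Y)^`() x) ((lU Y)^`() x)) ->
  measurable A ->
  \int[mu]_(z in f @^-1` A) ((lV Y)^`() z * k ((ly Y)^`() z) ((lU Y)^`() z)) =
  \int[mu]_(z in A) ((lV X)^`() z * k ((ly X)^`() z) ((lU X)^`() z)).
Proof.
move=> kc mX mY mA.
have lVY : lipschitzian (lV Y) by exact: lipschitzian_comp (adm_V aX) (bl_lip b).
have mV := lipschitzian_measurable_derive1 (adm_V aX).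
have mk : measurable_fun setT (fun z => (lV X)^`() z * k ((ly X)^`() z) ((lU X)^`() z)).
  exact: measurable_funM.
rewrite (bilipschitz_Rsubstitution b mk mA).
have mfA : measurable (f @^-1` A).
  by rewrite -[X in measurable X]setTI; exact: (bilipschitz_measurable b).
rewrite /Rintegral; congr fine; apply: ae_eq_integral => //.
- apply/measurable_EFinP; apply: (measurable_funS measurableT) => //; apply: measurable_funM => //.
  exact: lipschitzian_measurable_derive1.
- apply/measurable_EFinP; apply: (measurable_funS measurableT) => //; apply: measurable_funM => //.
    exact: (measurableT_comp mk (bilipschitz_measurable b)).
  exact: lipschitzian_measurable_derive1 (bl_lip b).
apply: ae_imp (relabel_derive1 (adm_y aX) (adm_U aX) (adm_H aX) (adm_V aX) b).
move=> x [f0 [-> -> _ ->]] _; congr EFin; rewrite kc//.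
by rewrite -!mulrA; congr (_ * _); rewrite mulrC.
Qed.
End homogeneous.

Lemma lostZ (c p u t : R) : 0 < c -> lost (p * c) (u * c) t = lost p u t.
Proof.
move=> c0; rewrite /lost pmulr_llt0//; case: ifP => // u0.
by rewrite mulrA -mulf_div divff ?mulr1// gt_eqF.
Qed.

Lemma surviveZ (c p u t : R) : 0 < c -> survive alpha (p * c) (u * c) t = survive alpha p u t.
Proof.
move=> c0; rewrite /survive pmulr_llt0//.
by rewrite (_ : 2 * (p * c) + t * (u * c) = (2 * p + t * u) * c) ?pmulr_lle0//; lra.
Qed.

Lemma relabel_Lag (a b c e : R -> R) f :
  relabel (Lag a b c e) f = Lag (a \o f) (b \o f) (c \o f) (e \o f).
Proof. by []. Qed.

Lemma Lag_ext (a b c e a' b' e' : R -> R) : a =1 a' -> b =1 b' -> e =1 e' ->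
  Lag a b c e = Lag a' b' c e'.
Proof. by move=> /funext -> /funext -> /funext ->. Qed.

(** The weights [survive], [mass1], [mass2] are homogeneous of degree 0 in [p]
    and [u], because breaking times do not depend on the parametrization. *)
Lemma evolve_relabel X f t : admissible X -> relabelling f ->
  evolve alpha (relabel X f) t = relabel (evolve alpha X t) f.
Proof.
move=> aX fG; have aY := admissible_relabel aX fG.
have [g [b _ _]] := (relabellingP f).1 fG.
have pre x : f @^-1` `]-oo, f x]%classic = `]-oo, x]%classic.
  by apply/seteqP; split => z /=; rewrite !in_itv/= (bilipschitz_le b).
have mX (Z : lag R) : admissible Z -> measurable_fun setT (ly Z)^`() /\ measurable_fun setT (lU Z)^`().
  by move=> aZ; split; apply: lipschitzian_measurable_derive1; [exact: adm_y aZ|exact: adm_U aZ].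
have [mp mu1] := mX _ aX; have [mpY muY] := mX _ aY.
have E1 (A : set R) : measurable A ->
    \int[mu]_(z in f @^-1` A) ((lV (relabel X f))^`() z * mass1X alpha (relabel X f) t z) =
    \int[mu]_(z in A) ((lV X)^`() z * mass1X alpha X t z).
  move=> mA; apply: (@relabel_energy_integral X f g aX b (fun p u => mass1 alpha p u t)) => //.
  - by move=> c p u c0; rewrite /mass1 lostZ.
  - exact: measurable_mass1.
  - exact: measurable_mass1.
have E2 (A : set R) : measurable A ->
    \int[mu]_(z in f @^-1` A) ((lV (relabel X f))^`() z * mass2X alpha (relabel X f) t z) =
    \int[mu]_(z in A) ((lV X)^`() z * mass2X alpha X t z).
  move=> mA; apply: (@relabel_energy_integral X f g aX b (fun p u => mass2 alpha p u t)) => //.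
  - by move=> c p u c0; rewrite /mass2 lostZ.
  - exact: measurable_mass2.
  - exact: measurable_mass2.
have pullE (w v : R -> R) x : (forall A, measurable A ->
    \int[mu]_(z in f @^-1` A) w z = \int[mu]_(z in A) v z) -> pull w x = pull v (f x).
  by move=> H; rewrite /pull -(pre x) (H _ (measurable_itv _)) -(H setT measurableT) preimage_setT.
have E0 (A : set R) : measurable A ->
    \int[mu]_(z in f @^-1` A) ((lV (relabel X f))^`() z * surviveX alpha (relabel X f) t z) =
    \int[mu]_(z in A) ((lV X)^`() z * surviveX alpha X t z).
  move=> mA; apply: (@relabel_energy_integral X f g aX b (fun p u => survive alpha p u t)) => //.
  - by move=> c p u c0; rewrite surviveZ.
  - exact: measurable_survive.
  - exact: measurable_survive.
rewrite /evolve relabel_Lag; apply: Lag_ext => x.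
- exact: (congr1 (fun r => ly X (f x) + t * lU X (f x) + r) (pullE _ _ x E2)).
- exact: (congr1 (fun r => lU X (f x) + r) (pullE _ _ x E1)).
- rewrite /comp; have := E0 _ (measurable_itv `]-oo, f x]); rewrite pre => e; exact: e.
Qed.
End Relabelling.

(** * The projection onto F0 *)

Section Projection.
Context {R : realType}.
Variables (alpha : R) (a01 : 0 <= alpha <= 1).
Variables (chim chip : R -> R) (chi : cutoffs chim chip).
Implicit Types (X : lag R) (f g h : R -> R) (t : R).
Local Notation mu := (@lebesgue_measure R).
Local Notation L2 f := (f \in Lfun mu 2%:E).
Local Notation F := (F alpha chim chip).
Local Notation F0 := (F0 alpha chim chip).

Definition label X x := ly X x + lH X x.
Definition unlabel X : R -> R := 'pinv_(fun=> 0) [set: R] (label X).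

Lemma F_lipschitzian X : F X -> [/\ lipschitzian (ly X), lipschitzian (lU X), lipschitzian (lH X) & lipschitzian (lV X)].
Proof. by move=> /(F_admissible chi)[]. Qed.

Lemma F_label X : F X ->
  [/\ lipschitzian (label X), E2 chim chip (fun x => label X x - x),
   exists C, forall x, `|label X x - x| <= C &
   {ae mu, forall x, (label X)^`() x = (ly X)^`() x + (lH X)^`() x}].
Proof.
move=> FX; have [l1 _ l3 _] := F_lipschitzian FX.
have [Ey _ EH _] := inF_B FX; rewrite /= in Ey EH.
have /(W1ooP chi)[lyi [Cy yC]] := inF_y FX.
have /(W1ooP chi)[_ [CH HC]] := inF_H FX.
have -> : (fun x => label X x - x) = (fun x => (ly X x - x) + 1 * lH X x).
  by apply/funext => x; rewrite /label mul1r addrAC.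
split; first exact: lipschitzianD.
- by apply: (E2_linear chi) => //; exact: E1_E2.
- exists (Cy + CH) => x; have -> : label X x - x = (ly X x - x) + lH X x by rewrite /label addrAC.
  by apply: (le_trans (ler_normD _ _)); rewrite lerD.
- apply: ae_imp (derive1_linear 1 l1 l3) => x; rewrite mul1r => <-.
  by congr (_^`() x); apply/funext => y; rewrite mul1r.
Qed.

Lemma label_expanding X : F X -> exists2 c : R, 0 < c &
  forall x y, x <= y -> c * (y - x) <= label X y - label X x.
Proof.
move=> FX; have [c c0 cX] := inF_gt0 FX; have [ll _ _ dl] := F_label FX.
exists c => //; rewrite -[c]invrK; apply: ae_expanding; rewrite ?invr_gt0//.
apply: ae_imp (ae_and cX dl) => x [h ->].
by rewrite ler_pdivlMl// mulr1 ltW.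
Qed.

Lemma label_bilipschitz X : F X -> bilipschitz (label X) (unlabel X).
Proof.
move=> FX; have [c c0 cX] := label_expanding FX; have [ll _ _ _] := F_label FX.
by have [] := expanding_bilipschitz ll c0 cX.
Qed.

Lemma label_relabelling X : F X -> relabelling (label X).
Proof.
move=> FX; have [ll E [C lC] _] := F_label FX.
apply/(relabellingP chi); exists (unlabel X); split; [exact: label_bilipschitz|by exists C|].
have li := lipschitzianB ll lipschitzian_id.
by have [] := (E2P chi li).1 E.
Qed.

Lemma unlabel_relabelling X : F X -> relabelling (unlabel X).
Proof.
by move=> FX; apply: (relabelling_inv chi (label_bilipschitz FX)); exact: label_relabelling.
Qed.

(** The condition on [f - id] in [E2] makes the limits of [y - id] at infinity
    exist after relabelling. *)
Lemma F_relabel X f g (C : R) : F X -> bilipschitz f g -> (forall x, `|f x - x| <= C) ->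
  E2 chim chip (fun x => f x - x) -> F (relabel X f).
Proof.
move=> FX b fC Ef; have [ly' lU' lH' lV'] := F_lipschitzian FX; have lf := bl_lip b.
have [Ey EU EH EV] := inF_B FX; rewrite /= in Ey EU EH EV.
have /(W1ooP chi)[lyi [Cy yC]] := inF_y FX.
have /(W1ooP chi)[_ [CU UC]] := inF_U FX.
have /(W1ooP chi)[_ [CH HC]] := inF_H FX.
have /(W1ooP chi)[_ [CV VC]] := inF_V FX.
have yE : (fun x => ly (relabel X f) x - x) = (fun x => ((fun x => ly X x - x) \o f) x + 1 * (f x - x)).
  by apply/funext => x /=; rewrite mul1r addrA subrK.
have lfi := lipschitzianB lf lipschitzian_id.
have lyf : lipschitzian ((fun x => ly X x - x) \o f) by exact: lipschitzian_comp.
have R1 := relabel_derive1 ly' lU' lH' lV' b.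
split.
- split; rewrite /=.
  + rewrite yE; apply: (E2_linear chi) => //; exact: (E2_comp chi lyi b fC).
  + exact: (E2_comp chi lU' b fC).
  + exact: (E1_comp chi lH' b fC).
  + exact: (E1_comp chi lV' b fC).
- apply/(W1ooP chi); split; first by rewrite yE; apply: lipschitzianD => //; exact: lipschitzianZ.
  exists (Cy + C) => x; rewrite [X in `|X|](congr1 (fun h => h x) yE) mul1r.
  by apply: (le_trans (ler_normD _ _)); rewrite lerD//; exact: yC.
- by apply/(W1ooP chi); split; [exact: lipschitzian_comp|exists CU => x; exact: UC].
- by apply/(W1ooP chi); split; [exact: lipschitzian_comp|exists CH => x; exact: HC].
- by apply/(W1ooP chi); split; [exact: lipschitzian_comp|exists CV => x; exact: VC].
- apply: ae_imp (ae_and R1 (bilipschitz_ae b (inF_ge0 FX))) => x [[f0 [-> _ -> _]] [h1 h2]].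
  by rewrite !mulr_ge0// ltW.
- have [c c0 cX] := inF_gt0 FX; have [e e0 fe] := bilipschitz_derive1_gt0 b.
  exists (c * e); first exact: mulr_gt0.
  apply: ae_imp (ae_and (lipschitzian_ae_derivable lf) (ae_and R1 (bilipschitz_ae b cX))).
  move=> x [df [[f0 [-> _ -> _]] h]].
  rewrite -mulrDl; apply: (@le_lt_trans _ _ (c * f^`() x)); first by rewrite ler_pM2l// fe.
  by rewrite ltr_pM2r.
- apply: ae_imp (ae_and R1 (bilipschitz_ae b (inF_eq FX))) => x [[f0 [-> -> _ ->]] h].
  by rewrite exprMn -h expr2; lra.
- apply: ae_imp (ae_and R1 (bilipschitz_ae b (inF_VH FX))) => x [[f0 [_ _ -> ->]] /andP[h1 h2]].
  by rewrite mulr_ge0 ?ler_wpM2r// ltW.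
- move=> a1; apply: ae_imp (ae_and R1 (bilipschitz_ae b (inF_alpha1 FX a1))).
  move=> x [[f0 [-> _ -> ->]] [h1 h2]]; split.
    by move/eqP; rewrite mulf_eq0 (gt_eqF f0) orbF => /eqP /h1 ->; rewrite mul0r.
  by rewrite pmulr_lgt0// => /h2 ->.
- move=> a1; have [kappa [k1 k2 k3]] := inF_alphalt1 FX a1.
  exists (fun x => if (lU (relabel X f))^`() x < 0 then 1 else kappa (f x)); split.
  + by move=> x; case: ifP => _; [right|exact: k1].
  + apply: ae_imp (ae_and R1 (bilipschitz_ae b k2)) => x [[f0 [_ -> -> ->]] h].
    case: ifPn => u0; last by rewrite h mulrA.
    by rewrite mul1r h k3 ?mul1r//; move: u0; rewrite pmulr_llt0.
  + by move=> x ->.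
Qed.

Lemma PiE X : Pi X = relabel X (unlabel X).
Proof. by []. Qed.

Lemma Pi_F0 X : F X -> F0 (Pi X).
Proof.
move=> FX; have b := label_bilipschitz FX; have [ll El [C lC] _] := F_label FX.
have [_ gK _ _ lg] := b.
split; last by move=> x; exact: gK.
have li := lipschitzianB ll lipschitzian_id.
have uC x : `|unlabel X x - x| <= C by rewrite -normrN opprB; have := lC (unlabel X x); rewrite gK.
apply: (F_relabel FX (bilipschitz_sym b) uC).
have := E2_linear chi (-1) (lipschitzian_cst 0) (lipschitzian_comp li lg) (E2_cst chi 0)
   (E2_comp chi li (bilipschitz_sym b) uC El).
by congr (E2 _ _ _); apply/funext => x /=; rewrite gK; lra.
Qed.

Lemma Pi_id X : F0 X -> Pi X = X.
Proof.
move=> [FX yH]; have [fK _ _ _ _] := label_bilipschitz FX.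
have u x : unlabel X x = x by rewrite -[in LHS](yH x); exact: fK.
by apply: lag_eq => x; rewrite /= -/(label X) -/(unlabel X) u.
Qed.

(** At time 0 the label is the identity, and [evolve_slope] bounds its slope
    at time [t] from below. *)
Lemma unlabel_evolve_lipschitz X t : F0 X -> 0 <= t ->
  lipschitz_with (1 + t + t ^+ 2 / 2) (unlabel (evolve alpha X t)).
Proof.
move=> [FX yH] t0; set K := 1 + t + _; have K0 : 0 < K.
  by rewrite /K !ltr_wpDr// ?mulr_ge0 ?invr_ge0 ?sqr_ge0.
have FXt := evolve_F a01 chi FX t0.
have [ll _ _ dl] := F_label FXt; have [_ _ _ dl0] := F_label FX.
have labE : label X = id by apply/funext => x; exact: yH.
have H : {ae mu, forall x, 1 <= K * (label (evolve alpha X t))^`() x}.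
  apply: ae_imp (ae_and dl0 (ae_and dl (evolve_slope a01 chi FX t0))) => x [e [-> h]].
  by move: h; rewrite -e labE derive1_id.
have Kc : 0 < K^-1 by rewrite invr_gt0.
have [_] := expanding_bilipschitz ll Kc (ae_expanding ll K0 H).
by rewrite invrK.
Qed.
End Projection.

(** * Norms *)

Section Norms.
Context {R : realType}.
Implicit Types (f g h k : R -> R) (c t : R).
Local Notation mu := (@lebesgue_measure R).

Lemma Lpnorm_ge0 p f : (0 <= Lpnorm p f)%E.
Proof. exact: Lnorm_ge0. Qed.

Lemma LpnormyE f : Lpnorm +oo f = ess_sup_inf.ess_sup mu (abse \o (EFin \o f)).
Proof. by rewrite /Lpnorm unlock /Lnorm lebesgue_setT_gt0. Qed.

Lemma Lpnormy_le f (M : \bar R) : (forall x, (`|f x|%:E <= M)%E) -> (Lpnorm +oo f <= M)%E.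
Proof. by move=> H; rewrite LpnormyE; apply/ess_sup_inf.ess_supP; exact: aeW. Qed.

Lemma le_Lpnormy f x : continuous f -> (`|f x|%:E <= Lpnorm +oo f)%E.
Proof.
move=> cf; have := Lpnorm_ge0 +oo f; have := lexx (Lpnorm +oo f).
rewrite {1}LpnormyE => /ess_sup_inf.ess_supP.
case: (Lpnorm +oo f) => [M H _|_ _|_]; [|by rewrite leey|by []].
rewrite lee_fin; apply: (ae_le_cts (f := fun x => `|f x|)).
  by move=> y; apply: cvg_norm; exact: cf.
by apply: ae_imp H => y; rewrite /= lee_fin.
Qed.

Lemma Lpnorm1E f : (Lpnorm 1%:E f = \int[mu]_x `|f x|%:E)%E.
Proof. exact: Lnorm1. Qed.

Lemma Lpnorm2E f : (Lpnorm 2%:E f = (\int[mu]_x (f x ^+ 2)%:E) `^ 2^-1)%E.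
Proof.
rewrite /Lpnorm unlock /=; congr poweR; apply: eq_integral => x _.
by rewrite /= powR_mulrn// real_normK// num_real.
Qed.

Lemma Lpnorm2_le f g c : 0 <= c ->
  (\int[mu]_x (f x ^+ 2)%:E <= (c ^+ 2)%:E * \int[mu]_x (g x ^+ 2)%:E)%E ->
  (Lpnorm 2%:E f <= c%:E * Lpnorm 2%:E g)%E.
Proof.
move=> c0 fg; have I0 h : (0 <= \int[mu]_x (h x ^+ 2)%:E)%E.
  by apply: integral_ge0 => x _; rewrite lee_fin sqr_ge0.
have cE : c%:E = ((c ^+ 2)%:E `^ 2^-1)%E.
  by rewrite poweR_EFin powR12_sqrt ?sqr_ge0// sqrtr_sqr ger0_norm.
rewrite !Lpnorm2E cE -poweRM//; last by rewrite lee_fin sqr_ge0.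
apply: gt0_ler_poweR => //.
- by rewrite in_itv/= I0 leey.
- by rewrite in_itv/= mule_ge0 ?lee_fin ?sqr_ge0// leey.
Qed.

Lemma Lpnorm2_ae_le f g c : measurable_fun setT f -> measurable_fun setT g -> 0 <= c ->
  {ae mu, forall x, `|f x| <= c * `|g x|} -> (Lpnorm 2%:E f <= c%:E * Lpnorm 2%:E g)%E.
Proof.
move=> mf mg c0 fg; apply: Lpnorm2_le => //.
have m2 (h : R -> R) : measurable_fun setT h -> measurable_fun setT (fun x => (h x ^+ 2)%:E).
  by move=> mh; apply/measurable_EFinP; exact: measurable_funX.
rewrite -ge0_integralZl//; [|exact: m2|by move=> x _; rewrite lee_fin sqr_ge0|by rewrite lee_fin sqr_ge0].
apply: ae_ge0_le_integral => //.
- by move=> x _; rewrite lee_fin sqr_ge0.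
- exact: m2.
- by move=> x _; rewrite mule_ge0// lee_fin sqr_ge0.
- apply: measurable_funeM; exact: m2.
- apply: ae_imp fg => x h _; rewrite -EFinM lee_fin -exprMn -real_normK ?num_real//.
  rewrite -[leRHS]real_normK ?num_real// lerXn2r ?nnegrE// normrM (ger0_norm c0) //.
Qed.

Lemma Lpnorm2D f g : measurable_fun setT f -> measurable_fun setT g ->
  (Lpnorm 2%:E (fun x => f x + g x)%R <= Lpnorm 2%:E f + Lpnorm 2%:E g)%E.
Proof. by move=> mf mg; apply: minkowski_EFin => //; rewrite ler1n. Qed.

Lemma Lpnorm2_combine h f g k (a b : R) : measurable_fun setT h ->
  measurable_fun setT f -> measurable_fun setT g -> measurable_fun setT k ->
  0 <= a -> 0 <= b ->
  {ae mu, forall x, `|h x| <= `|f x| + a * `|g x| + b * `|k x|} ->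
  (Lpnorm 2%:E h <= Lpnorm 2%:E f + a%:E * Lpnorm 2%:E g + b%:E * Lpnorm 2%:E k)%E.
Proof.
move=> mh mf mg mk a0 b0 H.
have mn (u : R -> R) : measurable_fun setT u -> measurable_fun setT (fun x => `|u x|).
  by move=> mu'; exact: measurableT_comp.
have norm_le (u : R -> R) c : measurable_fun setT u -> 0 <= c ->
    (Lpnorm 2%:E (fun x => c * `|u x|)%R <= c%:E * Lpnorm 2%:E u)%E.
  move=> mu' c0; apply: Lpnorm2_ae_le => //; first by apply: measurable_funM => //; exact: mn.
  by apply: aeW => x; rewrite normrM normr_id (ger0_norm c0).
have m1 : measurable_fun setT (fun x => 1 * `|f x|) by apply: measurable_funM => //; exact: mn.
have m2 : measurable_fun setT (fun x => a * `|g x|) by apply: measurable_funM => //; exact: mn.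
have m3 : measurable_fun setT (fun x => b * `|k x|) by apply: measurable_funM => //; exact: mn.
have m12 : measurable_fun setT (fun x => 1 * `|f x| + a * `|g x|) by exact: measurable_funD.
apply: (@le_trans _ _ (Lpnorm 2%:E (fun x => 1 * `|f x| + a * `|g x| + b * `|k x|)%R)).
  rewrite -[leRHS]mul1e; apply: Lpnorm2_ae_le => //; first exact: measurable_funD.
  apply: ae_imp H => x h1; rewrite !mul1r in h1 *; apply: (le_trans h1); exact: ler_norm.
apply: (le_trans (Lpnorm2D m12 m3)); apply: leeD; last exact: norm_le.
apply: (le_trans (Lpnorm2D m1 m2)); apply: leeD; last exact: norm_le.
by rewrite -[leRHS]mul1e; exact: norm_le.
Qed.

(** One factor [g^`()] of the square of [h] is the Jacobian, the other one is
    at most [c ^+ 2]. *)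
Lemma Lpnorm2_substitution h f g k c : measurable_fun setT h -> measurable_fun setT f ->
  bilipschitz g k -> 0 <= c -> lipschitz_with (c ^+ 2) g ->
  {ae mu, forall x, h x = f (g x) * g^`() x} ->
  (Lpnorm 2%:E h <= c%:E * Lpnorm 2%:E f)%E.
Proof.
move=> mh mf b c0 gL H; apply: Lpnorm2_le => //.
have m2 (u : R -> R) : measurable_fun setT u -> measurable_fun setT (fun x => (u x ^+ 2)%:E).
  by move=> mu'; apply/measurable_EFinP; exact: measurable_funX.
have mfg : measurable_fun setT (fun x => f (g x)) by exact: measurableT_comp (bilipschitz_measurable b).
have mg' := lipschitzian_measurable_derive1 (bl_lip b).
have g0 x : 0 <= g^`() x by exact: nondecreasing_derive1_ge0 (bl_nd b).
rewrite (ge0_bilipschitz_substitution b _ (m2 _ mf)); last by move=> x; rewrite lee_fin sqr_ge0.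
have mfg2 : measurable_fun setT (fun x => ((f (g x) ^+ 2)%:E * (g^`() x)%:E)%E).
  apply/measurable_EFinP; apply: measurable_funM => //; exact: measurable_funX.
have fg20 x : (0 <= ((f (g x) ^+ 2)%:E * (g^`() x)%:E))%E by rewrite mule_ge0 ?lee_fin ?sqr_ge0.
rewrite -ge0_integralZl//; last by rewrite lee_fin sqr_ge0.
apply: ae_ge0_le_integral => //.
- by move=> x _; rewrite lee_fin sqr_ge0.
- exact: m2.
- by move=> x _; rewrite mule_ge0// lee_fin sqr_ge0.
- exact: measurable_funeM.
- apply: ae_imp H => x -> _; rewrite -!EFinM lee_fin exprMn [in leRHS]mulrCA.
  rewrite ler_wpM2l ?sqr_ge0// expr2 ler_wpM2r//.
  by rewrite (le_trans (ler_norm _))// (lipschitz_with_derive1 x gL).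
Qed.

Lemma Lpnorm1_substitution h f g k : measurable_fun setT h -> measurable_fun setT f ->
  bilipschitz g k -> {ae mu, forall x, h x = f (g x) * g^`() x} ->
  Lpnorm 1%:E h = Lpnorm 1%:E f.
Proof.
move=> mh mf b H; rewrite !Lpnorm1E.
have mn (u : R -> R) : measurable_fun setT u -> measurable_fun setT (fun x => `|u x|%:E).
  by move=> mu'; apply/measurable_EFinP; exact: measurableT_comp.
have mfg : measurable_fun setT (fun x => f (g x)) by exact: measurableT_comp (bilipschitz_measurable b).
have mg' := lipschitzian_measurable_derive1 (bl_lip b).
rewrite (ge0_bilipschitz_substitution b _ (mn _ mf)); last by move=> x; rewrite lee_fin.
apply: ae_eq_integral => //; first exact: mn.
- by apply/measurable_EFinP; apply: measurable_funM => //; exact: measurableT_comp.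
- apply: ae_imp H => x -> _; rewrite normrM [X in _ * X]ger0_norm//.
  exact: nondecreasing_derive1_ge0 (bl_nd b).
Qed.

Lemma expR_ge2 t : 0 <= t -> 1 + t + t ^+ 2 / 2 <= expR t.
Proof.
move=> t0; have nd : {homo series (exp_coeff t) : n m / (n <= m)%N >-> n <= m}.
  by apply/nondecreasing_seqP => n; rewrite /series/= big_nat_recr//= lerDl exp_coeff_ge0.
have <- : series (exp_coeff t) 3 = 1 + t + t ^+ 2 / 2.
  rewrite /series/= !big_nat_recr//= big_nil exp_coeffE/= add0r expr0 expr1 !mulr1 invr1 mul1r.
  by rewrite [t ^+ 2 / 2]mulrC.
exact: nondecreasing_cvgn_le nd (is_cvg_series_exp_coeff t) 3.
Qed.
End Norms.

(** * Homogeneity and measurability of the gap *)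

Section GapFields.
Context {R : realType}.
Implicit Types p u w c t : R.

Lemma breakingZ p u c : 0 < c -> breaking (p * c) (u * c) = breaking p u.
Proof.
move=> c0; rewrite /breaking pmulr_llt0// !mulf_eq0 (gt_eqF c0) !orbF.
by case: ifP => // u0; rewrite mulrA -mulf_div divff ?mulr1// gt_eqF.
Qed.

Lemma gapZ p1 u1 w1 p2 u2 w2 c : 0 < c ->
  gap (p1 * c) (u1 * c) (w1 * c) (p2 * c) (u2 * c) (w2 * c) = gap p1 u1 w1 p2 u2 w2 * c.
Proof.
move=> c0; have sE : synchronous (p1 * c) (u1 * c) (p2 * c) (u2 * c) = synchronous p1 u1 p2 u2.
  by rewrite /synchronous !breakingZ// !pmulr_lge0.
rewrite /gap sE; case: ifP => _; first by rewrite -mulrBl normrM (gtr0_norm c0).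
by rewrite maxr_pMl// ltW.
Qed.

(** A decidable form, for measurability: the equality of the breaking times is
    cleared of its denominators. *)
Lemma synchronousE p1 u1 p2 u2 : 0 <= p1 -> 0 <= p2 ->
  synchronous p1 u1 p2 u2 <->
  ((0 <= u1) && (0 <= u2)) || ((((u1 < 0) && (u2 < 0)) && ((0 < p1) && (0 < p2))) && (p1 * u2 == p2 * u1)).
Proof.
move=> p10 p20; split.
  move=> [[-> ->//]|[b0 b12 boo]]; apply/orP; right.
  have u20 : u2 < 0 by apply: (@breaking_finite _ p2) => //; rewrite -b12.
  have u10 : u1 < 0 by apply: (@breaking_finite _ p1) => //; rewrite b12.
  move: b0 b12; rewrite /breaking u10 u20 => b0 [] b12.
  have b0' : 0 < - 2 * p2 / u2 by rewrite -b12.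
  have pos (p u : R) : 0 <= p -> u < 0 -> 0 < - 2 * p / u -> 0 < p.
    by move=> h0 u0; case: (ltgtP 0 p) h0 => // <- _; rewrite mulr0 mul0r ltxx.
  rewrite (pos _ _ p10 u10 b0) (pos _ _ p20 u20 b0') /=.
  move: b12; rewrite -!mulrA => b12.
  have r12 : p1 / u1 = p2 / u2 by lra.
  have e1 : p1 = p2 / u2 * u1 by rewrite -r12 divfK// lt_eqF.
  by rewrite e1 -mulrA (mulrC u1) mulrA divfK// lt_eqF.
move=> /orP[/andP[]|]; first by left.
move=> /andP[/andP[/andP[u10 u20] /andP[p1p p2p]] /eqP e]; right.
have b12 : - 2 * p1 / u1 = - 2 * p2 / u2.
  rewrite -!mulrA; congr (_ * _); apply/eqP.
  by rewrite eqr_div; [exact/eqP|rewrite lt_eqF|rewrite lt_eqF].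
rewrite /breaking u10 u20 b12; split=> //; last by rewrite ltry.
have -> : - 2 * p2 / u2 = 2 * p2 / (- u2) by rewrite invrN mulrN !mulNr.
by rewrite lte_fin divr_gt0 ?oppr_gt0// mulr_gt0.
Qed.

Lemma measurable_gap (p1 u1 w1 p2 u2 w2 : R -> R) :
  (forall x, 0 <= p1 x) -> (forall x, 0 <= p2 x) ->
  measurable_fun setT p1 -> measurable_fun setT u1 -> measurable_fun setT w1 ->
  measurable_fun setT p2 -> measurable_fun setT u2 -> measurable_fun setT w2 ->
  measurable_fun setT (fun x => gap (p1 x) (u1 x) (w1 x) (p2 x) (u2 x) (w2 x)).
Proof.
move=> p10 p20 m1 m2 m3 m4 m5 m6.
pose b x := ((0 <= u1 x) && (0 <= u2 x)) || ((((u1 x < 0) && (u2 x < 0)) && ((0 < p1 x) && (0 < p2 x))) && (p1 x * u2 x == p2 x * u1 x)).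
rewrite (_ : (fun x => _) = (fun x => if b x then `|w1 x - w2 x| else Num.max (w1 x) (w2 x))); last first.
  apply/funext => x; rewrite /gap; congr (if _ then _ else _).
  by apply/idP/idP => [/asboolP|h]; [|apply/asboolP]; rewrite synchronousE.
apply: measurable_fun_ifT.
- apply: measurable_or; first by apply: measurable_and; exact: measurable_fun_ler.
  apply: measurable_and; last by apply: measurable_fun_eqr; exact: measurable_funM.
  by apply: measurable_and; apply: measurable_and; exact: measurable_fun_ltr.
- by apply: measurableT_comp => //; exact: measurable_funB.
- exact: measurable_maxr.
Qed.

Lemma gap_dynamics_norm alpha p1 u1 w1 p2 u2 w2 t : 0 <= alpha <= 1 ->
  0 <= p1 -> 0 <= w1 -> p1 * w1 = u1 ^+ 2 ->
  0 <= p2 -> 0 <= w2 -> p2 * w2 = u2 ^+ 2 -> 0 <= t ->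
  `|gap (pt alpha p1 u1 w1 t) (ut alpha p1 u1 w1 t) (wt alpha p1 u1 w1 t)
        (pt alpha p2 u2 w2 t) (ut alpha p2 u2 w2 t) (wt alpha p2 u2 w2 t)| <=
  `|gap p1 u1 w1 p2 u2 w2|.
Proof.
move=> a01 p10 w10 e1 p20 w20 e2 t0; rewrite !ger0_norm ?gap_ge0//; first exact: gap_dynamics.
by have [_ /andP[]] := dynamics_invariant a01 p10 w10 e1 t0.
Qed.

Lemma gap_congr p1 u1 w1 p2 u2 w2 p1' u1' w1' p2' u2' w2' :
  p1 = p1' -> u1 = u1' -> w1 = w1' -> p2 = p2' -> u2 = u2' -> w2 = w2' ->
  gap p1 u1 w1 p2 u2 w2 = gap p1' u1' w1' p2' u2' w2'.
Proof. by move=> -> -> -> -> -> ->. Qed.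
End GapFields.

(** * The distance along relabelled and evolved data *)

Section Distance.
Context {R : realType}.
Variables (alpha : R) (a01 : 0 <= alpha <= 1).
Variables (chim chip : R -> R) (chi : cutoffs chim chip).
Implicit Types (X Y : lag R) (t : R).
Local Notation mu := (@lebesgue_measure R).
Local Notation admissible := (admissible chip).
Local Notation evolve := (evolve alpha).

Lemma G12E X Y x : G12 X Y x = gap ((ly X)^`() x) ((lU X)^`() x) ((lV X)^`() x)
  ((ly Y)^`() x) ((lU Y)^`() x) ((lV Y)^`() x).
Proof.
have sE : (x \in Omega X Y) = `[< synchronous ((ly X)^`() x) ((lU X)^`() x) ((ly Y)^`() x) ((lU Y)^`() x) >].
  by apply/idP/idP => [/set_mem|/asboolP] H; [apply/asboolP|apply/mem_set].
rewrite /G12 /gap !indicE in_setC sE.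
by case: ifP => _; rewrite /= ?(mulr1, mulr0, addr0, add0r).
Qed.

Lemma measurable_G12 X Y : admissible X -> admissible Y -> measurable_fun setT (G12 X Y).
Proof.
move=> aX aY; rewrite (funext (G12E X Y)).
apply: measurable_gap.
- move=> x; exact: nondecreasing_derive1_ge0 (adm_y_nd aX).
- move=> x; exact: nondecreasing_derive1_ge0 (adm_y_nd aY).
- exact: lipschitzian_measurable_derive1 (adm_y aX).
- exact: lipschitzian_measurable_derive1 (adm_U aX).
- exact: lipschitzian_measurable_derive1 (adm_V aX).
- exact: lipschitzian_measurable_derive1 (adm_y aY).
- exact: lipschitzian_measurable_derive1 (adm_U aY).
- exact: lipschitzian_measurable_derive1 (adm_V aY).
Qed.

Lemma admissible_fields X : admissible X -> {ae mu, forall x,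
  [/\ 0 <= (ly X)^`() x, 0 <= (lV X)^`() x & (ly X)^`() x * (lV X)^`() x = (lU X)^`() x ^+ 2]}.
Proof.
move=> aX; apply: ae_imp (adm_eq aX) => x e; split => //.
- exact: nondecreasing_derive1_ge0 (adm_y_nd aX).
- exact: nondecreasing_derive1_ge0 (adm_V_nd aX).
Qed.

Lemma cts_sub (f g : R -> R) : lipschitzian f -> lipschitzian g -> continuous (f \- g)%R.
Proof. by move=> lf lg; apply: lipschitzian_cts; exact: lipschitzianB. Qed.

(** The sup norms and the 1-norm are invariant under relabelling; the 2-norms
    gain the square root of the Lipschitz constant of [g]. *)
Lemma d_relabel_le X Y (g k : R -> R) (c : R) : admissible X -> admissible Y ->
  relabelling g -> bilipschitz g k -> 1 <= c -> lipschitz_with (c ^+ 2) g ->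
  (d (relabel X g) (relabel Y g) <= c%:E * d X Y)%E.
Proof.
move=> aX aY gG b c1 gL; have c0 : 0 <= c by rewrite (le_trans _ c1).
have aXg := admissible_relabel chi aX gG; have aYg := admissible_relabel chi aY gG.
have up (a a' : \bar R) : (0 <= a')%E -> (a <= a')%E -> (a <= c%:E * a')%E.
  move=> a0 aa; apply: (le_trans aa); rewrite -[leLHS]mul1e lee_wpmul2r// lee_fin//.
have sup (f h : R -> R) : lipschitzian f -> lipschitzian h ->
    (Lpnorm +oo ((f \o g) \- (h \o g))%R <= c%:E * Lpnorm +oo (f \- h)%R)%E.
  move=> lf lh; apply: up; first exact: Lpnorm_ge0.
  by apply: Lpnormy_le => x; exact: (le_Lpnormy (g x) (cts_sub lf lh)).
have RX := relabel_derive1 (adm_y aX) (adm_U aX) (adm_H aX) (adm_V aX) b.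
have RY := relabel_derive1 (adm_y aY) (adm_U aY) (adm_H aY) (adm_V aY) b.
have RR := ae_and RX RY.
have mG := measurable_G12 aX aY; have mGg := measurable_G12 aXg aYg.
have GG : {ae mu, forall x, G12 (relabel X g) (relabel Y g) x = G12 X Y (g x) * g^`() x}.
  apply: ae_imp RR => x [[g0 [e1 e2 _ e3]] [_ [e4 e5 _ e6]]].
  by rewrite !G12E e1 e2 e3 e4 e5 e6 gapZ.
have md Z : admissible Z -> measurable_fun setT (ly Z)^`() /\ measurable_fun setT (lU Z)^`().
  by move=> aZ; split; apply: lipschitzian_measurable_derive1; [exact: adm_y aZ|exact: adm_U aZ].
have [m1 m2] := md _ aX; have [m3 m4] := md _ aY.
have [m5 m6] := md _ aXg; have [m7 m8] := md _ aYg.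
have dy : (Lpnorm 2%:E ((ly (relabel X g))^`() \- (ly (relabel Y g))^`())%R <=
    c%:E * Lpnorm 2%:E ((ly X)^`() \- (ly Y)^`())%R)%E.
  apply: (Lpnorm2_substitution _ _ b c0 gL); [exact: measurable_funB|exact: measurable_funB|].
  by apply: ae_imp RR => x [[_ [e1 _ _ _]] [_ [e4 _ _ _]]]; rewrite /= e1 e4 mulrBl.
have dU : (Lpnorm 2%:E ((lU (relabel X g))^`() \- (lU (relabel Y g))^`())%R <=
    c%:E * Lpnorm 2%:E ((lU X)^`() \- (lU Y)^`())%R)%E.
  apply: (Lpnorm2_substitution _ _ b c0 gL); [exact: measurable_funB|exact: measurable_funB|].
  by apply: ae_imp RR => x [[_ [_ e1 _ _]] [_ [_ e4 _ _]]]; rewrite /= e1 e4 mulrBl.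
have dG1 : (Lpnorm 1%:E (G12 (relabel X g) (relabel Y g)) <= c%:E * Lpnorm 1%:E (G12 X Y))%E.
  by apply: up; [exact: Lpnorm_ge0|rewrite (Lpnorm1_substitution mGg mG b GG)].
have dG2 := Lpnorm2_substitution mGg mG b c0 gL GG.
have ge := @Lpnorm_ge0 R.
rewrite /d !ge0_muleDr ?adde_ge0//.
by rewrite !leeD// sup//; [exact: adm_y aX|exact: adm_y aY|exact: adm_U aX|exact: adm_U aY|exact: adm_H aX|exact: adm_H aY].
Qed.

Lemma pull_le (D : R -> R) x : mu.-integrable setT (EFin \o D) ->
  (`|pull D x|%:E <= 4^-1%:E * \int[mu]_z `|D z|%:E)%E.
Proof.
move=> iD; have mD : measurable_fun setT D by have /measurable_int/measurable_EFinP := iD.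
have iN : mu.-integrable setT (EFin \o (fun z => `|D z|)).
  by have := integrable_norm iD.
pose A : set R := `]-oo, x]%classic; pose B : set R := `]x, +oo[%classic.
have mA : measurable (A : set (measurableTypeR R)) by exact: measurable_itv.
have mB : measurable (B : set (measurableTypeR R)) by exact: measurable_itv.
have AB : A `|` B = setT.
  by rewrite /A /B; apply/seteqP; split => // z _ /=; rewrite !in_itv/= andbT; case: (leP z x); [left|right].
have dAB : [disjoint A & B].
  apply/disj_setPS; rewrite /A /B => z [] /=; rewrite !in_itv/= andbT => h1 h2.
  by move: (le_lt_trans h1 h2); rewrite ltxx.
have split (f : R -> R) : mu.-integrable setT (EFin \o f) ->
    \int[mu]_z f z = \int[mu]_(z in A) f z + \int[mu]_(z in B) f z.
  by move=> iF; rewrite -[in LHS]AB Rintegral_setU// AB.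
have fN : (\int[mu]_z `|D z|%:E \is a fin_num)%E by exact: integrable_fin_num.
rewrite -(fineK fN) -EFinM lee_fin -/(Rintegral mu setT (fun z => `|D z|)).
rewrite (split _ iN) /pull -/A (split _ iD).
have le1 (E : set R) : measurable (E : set (measurableTypeR R)) ->
    `|\int[mu]_(z in E) D z| <= \int[mu]_(z in E) `|D z|.
  move=> mE; apply: le_normr_Rintegral => //.
  by apply: integrableS iD.
have := le1 _ mA; have := le1 _ mB.
move: (Rintegral mu A D) (Rintegral mu B D) (Rintegral mu A _) (Rintegral mu B _) => a b a' b'.
rewrite !ler_norml => /andP[h1 h2] /andP[h3 h4]; apply/andP; split; lra.
Qed.

Lemma Lpnorm2_fields (f1 f2 y1 y2 u1 u2 a1 a2 G : R -> R) (s c : R) :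
  measurable_fun setT f1 -> measurable_fun setT f2 -> measurable_fun setT y1 ->
  measurable_fun setT y2 -> measurable_fun setT u1 -> measurable_fun setT u2 ->
  measurable_fun setT G -> 0 <= s -> 0 <= c -> (forall x, 0 <= G x) ->
  {ae mu, forall x, f1 x = y1 x + s * u1 x + 2^-1 * a1 x /\
                    f2 x = y2 x + s * u2 x + 2^-1 * a2 x} ->
  {ae mu, forall x, `|a1 x - a2 x| <= c * G x} ->
  (Lpnorm 2%:E (f1 \- f2)%R <= Lpnorm 2%:E (y1 \- y2)%R + s%:E * Lpnorm 2%:E (u1 \- u2)%R
     + (2^-1 * c)%:E * Lpnorm 2%:E G)%E.
Proof.
move=> mf1 mf2 my1 my2 mu1 mu2 mG s0 c0 G0 ff aa.
apply: Lpnorm2_combine; [exact: measurable_funB|exact: measurable_funB|exact: measurable_funB|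
  exact: mG|exact: s0|by rewrite mulr_ge0 ?invr_ge0|].
apply: ae_imp (ae_and ff aa) => x [[e1 e2] h] /=; rewrite e1 e2 (ger0_norm (G0 x)).
have -> : y1 x + s * u1 x + 2^-1 * a1 x - (y2 x + s * u2 x + 2^-1 * a2 x) =
  (y1 x - y2 x) + s * (u1 x - u2 x) + 2^-1 * (a1 x - a2 x) by lra.
apply: (le_trans (ler_normD _ _)); apply: lerD.
  by apply: (le_trans (ler_normD _ _)); rewrite lerD2l normrM (ger0_norm s0).
by rewrite normrM ger0_norm ?invr_ge0// -mulrA ler_wpM2l ?invr_ge0.
Qed.

Lemma expR_coefs t : 0 <= t ->
  [/\ 1 <= expR t, 1 + t <= expR t, 1 + (4^-1 * t + 8^-1 * t ^+ 2) <= expR t &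
      1 + (2^-1 * t + 4^-1 * t ^+ 2) <= expR t].
Proof.
move=> t0; have := expR_ge2 t0; have : 0 <= t ^+ 2 by rewrite sqr_ge0.
by move=> ? ?; split; lra.
Qed.

(** The sum of the bounds on the seven terms, whose coefficients are the left
    hand sides of [expR_coefs]. If one of the initial terms is infinite there
    is nothing to prove. *)
Lemma distance_terms (A B P Q H G1 G2 : \bar R) (a b p q h g1 g2 : \bar R) t : 0 <= t ->
  (0 <= A -> 0 <= B -> 0 <= P -> 0 <= Q -> 0 <= H -> 0 <= G1 -> 0 <= G2 ->
   a <= A + t%:E * B + (8^-1 * t ^+ 2)%:E * G1 ->
   b <= B + (4^-1 * t)%:E * G1 ->
   p <= P + t%:E * Q + (4^-1 * t ^+ 2)%:E * G2 ->
   q <= Q + (2^-1 * t)%:E * G2 -> h <= H -> g1 <= G1 -> g2 <= G2 ->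
   a + b + p + q + h + g1 + g2 <= (expR t)%:E * (A + B + P + Q + H + G1 + G2))%E.
Proof.
move=> t0 A0 B0 P0 Q0 H0 G10 G20 ha hb hp hq hh h1 h2.
have [->|Noo] := eqVneq (A + B + P + Q + H + G1 + G2)%E +oo%E.
  by rewrite gt0_muley ?leey// lte_fin expR_gt0.
have : (A + B + P + Q + H + G1 + G2)%E \is a fin_num.
  by rewrite ge0_fin_numE ?ltey// !adde_ge0.
rewrite !fin_numD => /andP[/andP[/andP[/andP[/andP[/andP[fA fB] fP] fQ] fH] fG1] fG2].
apply: (@le_trans _ _ ((A + t%:E * B + (8^-1 * t ^+ 2)%:E * G1) + (B + (4^-1 * t)%:E * G1)
  + (P + t%:E * Q + (4^-1 * t ^+ 2)%:E * G2) + (Q + (2^-1 * t)%:E * G2) + H + G1 + G2)%E).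
  by rewrite !leeD.
move: A0 B0 P0 Q0 H0 G10 G20.
rewrite -(fineK fA) -(fineK fB) -(fineK fP) -(fineK fQ) -(fineK fH) -(fineK fG1) -(fineK fG2).
move: (fine A) (fine B) (fine P) (fine Q) (fine H) (fine G1) (fine G2) => A' B' P' Q' H' G1' G2'.
rewrite -!EFinM -!EFinD !lee_fin => A0 B0 P0 Q0 H0 G10 G20.
have [c1 c2 c3 c4] := expR_coefs t0.
have k1 := ler_wpM2r A0 c1; have k2 := ler_wpM2r B0 c2; have k3 := ler_wpM2r P0 c1.
have k4 := ler_wpM2r Q0 c2; have k5 := ler_wpM2r H0 c1; have k6 := ler_wpM2r G10 c3.
have k7 := ler_wpM2r G20 c4.
lra.
Qed.

Lemma admissible_evolve X t : admissible X -> 0 <= t -> admissible (evolve X t).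
Proof.
move=> aX t0.
have [ly' dy] := evolve_y_derive1 a01 chi aX t0; have [lU' dU] := evolve_U_derive1 a01 chi aX t0.
have [_ lW _ bW EW] := admissible_dominated chi aX (measurable_surviveX alpha aX t) (surviveX_bounds a01 X t).
have [lV' dV] := evolve_V_derive1 a01 chi aX t.
have fields : {ae mu, forall x, [/\ 0 <= (ly (evolve X t))^`() x, 0 <= (lV (evolve X t))^`() x &
    (ly (evolve X t))^`() x * (lV (evolve X t))^`() x = (lU (evolve X t))^`() x ^+ 2]}.
  apply: ae_imp (ae_and (admissible_fields aX) (evolve_derive1 a01 chi aX t0)).
  move=> x [[p0 w0 e] [-> -> ->]].
  by have [h1 /andP[h2 _] h3] := dynamics_invariant a01 p0 w0 e t0.
split; [exact: ly'|exact: lU'|exact: adm_H aX|exact: lV'|..].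
- by apply: (lipschitz_nondecreasing ly'); apply: ae_imp fields => x [].
- by apply: (lipschitz_nondecreasing lV'); apply: ae_imp fields => x [].
- exists (\int[mu]_z ((lV X)^`() z * surviveX alpha X t z)) => x.
  by have /andP[h1 h2] := bW x; rewrite ger0_norm.
- exact: EW.
- by apply: ae_imp fields => x [].
Qed.

(** The forces on the two solutions differ by energies that [G12] controls,
    also after integration in time, by [mass1_gap] and [mass2_gap]. *)
Lemma d_evolve X Y t : admissible X -> admissible Y -> 0 <= t ->
  (d (evolve X t) (evolve Y t) <= (expR t)%:E * d X Y)%E.
Proof.
move=> aX aY t0.
have fX := admissible_fields aX; have fY := admissible_fields aY.
have eX := evolve_derive1 a01 chi aX t0; have eY := evolve_derive1 a01 chi aY t0.
have FF := ae_and (ae_and fX fY) (ae_and eX eY).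
have [lyX _] := evolve_y_derive1 a01 chi aX t0; have [lyY _] := evolve_y_derive1 a01 chi aY t0.
have [lUX _] := evolve_U_derive1 a01 chi aX t0; have [lUY _] := evolve_U_derive1 a01 chi aY t0.
have mG := measurable_G12 aX aY.
have v0 Z x : admissible Z -> 0 <= (lV Z)^`() x by move=> aZ; exact: nondecreasing_derive1_ge0 (adm_V_nd aZ).
have G0 x : 0 <= G12 X Y x by rewrite G12E; apply: gap_ge0; exact: v0.
have md Z : admissible Z -> [/\ measurable_fun setT (ly Z)^`(), measurable_fun setT (lU Z)^`() & measurable_fun setT (lV Z)^`()].
  by move=> aZ; split; apply: lipschitzian_measurable_derive1; [exact: adm_y aZ|exact: adm_U aZ|exact: adm_V aZ].
have [m1 m2 m3] := md _ aX; have [m4 m5 m6] := md _ aY.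
have pull_gap (k1 k2 : R -> R) (c b : R) x : 0 <= c ->
    measurable_fun setT k1 -> measurable_fun setT k2 ->
    (forall z, 0 <= k1 z <= b) -> (forall z, 0 <= k2 z <= b) ->
    {ae mu, forall z, `|(lV X)^`() z * k1 z - (lV Y)^`() z * k2 z| <= c * G12 X Y z} ->
    (`|pull (fun z => (lV X)^`() z * k1 z) x - pull (fun z => (lV Y)^`() z * k2 z) x|%:E <=
      (4^-1 * c)%:E * Lpnorm 1%:E (G12 X Y))%E.
  move=> c0 mk1 mk2 kb1 kb2 H.
  have [i1 _ _ _ _] := admissible_dominated chi aX mk1 kb1.
  have [i2 _ _ _ _] := admissible_dominated chi aY mk2 kb2.
  have iD : mu.-integrable setT (EFin \o (fun z => (lV X)^`() z * k1 z - (lV Y)^`() z * k2 z)).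
    by have := integrableB measurableT i1 i2.
  have -> : pull (fun z => (lV X)^`() z * k1 z) x - pull (fun z => (lV Y)^`() z * k2 z) x =
      pull (fun z => (lV X)^`() z * k1 z - (lV Y)^`() z * k2 z) x.
    rewrite /pull RintegralB//; [rewrite RintegralB//; lra|..]; apply: integrableS (measurableT) _ _ _ => //.
  apply: (le_trans (pull_le x iD)); rewrite EFinM -muleA lee_wpmul2l ?lee_fin ?invr_ge0//.
  rewrite Lpnorm1E -ge0_integralZl//; last by apply/measurable_EFinP; exact: measurableT_comp.
  apply: ae_ge0_le_integral => //.
  - apply/measurable_EFinP; apply: measurableT_comp => //.
    by apply: measurable_funB; exact: measurable_funM.
  - by move=> z _; rewrite mule_ge0.
  - by apply: measurable_funeM; apply/measurable_EFinP; exact: measurableT_comp.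
  - by apply: ae_imp H => z h _; rewrite -EFinM lee_fin (ger0_norm (G0 z)).
have H1 : {ae mu, forall z, `|(lV X)^`() z * mass1X alpha X t z - (lV Y)^`() z * mass1X alpha Y t z| <= t * G12 X Y z}.
  apply: ae_imp FF => z [[[p0 w0 e] [p0' w0' e']] _]; rewrite G12E.
  exact: mass1_gap.
have H2 : {ae mu, forall z, `|(lV X)^`() z * mass2X alpha X t z - (lV Y)^`() z * mass2X alpha Y t z| <= t ^+ 2 / 2 * G12 X Y z}.
  apply: ae_imp FF => z [[[p0 w0 e] [p0' w0' e']] _]; rewrite G12E.
  exact: mass2_gap.
have g1G : {ae mu, forall x, `|G12 (evolve X t) (evolve Y t) x| <= 1 * `|G12 X Y x|}.
  apply: ae_imp FF => x [[[p0 w0 e] [p0' w0' e']] [[e1 e2 e3] [e4 e5 e6]]].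
  rewrite mul1r (etrans (G12E _ _ x) (gap_congr e1 e2 e3 e4 e5 e6)) (G12E X Y).
  exact: (gap_dynamics_norm a01 p0 w0 e p0' w0' e' t0).
have mGt : measurable_fun setT (G12 (evolve X t) (evolve Y t)).
  exact: measurable_G12 (admissible_evolve aX t0) (admissible_evolve aY t0).
apply: (distance_terms t0); try exact: Lpnorm_ge0.
- apply: Lpnormy_le => x /=.
  have h1 := le_Lpnormy x (cts_sub (adm_y aX) (adm_y aY)).
  have h2 := le_Lpnormy x (cts_sub (adm_U aX) (adm_U aY)).
  have t20 : 0 <= t ^+ 2 / 2 by rewrite mulr_ge0 ?sqr_ge0 ?invr_ge0.
  have h3 := pull_gap _ _ _ _ x t20 (measurable_mass2X alpha aX t) (measurable_mass2X alpha aY t)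
    (fun z => mass2X_bounds a01 aX z t0) (fun z => mass2X_bounds a01 aY z t0) H2.
  have -> : 8^-1 * t ^+ 2 = 4^-1 * (t ^+ 2 / 2) by lra.
  have h2' : (t%:E * `|(lU X \- lU Y)%R x|%:E <= t%:E * Lpnorm +oo (lU X \- lU Y)%R)%E.
    by rewrite lee_wpmul2l.
  apply: le_trans (leeD (leeD h1 h2') h3); rewrite -EFinM -!EFinD lee_fin /=.
  move: (pull _ x) (pull _ x) (ly X x) (ly Y x) (lU X x) (lU Y x) => b a y1 y2 u1 u2.
  have -> : y1 + t * u1 + a - (y2 + t * u2 + b) = (y1 - y2) + t * (u1 - u2) + (a - b) by lra.
  apply: (le_trans (ler_normD _ _)); rewrite lerD2r.
  by apply: (le_trans (ler_normD _ _)); rewrite lerD2l normrM (ger0_norm t0).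
- apply: Lpnormy_le => x /=.
  have h2 := le_Lpnormy x (cts_sub (adm_U aX) (adm_U aY)).
  have h3 := pull_gap _ _ _ _ x t0 (measurable_mass1X alpha aX t) (measurable_mass1X alpha aY t)
    (fun z => mass1X_bounds a01 aX z t0) (fun z => mass1X_bounds a01 aY z t0) H1.
  apply: le_trans (leeD h2 h3); rewrite -EFinD lee_fin /=.
  move: (pull _ x) (pull _ x) (lU X x) (lU Y x) => b a u1 u2.
  have -> : u1 + a - (u2 + b) = (u1 - u2) + (a - b) by lra.
  exact: ler_normD.
- have -> : 4^-1 * t ^+ 2 = 2^-1 * (t ^+ 2 / 2) by lra.
  apply: (@Lpnorm2_fields _ _ _ _ _ _ (fun z => (lV X)^`() z * mass2X alpha X t z)
    (fun z => (lV Y)^`() z * mass2X alpha Y t z)); [exact: lipschitzian_measurable_derive1|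
    exact: lipschitzian_measurable_derive1|exact: m1|exact: m4|exact: m2|exact: m5|exact: mG|
    exact: t0|by rewrite mulr_ge0 ?sqr_ge0 ?invr_ge0|exact: G0| |exact: H2].
  by apply: ae_imp (ae_and eX eY) => x [[e1 _ _] [e2 _ _]].
- rewrite -[X in (X + _)%E]adde0 -[X in (_ + X + _)%E](mul0e (Lpnorm 2%:E ((lU X)^`() \- (lU Y)^`())%R)).
  apply: (@Lpnorm2_fields _ _ _ _ _ _ (fun z => (lV X)^`() z * mass1X alpha X t z)
    (fun z => (lV Y)^`() z * mass1X alpha Y t z)); [exact: lipschitzian_measurable_derive1|
    exact: lipschitzian_measurable_derive1|exact: m2|exact: m5|exact: m2|exact: m5|exact: mG|
    exact: lexx|exact: t0|exact: G0| |exact: H1].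
  by apply: ae_imp (ae_and eX eY) => x [[_ e1 _] [_ e2 _]]; rewrite !mul0r !addr0.
- exact: lexx.
- rewrite !Lpnorm1E; apply: ae_ge0_le_integral.
  + exact: measurableT.
  + by move=> x _; rewrite lee_fin.
  + by apply/measurable_EFinP; exact: (measurableT_comp (@normr_measurable _ _) mGt).
  + by move=> x _; rewrite lee_fin.
  + by apply/measurable_EFinP; exact: (measurableT_comp (@normr_measurable _ _) mG).
  + by apply: ae_imp g1G => x h _; rewrite lee_fin -[leRHS]mul1r.
- rewrite -[leRHS]mul1e; exact: Lpnorm2_ae_le mGt mG ler01 g1G.
Qed.
End Distance.

(** * The estimate for the metric *)

Section Contraction.
Context {R : realType}.
Variables (alpha : R) (a01 : 0 <= alpha <= 1).
Variables (chim chip : R -> R) (chi : cutoffs chim chip).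
Implicit Types (X Y Z : lag R) (f g : R -> R) (t : R).
Local Notation admissible := (admissible chip).
Local Notation F := (F alpha chim chip).
Local Notation F0 := (F0 alpha chim chip).
Local Notation evolve := (evolve alpha).

Lemma le_ereal_inf_scale (S : set (\bar R)) (M : \bar R) (c : R) : 0 < c ->
  (forall e, S e -> (M <= c%:E * e)%E) -> (M <= c%:E * ereal_inf S)%E.
Proof.
move=> c0 H; rewrite -lee_pdivrMl//; apply: le_ereal_inf_tmp => e Se.
by rewrite lee_pdivrMl//; exact: H.
Qed.

(** The evolution costs the factor [expR t], and the normalization at time
    [t], whose Lipschitz constant is at most [expR t], its square root. *)
Lemma d_relabel_evolve X Y Z t : F0 Z -> admissible X -> admissible Y -> 0 <= t ->
  (d (relabel (evolve X t) (unlabel (evolve Z t))) (relabel (evolve Y t) (unlabel (evolve Z t)))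
   <= (expR (3 / 2 * t))%:E * d X Y)%E.
Proof.
move=> F0Z aX aY t0; have FZt := evolve_F a01 chi F0Z.1 t0.
have c1 : 1 <= expR (t / 2) by rewrite (le_trans _ (expR_ge1Dx _))// lerDl divr_ge0.
have c2 : expR (t / 2) ^+ 2 = expR t by rewrite -expRM_natl; congr expR; lra.
have gL : lipschitz_with (expR (t / 2) ^+ 2) (unlabel (evolve Z t)).
  move=> x y; apply: (le_trans (unlabel_evolve_lipschitz a01 chi F0Z t0 x y)).
  by rewrite ler_wpM2r// c2 expR_ge2.
apply: (le_trans (d_relabel_le chi (admissible_evolve a01 chi aX t0) (admissible_evolve a01 chi aY t0)
  (unlabel_relabelling chi FZt) (bilipschitz_sym (label_bilipschitz chi FZt)) c1 gL)).
have -> : expR (3 / 2 * t) = expR (t / 2) * expR t by rewrite -expRD; congr expR; lra.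
rewrite EFinM -muleA; apply: lee_wpmul2l; first by rewrite lee_fin expR_ge0.
exact: (d_evolve a01 chi aX aY t0).
Qed.

Lemma relabel_Pi X (f : R -> R) : F X ->
  relabel (Pi X) (label X \o f) = relabel X f.
Proof.
move=> FX; have [fK _ _ _ _] := label_bilipschitz chi FX.
rewrite PiE relabel_comp; congr relabel; apply/funext => x /=; exact: fK.
Qed.

Lemma d_ge0 X Y : (0 <= d X Y)%E.
Proof. by rewrite /d !adde_ge0 ?Lpnorm_ge0. Qed.

Lemma leeD_scaled (P Q V1 V2 W1 W2 X1 X2 Y1 Y2 : lag R) (c : R) : W1 = V1 -> W2 = V2 ->
  (d P V1 <= c%:E * d X1 X2)%E -> (d V2 Q <= c%:E * d Y1 Y2)%E ->
  (d P W1 + d W2 Q <= c%:E * (d X1 X2 + d Y1 Y2))%E.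
Proof. by move=> -> -> h1 h2; rewrite ge0_muleDr ?d_ge0//; exact: leeD. Qed.

(** A pair of relabellings [f], [g] for [X], [Y] becomes the pair [f'], [g']
    for the projected solutions: these undo one projection, relabel as before
    and perform the other projection. *)
Lemma J_evolve X Y t : F0 X -> F0 Y -> 0 <= t ->
  (J (Pi (evolve X t)) (Pi (evolve Y t)) <= (expR (3 / 2 * t))%:E * J X Y)%E.
Proof.
move=> F0X F0Y t0; have aX := F_admissible chi F0X.1; have aY := F_admissible chi F0Y.1.
have FXt := evolve_F a01 chi F0X.1 t0; have FYt := evolve_F a01 chi F0Y.1 t0.
apply: le_ereal_inf_scale; first exact: expR_gt0.
move=> _ [f fG [g gG <-]].
have aYf := admissible_relabel chi aY fG; have aXg := admissible_relabel chi aX gG.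
pose f' := label (evolve Y t) \o (f \o unlabel (evolve X t)).
pose g' := label (evolve X t) \o (g \o unlabel (evolve Y t)).
have f'G : relabelling f'.
  apply: (relabelling_comp chi (label_relabelling chi FYt)); apply: (relabelling_comp chi fG).
  exact: unlabel_relabelling FXt.
have g'G : relabelling g'.
  apply: (relabelling_comp chi (label_relabelling chi FXt)); apply: (relabelling_comp chi gG).
  exact: unlabel_relabelling FYt.
apply: (@le_trans _ _ (d (Pi (evolve X t)) (relabel (Pi (evolve Y t)) f') +
   d (relabel (Pi (evolve X t)) g') (Pi (evolve Y t)))%E).
  by apply: ereal_inf_lbound; exists f' => //; exists g'.
have E1 : relabel (Pi (evolve Y t)) f' = relabel (evolve (relabel Y f) t) (unlabel (evolve X t)).
  by rewrite (evolve_relabel chi alpha t aY fG) relabel_comp; exact: relabel_Pi FYt.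
have E2 : relabel (Pi (evolve X t)) g' = relabel (evolve (relabel X g) t) (unlabel (evolve Y t)).
  by rewrite (evolve_relabel chi alpha t aX gG) relabel_comp; exact: relabel_Pi FXt.
have I1 : (d (Pi (evolve X t)) (relabel (evolve (relabel Y f) t) (unlabel (evolve X t))) <=
  (expR (3 / 2 * t))%:E * d X (relabel Y f))%E := d_relabel_evolve F0X aX aYf t0.
have I2 : (d (relabel (evolve (relabel X g) t) (unlabel (evolve Y t))) (Pi (evolve Y t)) <=
  (expR (3 / 2 * t))%:E * d (relabel X g) Y)%E := d_relabel_evolve F0Y aXg aY t0.
exact: leeD_scaled E1 E2 I1 I2.
Qed.
End Contraction.

Theorem theorem3p7 (R : realType) (alpha : R) (chim chip : R -> R)
    (XA XB : R -> lag R) :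
  0 <= alpha <= 1 -> cutoffs chim chip ->
  lag_solution alpha chim chip XA -> lag_solution alpha chim chip XB ->
  F0 alpha chim chip (XA 0) -> F0 alpha chim chip (XB 0) ->
  forall t : R, 0 <= t ->
    (dF alpha chim chip (XA t) (XB t) <=
     (expR (3 / 2 * t))%:E * dF alpha chim chip (XA 0%R) (XB 0%R))%E.
Proof.
move=> a01 chi [sA _] [sB _] FA FB t t0.
rewrite (lag_system_evolve a01 chi sA (F_admissible chi FA.1) t0).
rewrite (lag_system_evolve a01 chi sB (F_admissible chi FB.1) t0).
apply: le_ereal_inf_scale; first exact: expR_gt0.
move=> _ [N [X [FX X0 XN ->]]].
rewrite (Pi_id chi FA) in X0; rewrite (Pi_id chi FB) in XN.
apply: (@le_trans _ _ (\sum_(1 <= n < N.+1) J (Pi (evolve alpha (X n) t)) (Pi (evolve alpha (X n.-1) t)))%E).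
  apply: ereal_inf_lbound; exists N, (fun n => Pi (evolve alpha (X n) t)); split.
  - move=> n nN; apply: (Pi_F0 chi); exact: (evolve_F a01 chi (FX n nN).1 t0).
  - exact: (congr1 (fun Z => Pi (evolve alpha Z t)) X0).
  - exact: (congr1 (fun Z => Pi (evolve alpha Z t)) XN).
  - exact: erefl.
rewrite ge0_sume_distrr; last first.
  move=> n _; apply: le_ereal_inf_tmp => _ [f _ [g _ <-]].
  by rewrite adde_ge0// d_ge0.
rewrite big_nat [leRHS]big_nat; apply: lee_sum => n /andP[n1 nN].
apply: (J_evolve a01 chi) => //; apply: FX => //.
by rewrite (leq_trans (leq_pred n)).
Qed.
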